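(* Let the standing assumptions of the context hold (in particular (A1)–(A3)), let $\rho>0$ satisfy $\gamma_1-\rho>K$, and let the scale parameter $\varepsilon$ satisfy $$0<\varepsilon<\frac{\rho}{\gamma_2+\dfrac{1}{\frac1K-\frac1{\gamma_1-\rho}}}\qquad\text{and}\qquad\kappa_*(K,\gamma_1,\gamma_2,\rho,\varepsilon)<1,$$ where $$\kappa_*(K,\gamma_1,\gamma_2,\rho,\varepsilon)=\frac{K}{\gamma_1-\rho}+\frac{\varepsilon K}{\rho-\varepsilon\gamma_2}+\frac{K^2}{(\gamma_1-\rho)\left(\frac\rho\varepsilon-\gamma_2\right)\left[1-K\left(\frac1{\gamma_1-\rho}+\frac\varepsilon{\rho-\varepsilon\gamma_2}\right)\right]}.$$ Then, as $\mu$ tends to zero, a solution of the original system can be approximated by a corresponding solution of the reduced system $$\dot{\tilde v}^\varepsilon=B\tilde v^\varepsilon+g(\tilde u^\varepsilon,\tilde v^\varepsilon),\qquad\tilde u^\varepsilon=h^{\mu,\varepsilon}(\theta_t\omega,\tilde v^\varepsilon),$$ in the following sense: for each initial state $\zeta\in\mathbb H$ of the original system there is a corresponding initial state $\bar\zeta$ on the Wong-Zakai random slow manifold $\mathcal M^{\mu,\varepsilon}(\omega)$ such that $$\|w^\varepsilon(t,\omega,\zeta)-\tilde w^\varepsilon(t,\omega,\bar\zeta)\|_{\mathbb H}\le C_1e^{-C_2t}\|\zeta-\bar\zeta\|_{\mathbb H}+o(\mu^\alpha),\quad\text{a.s. for every }t\ge0,$$ where $\tilde w^\varepsilon(t,\omega,\bar\zeta)=(\tilde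 u^\varepsilon(t),\tilde v^\varepsilon(t))$ is the solution of the reduced system with initial state $\bar\zeta$, $C_1=\dfrac{1}{1-K\left(\frac1{\gamma_1-\rho}+\frac\varepsilon{\rho-\varepsilon\gamma_2}\right)}$, $C_2=\dfrac\rho\varepsilon$, and $\alpha\in(0,\tfrac12)$.
   Context: Spaces: $\mathbb H_1,\mathbb H_2$ are separable Hilbert spaces, $\mathbb H=\mathbb H_1\times\mathbb H_2$ with norm $\|\cdot\|_{\mathbb H}=\|\cdot\|_{\mathbb H_1}+\|\cdot\|_{\mathbb H_2}$. Standing assumptions: (A1) $A$ generates a $C_0$-semigroup $e^{At}$ on $\mathbb H_1$ with $\|e^{At}x\|_{\mathbb H_1}\le e^{-\gamma_1t}\|x\|_{\mathbb H_1}$ for $t\ge0$, $x\in\mathbb H_1$, and $B$ generates a $C_0$-group $e^{Bt}$ on $\mathbb H_2$ with $\|e^{Bt}y\|_{\mathbb H_2}\le e^{-\gamma_2t}\|y\|_{\mathbb H_2}$ for $t\le0$, $y\in\mathbb H_2$, for some positive constants $\gamma_1,\gamma_2$. (A2) $f:\mathbb H\to\mathbb H_1$ and $g:\mathbb H\to\mathbb H_2$ are continuous with $f(0,0)=0$, $g(0,0)=0$, and there is $K>0$ such that $\|f(x_1,y_1)-f(x_2,y_2)\|_{\mathbb H_1}$ and $\|g(x_1,y_1)-g(x_2,y_2)\|_{\mathbb H_2}$ are both at most $K(\|x_1-x_2\|_{\mathbb H_1}+\|y_1-y_2\|_{\mathbb H_2})$ for all $(x_i,y_i)\in\mathbb H$.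 (A3) $K<\gamma_1$. The noise intensity $\sigma$ is an element of the domain $D(A)\subset\mathbb H_1$, with $\|A\sigma\|_{\mathbb H_1}<\infty$. Noise: $B_t(\omega)=\omega(t)$ is a one-dimensional two-sided Brownian motion (not to be confused with the operator $B$) on the canonical space $C_0(\mathbb R,\mathbb R)$ of continuous functions vanishing at $0$, with Borel $\sigma$-algebra and Wiener measure $\mathbb P$. The Wiener shift is $\theta_t\omega(s)=\omega(t+s)-\omega(t)$. The space is restricted to a measurable, $(\theta_t)$-invariant subset $\Omega$ of full measure on which the usual sublinear growth properties $B_t(\omega)/t\to0$ and, for each $\mu>0$, $z^\mu(\theta_t\omega)/t\to0$ as $t\to\pm\infty$ hold. For $\mu>0$ the stationary Ornstein–Uhlenbeck process is $z^\mu(\theta_t\omega)=z^\mu_t(\omega)=\frac1\mu\int_{-\infty}^te^{-(t-s)/\mu}\,\mathrm dB_s(\omega)$, and the integrated O-U process is $\Phi^\mu_t(\omega)=\int_0^tz^\mu(\theta_s\omega)\,\mathrm ds$, so $\dot\Phi^\mu_t(\omega)=z^\mu_t(\omega)$. Systems: the original system is $$\dot u^\varepsilon=\tfrac1\varepsilon Au^\varepsilon+\tfrac1\varepsilon f(u^\varepsilon,v^\varepsilon)+\tfrac\sigma{\sqrt\varepsilon}\dot B_t(\omega)\ \text{in }\mathbb H_1,\qquad\dot v^\varepsilon=Bv^\varepsilon+g(u^\varepsilon,v^\varepsilon)\ \text{in }\mathbb H_2,$$ and the Wong-Zakai system is $$\dot x^{\mu,\varepsilon}=\tfrac1\varepsilon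 Ax^{\mu,\varepsilon}+\tfrac1\varepsilon f(x^{\mu,\varepsilon},y^{\mu,\varepsilon})+\tfrac\sigma{\sqrt\varepsilon}\dot\Phi^\mu_t(\omega)\ \text{in }\mathbb H_1,\qquad\dot y^{\mu,\varepsilon}=By^{\mu,\varepsilon}+g(x^{\mu,\varepsilon},y^{\mu,\varepsilon})\ \text{in }\mathbb H_2.$$ Their mild solutions (variation of constants) with value $\zeta\in\mathbb H$ at $t=0$ are denoted $w^\varepsilon(t,\omega,\zeta)=(u^\varepsilon(t),v^\varepsilon(t))$ and $z^{\mu,\varepsilon}(t,\omega,\zeta)=(x^{\mu,\varepsilon}(t),y^{\mu,\varepsilon}(t))$. Function space: $C^{-}_{-\rho/\varepsilon}$ is the Banach space of pairs $(x,y)$ of continuous functions $x:(-\infty,0]\to\mathbb H_1$, $y:(-\infty,0]\to\mathbb H_2$ with finite norm $\sup_{t\le0}e^{\frac\rho\varepsilon t}\|x(t)\|_{\mathbb H_1}+\sup_{t\le0}e^{\frac\rho\varepsilon t}\|y(t)\|_{\mathbb H_2}$. Wong-Zakai random slow manifold: $\mathcal M^{\mu,\varepsilon}(\omega)=\{\zeta\in\mathbb H:z^{\mu,\varepsilon}(\cdot,\omega,\zeta)\in C^-_{-\rho/\varepsilon}\}$, where membership means that there is a mild solution on $(-\infty,0]$ with value $\zeta$ at time $0$ lying in $C^-_{-\rho/\varepsilon}$. Under the stated conditions on $\varepsilon$ it is the graph $\{(h^{\mu,\varepsilon}(\omega,\xi),\xi):\xi\in\mathbb H_2\}$ of a function $h^{\mu,\varepsilon}(\omega,\cdot):\mathbb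 H_2\to\mathbb H_1$, Lipschitz in $\xi$. The reduced system is understood in the mild sense, pathwise in $\omega$: writing $\bar\zeta=(h^{\mu,\varepsilon}(\omega,\bar\xi),\bar\xi)$, $\tilde v^\varepsilon$ starts from $\bar\xi$ at $t=0$ and $\tilde u^\varepsilon(t)=h^{\mu,\varepsilon}(\theta_t\omega,\tilde v^\varepsilon(t))$. The state $\bar\zeta$ may depend on $\omega$ and $\mu$; $o(\mu^\alpha)$ is understood as $\mu\to0$, for each fixed $t\ge0$. *)

(* Defs.v *)
From HB Require Import structures.
From mathcomp Require Import all_boot all_order all_algebra.
From mathcomp Require Import all_classical all_reals all_analysis.

Set Implicit Arguments.
Unset Strict Implicit.
Unset Printing Implicit Defensive.

Import Order.TTheory GRing.Theory Num.Theory.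
Import numFieldTopology.Exports numFieldNormedType.Exports.

Local Open Scope classical_set_scope.
Local Open Scope ring_scope.

Section hilbert_spaces.
Context {R : realType}.

Definition is_hilbert (H : completeNormedModType R) :=
  exists ip : {dot H for idfun}, forall x : H, ip x x = `|x| ^+ 2.

Definition is_separable (T : topologicalType) :=
  exists2 D : set T, countable D & dense D.

(* The product type carries the max norm in the library; this is the sum norm,
   which induces the same topology. *)
Definition sum_norm {H1 H2 : normedModType R} (z : H1 * H2) : R :=
  `|z.1| + `|z.2|.

End hilbert_spaces.

Section stieltjes_integral.
Context {R : realType} {V : normedModType R}.
Implicit Types (phi : R -> V) (beta : R -> R).

(* Limit of the tagged sums as the mesh tends to 0; meant for a <= b. *)
Definition is_rs_int phi beta (a b : R) (v : V) :=
  forall e, 0 < e -> exists2 d, 0 < d &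
    forall (n : nat) (p c : nat -> R),
      p 0%N = a -> p n = b ->
      (forall i, (i < n)%N -> p i <= c i <= p i.+1 /\ p i.+1 - p i < d) ->
      `| \sum_(0 <= i < n) (beta (p i.+1) - beta (p i)) *: phi (c i) - v | < e.

(* The value is 0 if the integral does not exist. *)
Definition rs_int phi beta (a b : R) : V :=
  if a <= b then xget 0 [set v | is_rs_int phi beta a b v]
  else - xget 0 [set v | is_rs_int phi beta b a v].

Definition r_int phi (a b : R) : V := rs_int phi id a b.

End stieltjes_integral.

Section semigroups.
Context {R : realType} {H : normedModType R}.
Implicit Types (D : set H) (A : H -> H) (S : R -> H -> H).

Definition C0_semigroup S :=
  [/\ forall t, 0 <= t -> linear (S t) /\ continuous (S t),
      forall x, S 0 x = x,
      forall s t x, 0 <= s -> 0 <= t -> S (s + t) x = S s (S t x) &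
      forall x, S t x @[t --> 0^'+] --> x].

Definition C0_group S :=
  [/\ forall t, linear (S t) /\ continuous (S t),
      forall x, S 0 x = x,
      forall s t x, S (s + t) x = S s (S t x) &
      forall x, S t x @[t --> 0] --> x].

(* An unbounded operator is given by its domain D and by a total function A
   whose values outside D are irrelevant. *)
Definition generates_semigroup D A S := C0_semigroup S /\
  forall x y, (D x /\ A x = y) <-> (t^-1 *: (S t x - x) @[t --> 0^'+] --> y).

Definition generates_group D A S := C0_group S /\
  forall x y, (D x /\ A x = y) <-> (t^-1 *: (S t x - x) @[t --> 0^'] --> y).

End semigroups.

Section canonical_space.
Context (R : realType).

Definition C0_set : set {compact-open, R -> R} :=
  [set w | continuous (w : R -> R) /\ w 0 = 0].

Lemma C0_set_cst0 : C0_set (fun=> 0).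
Proof. by split=> // x; exact: cvg_cst. Qed.

Definition C0 : Type := set_type C0_set.
HB.instance Definition _ := Topological.on C0.
HB.instance Definition _ := isPointed.Build C0 (SigSub (mem_set C0_set_cst0)).

Definition wpath : Type := g_sigma_algebraType (@open C0).
HB.instance Definition _ := Measurable.on wpath.

Definition traj (w : wpath) : R -> R := set_val (w : C0).

Lemma traj_C0 (w : wpath) : C0_set (traj w).
Proof. by case: w => u uC; exact: set_mem uC. Qed.

Lemma C0_set_shift (t : R) (w : wpath) :
  C0_set (fun s => traj w (t + s) - traj w t).
Proof.
have [cw _] := traj_C0 w; split; last by rewrite addr0 subrr.
move=> s; apply: cvgB; last exact: cvg_cst.
apply: (@continuous_comp R R R (fun s => t + s) (traj w)); last exact: cw.
by apply: cvgD; [exact: cvg_cst|exact: cvg_id].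
Qed.

Definition wiener_shift (t : R) (w : wpath) : wpath :=
  SigSub (mem_set (C0_set_shift t w)).

End canonical_space.

Coercion traj : wpath >-> Funclass.

Section noise.
Context {R : realType}.
Implicit Types (w : wpath R) (P : probability (wpath R) R) (mu t : R).

(* The times are strictly increasing because normal_prob 0 0 is not the Dirac
   mass at 0 in the library. *)
Definition is_wiener P :=
  (forall (s t : R) (A : set R), s < t -> measurable A ->
     P [set w : wpath R | A (w t - w s)] = normal_prob 0 (Num.sqrt (t - s)) A) /\
  (forall (n : nat) (t : nat -> R) (A : nat -> set R),
     (forall i, (i < n)%N -> t i < t i.+1) -> (forall i, measurable (A i)) ->
     P [set w : wpath R | forall i, (i < n)%N -> A i (w (t i.+1) - w (t i))] =
     (\prod_(0 <= i < n) P [set w : wpath R | A i (w (t i.+1) - w (t i))%R])%E).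

(* [ou mu w t] is z^mu(theta_t w). The integrand is smooth and deterministic,
   so that the Wiener integral is a pathwise Riemann-Stieltjes one. *)
Definition ou mu w t : R :=
  mu^-1 * lim (rs_int (fun s => expR (- (t - s) / mu) : R^o) w a t @[a --> -oo]).

Definition integrated_ou mu w t : R := r_int (ou mu w : R -> R^o) 0 t.

Definition noise_space P (Omega : set (wpath R)) :=
  [/\ measurable Omega, P Omega = 1%E,
      forall t w, Omega w -> Omega (wiener_shift t w),
      forall w, Omega w ->
        (w t / t @[t --> +oo] --> 0) /\ (w t / t @[t --> -oo] --> 0) &
      forall mu w, 0 < mu -> Omega w ->
        (ou mu w t / t @[t --> +oo] --> 0) /\
        (ou mu w t / t @[t --> -oo] --> 0)].

End noise.

Section slow_fast_systems.
Context {R : realType} {H1 H2 : completeNormedModType R}.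
Variables (SA : R -> H1 -> H1) (SB : R -> H2 -> H2).
Variables (f : H1 * H2 -> H1) (g : H1 * H2 -> H2) (sigma : H1).
Implicit Types (J : set R) (z : R -> H1 * H2) (w : wpath R).

(* Variation of constants between any two times s <= t of J, since SA cannot
   be run backwards. The semigroup generated by A / eps is SA (t / eps), and
   [conv s t] is the convolution of SA ((t - _) / eps) sigma with the noise. *)
Definition mild_solution (eps : R) (conv : R -> R -> H1) J z :=
  {within J, continuous z} /\
  forall s t, J s -> J t -> s <= t ->
    (z t).1 = SA ((t - s) / eps) (z s).1
      + eps^-1 *: r_int (fun r => SA ((t - r) / eps) (f (z r))) s t
      + (Num.sqrt eps)^-1 *: conv s t /\
    (z t).2 = SB (t - s) (z s).2 + r_int (fun r => SB (t - r) (g (z r))) s t.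

(* The integrand is C^1 because sigma is in the domain of A: the stochastic
   convolution is a pathwise Riemann-Stieltjes integral. *)
Definition original_solution eps w :=
  mild_solution eps
    (fun s t => rs_int (fun r => SA ((t - r) / eps) sigma) w s t).

Definition wong_zakai_solution mu eps w :=
  mild_solution eps (fun s t =>
    r_int (fun r => (integrated_ou mu w)^`()%classic r *: SA ((t - r) / eps) sigma) s t).

Definition Cminus_norm (rho eps : R) z : \bar R :=
  (ereal_sup [set (expR (rho / eps * t) * `|(z t).1|)%:E | t in `]-oo, 0%R]]
   + ereal_sup [set (expR (rho / eps * t) * `|(z t).2|)%:E | t in `]-oo, 0%R]])%E.

Definition in_Cminus (rho eps : R) z :=
  {within `]-oo, 0%R], continuous z} /\ (Cminus_norm rho eps z < +oo)%E.

Definition slow_manifold mu rho eps w : set (H1 * H2) :=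
  [set zeta | exists z,
    [/\ wong_zakai_solution mu eps w `]-oo, 0%R] z, z 0 = zeta &
        in_Cminus rho eps z]].

(* The function whose graph is the slow manifold. *)
Definition slow_graph mu rho eps w (xi : H2) : H1 :=
  xget 0 [set x | slow_manifold mu rho eps w (x, xi)].

Definition reduced_solution mu rho eps w J z :=
  {within J, continuous z} /\
  (forall t, J t -> (z t).1 = slow_graph mu rho eps (wiener_shift t w) (z t).2) /\
  forall s t, J s -> J t -> s <= t ->
    (z t).2 = SB (t - s) (z s).2 + r_int (fun r => SB (t - r) (g (z r))) s t.

End slow_fast_systems.

Definition kappa_star {R : realType} (K gamma1 gamma2 rho eps : R) : R :=
  K / (gamma1 - rho) + eps * K / (rho - eps * gamma2)
  + K ^+ 2 / ((gamma1 - rho) * (rho / eps - gamma2)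
              * (1 - K * ((gamma1 - rho)^-1 + eps / (rho - eps * gamma2)))).

(* Main.v *)
Require Import Defs.
From mathcomp Require Import all_boot all_order all_algebra.
From mathcomp Require Import all_classical all_reals all_analysis.
From mathcomp Require Import measurable_realfun ring lra.
Import Order.TTheory GRing.Theory Num.Theory.
Import numFieldTopology.Exports numFieldNormedType.Exports.
Local Open Scope classical_set_scope.
Local Open Scope ring_scope.

(* Let z be the forward Wong-Zakai orbit of zeta, frozen at zeta for negative
   times, and let eta = rho / eps. A Lyapunov-Perron operator on the whole line
   (the slow component integrated from +oo, the fast one from -oo) is a
   contraction for the norm sup_t e^(eta t) |zt - z| with rate
   K (1 / (gamma1 - rho) + eps / (rho - eps gamma2)) < 1, by the bound on eps
   alone. Its fixed point zt is a Wong-Zakai orbit that attracts z exponentially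
   at +oo and has the growth defining the slow manifold at -oo; by shift
   covariance zt stays on the manifold, so it solves the reduced system and
   zbar = zt 0.

   It remains to compare z with the original solution. Integrating by parts, the
   forcing terms differ by a multiple of sup |B - Phi^mu|, and
   Phi^mu_t - B_t = mu z^mu_0 - mu z^mu_t is O(mu^beta) as soon as the path is
   beta-Hoelder, which holds a.s. for beta < 1/2; take alpha < beta < 1/2. *)

Set Implicit Arguments.
Unset Strict Implicit.
Unset Printing Implicit Defensive.

(** The obstacle is that the fast semigroup cannot be run backwards, so the forward orbit through an
    arbitrary [zeta] has no past. Freezing it gives a reference function on the whole line whose
    defect under the Lyapunov-Perron operator still has finite weighted norm. The improper integrals
    converge because of the gap [gamma2 < eta < gamma1 / eps]: backwards the slow group grows at
    rate at most [gamma2], which the weight beats at +oo, and the fast decay at rate [gamma1 / eps]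
    beats the weight at -oo. The bound on [eps] is the inequality [K (1 / (gamma1 - rho) + 1 / (eta
    - gamma2)) < 1] solved for [eps]; call its left side [q]. Both Wong-Zakai orbits carry the same
    noise, which cancels from their difference. On [[0, +oo[] any weighted bound [N] of that
    difference improves to [q N] plus the initial distance, whence [C1 = 1 / (1 - q)], with no term
    in [mu]. All of [o(mu^alpha)] comes from comparing the original with the Wong-Zakai orbit of the
    same [zeta], at a fixed time and on a fixed path. *)

(* [ring] does not apply in a Z-module; [zmod] decides identities there by reflection. *)
Inductive zterm := ZVar of nat | ZZero | ZAdd of zterm & zterm | ZOpp of zterm.

Fixpoint zeval (V : zmodType) (env : seq V) (t : zterm) : V :=
  match t with
  | ZVar n => nth 0 env n
  | ZZero => 0
  | ZAdd t1 t2 => zeval env t1 + zeval env t2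
  | ZOpp t1 => - zeval env t1
  end.

Fixpoint zcoef (t : zterm) (k : nat) : int :=
  match t with
  | ZVar n => (n == k)%:R
  | ZZero => 0
  | ZAdd t1 t2 => zcoef t1 k + zcoef t2 k
  | ZOpp t1 => - zcoef t1 k
  end.

(** An index beyond [env] evaluates to the default 0, in agreement with its absence from the sum. *)
Lemma zevalE (V : zmodType) (env : seq V) t :
  zeval env t = \sum_(k < size env) nth 0 env k *~ zcoef t k.
Proof.
elim: t => [n||t1 IH1 t2 IH2|t IH] /=.
- have [n_lt|n_ge] := ltnP n (size env).
    rewrite (bigD1 (Ordinal n_lt))//= eqxx mulr1z big1 ?addr0// => k.
    by rewrite -val_eqE /= eq_sym => /negbTE ->; rewrite mulr0z.
  rewrite nth_default// big1// => k _; rewrite gtn_eqF ?mulr0z//.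
  exact: leq_trans (ltn_ord k) n_ge.
- by rewrite big1// => k _; rewrite mulr0z.
- by rewrite IH1 IH2 -big_split /=; apply: eq_bigr => k _; rewrite mulrzDr.
- by rewrite IH -sumrN; apply: eq_bigr => k _; rewrite mulrNz.
Qed.

Lemma zeval_eq (V : zmodType) (env : seq V) s t :
  all (fun k => zcoef s k == zcoef t k) (iota 0 (size env)) ->
  zeval env s = zeval env t.
Proof.
move=> /allP st; rewrite !zevalE; apply: eq_bigr => k _.
by rewrite (eqP (st k _))// mem_iota /= add0n.
Qed.

(* Atoms are compared up to unification, since the same operation may appear
   through different canonical structures. *)
Ltac zindex x env :=
  lazymatch env with
  | ?y :: ?env' =>
    let same := match goal with _ => let _ := match goal with _ => unify x y end in constr:(true)
                            | _ => constr:(false) end in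
    lazymatch same with
    | true => constr:(0%N)
    | false => let n := zindex x env' in constr:(S n)
    end
  | _ => constr:(0%N)
  end.

Ltac zinsert x env :=
  let n := zindex x env in
  let absent := eval lazy in (size env <= n)%N in
  lazymatch absent with
  | true => let env' := eval cbv [rcons] in (rcons env x) in env'
  | false => env
  end.

Ltac zatoms t env :=
  lazymatch t with
  | 0 => env
  | ?a + ?b => let env' := zatoms a env in zatoms b env'
  | - ?a => zatoms a env
  | ?x => zinsert x env
  end.

Ltac zquote t env :=
  lazymatch t with
  | 0 => constr:(ZZero)
  | ?a + ?b => let a' := zquote a env in let b' := zquote b env in constr:(ZAdd a' b')
  | - ?a => let a' := zquote a env in constr:(ZOpp a')
  | ?x => let n := zindex x env in constr:(ZVar n)
  end.

(** Scalings are first distributed over sums, so that the scaled vectors that remain serve as atoms.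
    The comparison of coefficients is settled by computation, hence [isT]. *)
Ltac zmod :=
  rewrite ?(scalerDr, scalerDl, scalerN, scaleNr, scalerBr, scalerBl, scale0r, scaler0, scale1r);
  lazymatch goal with
  | |- @eq ?V ?s ?t =>
    let env := zatoms s (@nil V) in let env := zatoms t env in
    let s' := zquote s env in let t' := zquote t env in
    apply: (@zeval_eq _ env s' t' isT)
  end.

(** * The Riemann and Riemann-Stieltjes integrals *)

Section compactness.
Context {R : realType}.

(** The tube lemma: continuity at each [(t0, r)] gives a product neighbourhood, and compactness of
    [[a, b]] lets one neighbourhood of [t0] serve for all [r]. *)
Lemma near_uniform (T : topologicalType) (V : normedModType R)
    (psi : T -> R -> V) (a b : R) (t0 : T) (e : R) :
  (forall r, {for (t0, r), continuous (fun p : T * R => psi p.1 p.2)}) -> 0 < e ->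
  \forall t \near t0, forall r, a <= r <= b -> `|psi t r - psi t0 r| < e.
Proof.
move=> cpsi e0.
have /compact_near_coveringP := @segment_compact R a b.
move=> /(_ T (nbhs t0) (fun t r => `|psi t r - psi t0 r| < e)) H.
have {}H : \forall t \near t0, `[a, b] `<=` (fun r => `|psi t r - psi t0 r| < e).
  apply: H => r _.
  have e20 : 0 < e / 2 by rewrite divr_gt0.
  have /cvgrPdist_lt/(_ _ e20) h1 := cpsi r.
  have h2 : \forall r' \near r, `|psi t0 r - psi t0 r'| < e / 2.
    have : {for r, continuous (psi t0)}.
      apply: (@continuous_comp R (T * R)%type V (fun r => (t0, r))
        (fun p => psi p.1 p.2)); last exact: cpsi.
      by apply: (@cvg_pair _ _ _ _ (nbhs t0) (nbhs r)); [exact: cvg_cst|exact: cvg_id].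
    by move=> /cvgrPdist_lt/(_ _ e20).
  case: h1 => -[U W] /= [Ut Wr] UW.
  exists (W `&` [set r' | `|psi t0 r - psi t0 r'| < e / 2], U) => /=.
    by split => //; apply: filterI.
  move=> [r' t] /= [[Wr' h] Ut'].
  have /= h' := UW (t, r') (conj Ut' Wr').
  rewrite (le_lt_trans (ler_distD (psi t0 r) _ _))// [ltRHS](splitr e).
  by rewrite ltrD// distrC.
apply: filterS H => t H r rab; apply: H.
by rewrite /= in_itv.
Qed.

(** The tube lemma for [(h, r) |-> phi (r + h)] at [h = 0]. Only [x] is confined to the interval;
    [y] may leave it. *)
Lemma unif_cont_itv (V : normedModType R) (phi : R -> V) (a b e : R) :
  continuous phi -> 0 < e ->
  exists2 d, 0 < d & forall x y, a <= x <= b -> `|y - x| < d -> `|phi y - phi x| < e.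
Proof.
move=> cphi e0.
have : \forall h \near (0 : R), forall r, a <= r <= b ->
    `|phi (r + h) - phi (r + 0)| < e.
  apply: (@near_uniform _ _ (fun h r => phi (r + h))) => // r.
  apply: (@continuous_comp (R * R)%type R V (fun p : R * R => p.2 + p.1) phi); last exact: cphi.
  by apply: cvgD; [exact: cvg_snd|exact: cvg_fst].
move=> /nbhs_norm0P[d d0 dP]; exists d => // x y xab xy.
by have := dP _ xy x xab; rewrite addr0 addrCA subrr addr0.
Qed.

Lemma bounded_itv (V : normedModType R) (phi : R -> V) (a b : R) :
  continuous phi -> exists2 M, 0 < M & forall x, a <= x <= b -> `|phi x| <= M.
Proof.
move=> cphi; have [ab|ba] := leP a b; last first.
  by exists 1 => // x /andP[/le_trans h /h]; rewrite leNgt ba.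
have /(EVT_max ab)[c _ cP] : {within `[a, b], continuous (fun x => `|phi x| : R)}.
  by apply: continuous_subspaceT => x; apply: continuous_comp;
    [exact: cphi|exact: norm_continuous].
exists (1 + `|phi c|) => [|x xab]; first by rewrite ltr_pwDl.
by rewrite (le_trans (cP x _)) ?in_itv//= lerDr.
Qed.

End compactness.

(** * Primitives described by their increments, and Riemann sums *)

Section primitives.
Context {R : realType}.
Implicit Types (V : normedModType R).

(** Stated on increments, with a free tag and uniformly on compact intervals: summed over a
    partition it yields the Riemann integral, it passes to pointwise limits, and it makes sense for
    vector values, where the mean value theorem fails. *)
Definition is_primitive V (phi G : R -> V) := forall a b e, 0 < e ->
  exists2 d, 0 < d & forall p c q, a <= p -> p <= c <= q -> q <= b -> q - p < d ->
    `|G q - G p - (q - p) *: phi c| <= e * (q - p).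

Lemma monotone_partition (p : nat -> R) n : (forall i, (i < n)%N -> p i <= p i.+1) ->
  forall i, (i <= n)%N -> p 0%N <= p i /\ p i <= p n.
Proof.
elim: n => [_ [|]//|n IH pm i].
have pm' : forall i, (i < n)%N -> p i <= p i.+1 by move=> j /ltnW; exact: pm.
rewrite leq_eqVlt => /predU1P[->|].
  by have [h _] := IH pm' n (leqnn _); split=> //; exact: (le_trans h (pm _ _)).
by rewrite ltnS => /(IH pm')[? h]; split=> //; exact: (le_trans h (pm _ _)).
Qed.

(* The tagged sums converge as soon as [(beta q - beta p) phi c] is an
   increment of [G] up to [o(q - p)]. *)
Lemma is_rs_int_local V (phi : R -> V) (beta : R -> R) (G : R -> V) (a b : R) :
  a <= b ->
  (forall e, 0 < e -> exists2 d, 0 < d & forall p c q,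
     a <= p -> p <= c <= q -> q <= b -> q - p < d ->
     `|(beta q - beta p) *: phi c - (G q - G p)| <= e * (q - p)) ->
  is_rs_int phi beta a b (G b - G a).
Proof.
move=> ab H e e0.
have e10 : 0 < e / (b - a + 1) by rewrite divr_gt0// ltr_wpDl// subr_ge0.
have [d d0 dP] := H _ e10; exists d => // n p c p0 pn pc.
have pm i : (i < n)%N -> p i <= p i.+1.
  by move=> /pc[/andP[h1 h2] _]; exact: le_trans h1 h2.
have pab := monotone_partition pm.
rewrite -p0 -pn -(telescope_sumr (fun i => G (p i)))// -sumrB.
apply: (@le_lt_trans _ _ (\sum_(0 <= i < n) (e / (b - a + 1) * (p i.+1 - p i)))).
  apply: le_trans (ler_norm_sum _ _ _) _.
  rewrite big_nat [leRHS]big_nat; apply: ler_sum => i /andP[_ i_n].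
  have [h1 h2] := pc i i_n.
  apply: dP => //; first by rewrite -p0; apply: (pab i (ltnW i_n)).1.
  by rewrite -pn; apply: (pab i.+1 i_n).2.
rewrite -mulr_sumr telescope_sumr// p0 pn mulrAC -mulrA gtr_pMr//.
by rewrite ltr_pdivrMr ?mul1r; lra.
Qed.

Lemma fine_partition (a b d : R) : a <= b -> 0 < d -> exists n (p : nat -> R),
  [/\ p 0%N = a, p n = b & forall i, (i < n)%N -> p i <= p i.+1 /\ p i.+1 - p i < d].
Proof.
move=> ab d0.
have [n nP] : exists n : nat, (b - a) / d < n%:R.
  by exists (Num.bound ((b - a) / d)); rewrite archi_boundP// divr_ge0 ?subr_ge0// ltW.
have n0 : (0 : R) < n.+1%:R by rewrite ltr0n.
exists n.+1, (fun i => a + (b - a) * i%:R / n.+1%:R); split.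
- by rewrite mulr0 mul0r addr0.
- by rewrite mulfK ?gt_eqF// addrCA subrr addr0.
move=> i _.
have E : (a + (b - a) * i.+1%:R / n.+1%:R) - (a + (b - a) * i%:R / n.+1%:R) =
    (b - a) / n.+1%:R by rewrite -[i.+1%:R]natr1; field.
split; first by rewrite -subr_ge0 E divr_ge0 ?subr_ge0// ltW.
rewrite E ltr_pdivrMr// mulrC -ltr_pdivrMr//; apply: (lt_trans nP).
by rewrite ltr_nat.
Qed.

Lemma is_rs_int_unique V (phi : R -> V) (beta : R -> R) (a b : R) (v w : V) :
  a <= b -> is_rs_int phi beta a b v -> is_rs_int phi beta a b w -> v = w.
Proof.
move=> ab Hv Hw; apply/eqP; rewrite -subr_eq0 -normr_le0.
apply/ler_addgt0Pl => e e0; rewrite addr0.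
have e20 : 0 < e / 2 by rewrite divr_gt0.
have [d1 d10 P1] := Hv _ e20; have [d2 d20 P2] := Hw _ e20.
have [n [p [p0 pn pP]]] := @fine_partition a b (Num.min d1 d2) ab
  (ltac:(by rewrite lt_min d10)).
have h1 i : (i < n)%N -> p i <= p i <= p i.+1 /\ p i.+1 - p i < d1.
  by move=> /pP[-> ]; rewrite lexx lt_min => /andP[].
have h2 i : (i < n)%N -> p i <= p i <= p i.+1 /\ p i.+1 - p i < d2.
  by move=> /pP[-> ]; rewrite lexx lt_min => /andP[].
have {}P1 := P1 n p p p0 pn h1; have {}P2 := P2 n p p p0 pn h2.
set S := \sum_(_ <= _ < _) _ in P1 P2.
rewrite (le_trans (ler_distD S _ _))// [leRHS](splitr e) ltW//.
by rewrite ltrD// distrC.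
Qed.

Lemma rs_intE V (phi : R -> V) beta a b v : a <= b ->
  is_rs_int phi beta a b v -> rs_int phi beta a b = v.
Proof.
move=> ab Hv; rewrite /rs_int ab; case: xgetP => [w _ /= Hw|/(_ v)//].
exact: is_rs_int_unique Hw Hv.
Qed.

Lemma eq_rs_int V (phi psi : R -> V) (beta beta' : R -> R) a b : a <= b ->
  (forall r, a <= r <= b -> phi r = psi r) ->
  (forall r, a <= r <= b -> beta r = beta' r) ->
  rs_int phi beta a b = rs_int psi beta' a b.
Proof.
move=> ab; wlog suff H : phi psi beta beta' / (forall r, a <= r <= b -> phi r = psi r) ->
    (forall r, a <= r <= b -> beta r = beta' r) ->
    is_rs_int phi beta a b `<=` is_rs_int psi beta' a b.
  move=> e1 e2; rewrite /rs_int ab; congr (xget _ _); apply/seteqP; split; apply: H => //.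
    by move=> r /e1.
  by move=> r /e2.
move=> e1 e2 v Hv e e0; have [d d0 dP] := Hv e e0; exists d => // n p c p0 pn pc.
have pm i : (i < n)%N -> p i <= p i.+1.
  by move=> /pc[/andP[h1 h2] _]; exact: le_trans h1 h2.
have pab i : (i <= n)%N -> a <= p i <= b.
  by move=> i_n; have [] := monotone_partition pm i_n; rewrite p0 pn => -> ->.
rewrite (_ : \sum_(_ <= _ < _) _ =
  \sum_(0 <= i < n) (beta (p i.+1) - beta (p i)) *: phi (c i)); first exact: dP.
apply: eq_big_nat => i /andP[_ i_n]; rewrite !e2 ?e1//; try by apply: pab => //; exact: ltnW.
have [/andP[h1 h2] _] := pc i i_n.
have /andP[h3 _] := pab i (ltnW i_n); have /andP[_ h4] := pab i.+1 i_n.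
by rewrite (le_trans h3 h1) (le_trans h2 h4).
Qed.

Lemma is_primitive_rs V (phi G : R -> V) a b : is_primitive phi G -> a <= b ->
  is_rs_int phi id a b (G b - G a).
Proof.
move=> H ab; apply: is_rs_int_local => // e e0.
have [d d0 dP] := H a b e e0; exists d => // p c q ap pcq qb qpd.
by rewrite distrC; exact: dP.
Qed.

Lemma r_intE V (phi G : R -> V) a b : is_primitive phi G ->
  r_int phi a b = G b - G a.
Proof.
move=> H; rewrite /r_int; have [ab|ba] := leP a b.
  by apply: rs_intE => //; exact: is_primitive_rs.
have := @rs_intE V phi id b a _ (ltW ba) (is_primitive_rs H (ltW ba)).
by rewrite /rs_int (ltW ba) (lt_geF ba) => ->; rewrite opprB.
Qed.

Lemma eq_r_int V (phi psi : R -> V) a b : a <= b ->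
  (forall r, a <= r <= b -> phi r = psi r) -> r_int phi a b = r_int psi a b.
Proof. by move=> ab e1; exact: eq_rs_int. Qed.

Lemma eq_r_intT V (phi psi : R -> V) a b : phi =1 psi -> r_int phi a b = r_int psi a b.
Proof. by move=> /funext ->. Qed.

Lemma r_intN V (phi : R -> V) a b : r_int phi a b = - r_int phi b a.
Proof.
(* For [a = b] both sides take the branch [a <= b] of the definition, so this value has to be shown
   to vanish. *)
have is0 (c : R) (v : V) : is_rs_int phi id c c v -> v = 0.
  move=> /(_ _ _) H; apply: (@is_rs_int_unique _ phi id c c) => // e e0.
  exists 1 => // n p t p0 pn pc.
  rewrite big_nat big1 ?subrr ?normr0// => i /andP[_ i_n].
  have pm j : (j < n)%N -> p j <= p j.+1.
    by move=> /pc[/andP[h1 h2] _]; exact: le_trans h1 h2.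
  have h j : (j <= n)%N -> p j = c.
    by move=> jn; have := monotone_partition pm jn; rewrite p0 pn => -[? ?];
      apply/eqP; rewrite eq_le; apply/andP.
  by rewrite !h ?(ltnW i_n)// subrr scale0r.
rewrite /r_int /rs_int; case: (ltgtP a b) => [//|//|->]; first by rewrite opprK.
rewrite (_ : xget _ _ = 0) ?oppr0//; case: xgetP => // v _; exact: is0.
Qed.

End primitives.

(** * Existence of primitives of continuous functions *)

Section existence.
Context {R : realType}.

(** A mean value inequality without derivatives: domination of the short increments adds up along a
    partition finer than [d]. *)
Lemma ler_norm_primitive (V : normedModType R) (D : R -> V) (E : R -> R) a b d : a <= b -> 0 < d ->
  (forall p q, a <= p -> p <= q -> q <= b -> q - p < d -> `|D q - D p| <= E q - E p) ->
  `|D b - D a| <= E b - E a.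
Proof.
move=> ab d0 H; have [n [p [p0 pn pP]]] := fine_partition ab d0.
have pab := monotone_partition (fun i h => (pP i h).1).
rewrite -pn -p0 -(telescope_sumr (fun i => D (p i)))//.
rewrite -(telescope_sumr (fun i => E (p i)))//.
apply: le_trans (ler_norm_sum _ _ _) _.
rewrite big_nat [leRHS]big_nat; apply: ler_sum => i /andP[_ i_n].
apply: H; last 1 first; try exact: (pP i i_n).2.
- by rewrite -p0; apply: (pab i (ltnW i_n)).1.
- exact: (pP i i_n).1.
- by rewrite -pn; apply: (pab i.+1 i_n).2.
Qed.

Definition grid (m k : nat) : R := - m.+1%:R + k%:R / m.+1%:R.

(** The difference of the two minima is the length of the part of the [k]-th cell to the left of
    [t], so this is a primitive of a step function. Cells of length [1 / (m + 1)] on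
    [[- (m + 1), m + 1]] number [2 (m + 1)^2]. *)
Definition step_primitive (V : normedModType R) (phi : R -> V) (m : nat) (t : R) : V :=
  \sum_(0 <= k < 2 * m.+1 ^ 2)
    (Num.min t (grid m k.+1) - Num.min t (grid m k)) *: phi (grid m k).

(** [l] is the length of the part of [[x, x + h]] that lies in [[s, t]]. *)
Lemma min_increment (s t x h : R) : s <= t -> 0 < h ->
  let l := (Num.min t (x + h) - Num.min t x) - (Num.min s (x + h) - Num.min s x) in
  0 <= l /\ (t <= x -> l = 0) /\ (x <= s - h -> l = 0).
Proof.
move=> st h0 /=.
by have [?|?] := leP t (x + h); have [?|?] := leP t x; have [?|?] := leP s (x + h);
  have [?|?] := leP s x; do ?[split|move=> ?]; lra.
Qed.

(** The parts of the cells inside [[s, t]] have total length [t - s]. A cell that meets [[s, t]] may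
    begin up to one mesh before [s], and its value is read at its left end: hence the enlarged
    interval in the last hypothesis. *)
Lemma step_primitiveP (V : normedModType R) (phi : R -> V) m s t v e :
  - m.+1%:R <= s -> s <= t -> t <= m.+1%:R ->
  (forall x, s - m.+1%:R^-1 <= x <= t -> `|phi x - v| <= e) ->
  `|step_primitive phi m t - step_primitive phi m s - (t - s) *: v| <= e * (t - s).
Proof.
move=> ms st tm H.
have m0 : (0 : R) < m.+1%:R by rewrite ltr0n.
have gridS k : grid m k.+1 = grid m k + m.+1%:R^-1.
  by rewrite /grid -addrA -mulrDl natr1 div1r || rewrite /grid -[k.+1%:R]natr1 mulrDl div1r addrA.
pose l k := (Num.min t (grid m k.+1) - Num.min t (grid m k)) -
            (Num.min s (grid m k.+1) - Num.min s (grid m k)).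
have suml : \sum_(0 <= k < 2 * m.+1 ^ 2) l k = t - s.
  rewrite sumrB (telescope_sumr (fun k => Num.min t (grid m k)))//.
  rewrite (telescope_sumr (fun k => Num.min s (grid m k)))//.
  have -> : grid m 0 = - m.+1%:R by rewrite /grid mul0r addr0.
  have -> : grid m (2 * m.+1 ^ 2) = m.+1%:R.
    by rewrite /grid natrM natrX; field; rewrite gt_eqF.
  rewrite (min_l tm) (min_r (le_trans ms st)) (min_l (le_trans st tm)) (min_r ms).
  by rewrite opprB addrA subrK.
rewrite -suml /step_primitive -sumrB scaler_suml -sumrB mulr_sumr.
apply: le_trans (ler_norm_sum _ _ _) _.
apply: ler_sum => k _.
rewrite -scalerBl -/(l k) -scalerBr normrZ.
have m1 : (0 : R) < m.+1%:R^-1 by rewrite invr_gt0.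
have [cells0 [cells1 cells2]] := min_increment (grid m k) st m1.
rewrite -gridS -/(l k) in cells0 cells1 cells2.
rewrite ger0_norm// mulrC.
have [[h1 h2]|h] : (s - m.+1%:R^-1 <= grid m k /\ grid m k <= t) \/ l k = 0.
- have [h1|h1] := lerP (grid m k) t; last first.
    by right; apply: cells1; exact: ltW.
  have [h2|h2] := lerP (s - m.+1%:R^-1) (grid m k); first by left.
  by right; apply: cells2; exact: ltW.
- by rewrite ler_wpM2r// H// h1 h2.
- by rewrite h !mulr0.
Qed.

Lemma cauchy_seq_cvg (V : completeNormedModType R) (u : nat -> V) :
  (forall e, 0 < e -> exists N, forall m m', (N <= m)%N -> (N <= m')%N ->
    `|u m - u m'| <= e) -> cvg (u m @[m --> \oo]).
Proof.
move=> H; apply/cauchy_cvgP/cauchy_exP => e e0.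
have [N NP] := H (e / 2) (ltac:(by rewrite divr_gt0)).
exists (u N), N => // m Nm; rewrite -ball_normE /=.
by rewrite (le_lt_trans (NP _ _ (leqnn _) Nm))// ltr_pdivrMr// ltr_pMr// ltr1n.
Qed.

Lemma lim_norm_le (T : Type) (F : set_system T) {FF : ProperFilter F}
    (V : normedModType R) (f : T -> V) (l : V) (M : R) :
  f x @[x --> F] --> l -> (\forall x \near F, `|f x| <= M) -> `|l| <= M.
Proof.
move=> fl fM; have fl' : `|f x| @[x --> F] --> `|l| by exact: cvg_norm.
by rewrite -(cvg_lim (@Rhausdorff R) fl'); apply: limr_le => //; apply/cvg_ex; exists `|l|.
Qed.

(** The step primitives, normalised to vanish at 0, satisfy the defining estimate with the same [d]
    for all large [m]. Comparing two of them shows that they are pointwise Cauchy, and the estimate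
    survives in the limit. *)
Lemma primitive_exists (V : completeNormedModType R) (phi : R -> V) :
  continuous phi -> exists G, is_primitive phi G.
Proof.
move=> cphi.
pose D m t := step_primitive phi m t - step_primitive phi m 0.
have DD m p q : D m q - D m p = step_primitive phi m q - step_primitive phi m p.
  by rewrite /D; zmod.
have loc L e : 0 < e -> exists d N, 0 < d /\ forall m, (N <= m)%N -> forall p c q,
    - L <= p -> p <= c <= q -> q <= L -> q - p < d ->
    `|D m q - D m p - (q - p) *: phi c| <= e * (q - p).
  move=> e0.
  have e20 : 0 < e / 2 by rewrite divr_gt0.
  have [d d0 dP] := @unif_cont_itv _ _ phi (- L - 1) L _ cphi e20.
  have d20 : 0 < d / 2 by rewrite divr_gt0.
  have h1 : \forall m \near \oo, (m.+1%:R : R)^-1 < d / 2.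
    have := @near_infty_natSinv_lt R (PosNum d20); exact.
  have h2 : \forall m \near \oo, L <= (m.+1%:R : R).
    have := @nbhs_infty_ger R L; apply: filterS => m h.
    by rewrite (le_trans h)// ler_nat.
  have [N _ NP] := filterI h1 h2.
  exists (d / 2), N; split => // m /NP[md Lm] p c q Lp /andP[pc cq] qL qpd.
  have m1 : (m.+1%:R : R)^-1 <= 1 by rewrite invf_le1 ?ler1n ?ltr0n.
  rewrite DD; apply: step_primitiveP => //; [lra|exact: le_trans cq|lra|].
  move=> x /andP[x1 x2].
  set h := m.+1%:R^-1 in md m1 x1.
  rewrite distrC (le_trans (ler_distD (phi p) _ _))// [leRHS](splitr e) ltW// ltrD//.
    by rewrite distrC; apply: dP; [apply/andP; split; lra|rewrite ltr_norml; apply/andP; split; lra].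
  by rewrite distrC; apply: dP; [apply/andP; split; lra|rewrite ltr_norml; apply/andP; split; lra].
have cvgD t : cvg (D m t @[m --> \oo]).
  apply: cauchy_seq_cvg => e e0.
  pose L := `|t|.
  have L0 : 0 <= L by rewrite normr_ge0.
  have L1 : 0 < 2 * L + 1 by rewrite ltr_wpDl// mulr_ge0.
  have e10 : 0 < e / (2 * L + 1) / 2 by rewrite divr_gt0// divr_gt0.
  have [d [N [d0 NP]]] := loc L _ e10.
  exists N => m m' /NP Pm /NP Pm'.
  pose E u := D m u - D m' u.
  have E0 : E 0 = 0 by rewrite /E /D !subrr.
  have H p q : - L <= p -> p <= q -> q <= L -> q - p < d ->
      `|E q - E p| <= e / (2 * L + 1) * (q - p).
    move=> Lp pq qL qpd.
    have -> : E q - E p = (D m q - D m p - (q - p) *: phi p) -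
        (D m' q - D m' p - (q - p) *: phi p).
      by rewrite /E; zmod.
    rewrite (le_trans (ler_normB _ _))// (splitr (e / _)) mulrDl lerD//.
      by apply: Pm; rewrite ?lexx.
    by apply: Pm'; rewrite ?lexx.
  apply: (@le_trans _ _ (e / (2 * L + 1) * L)); last first.
    by rewrite mulrAC -mulrA ler_piMr 1?ltW// ltr_pdivrMr// mul1r; lra.
  rewrite -/(E t) -[E t]subr0 -E0; have [t0|t0] := leP 0 t.
    rewrite [X in _ * X](_ : L = t - 0); last by rewrite subr0 /L ger0_norm.
    rewrite mulrBr; apply: (@ler_norm_primitive _ E (fun x => e / (2 * L + 1) * x) _ _ _ t0 d0) => p q p0 pq qt.
    rewrite -mulrBr; apply: H => //; [lra|].
    by rewrite (le_trans qt)// ler_norm.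
  rewrite [X in _ * X](_ : L = 0 - t); last by rewrite sub0r /L ltr0_norm.
  rewrite distrC mulrBr.
  apply: (@ler_norm_primitive _ E (fun x => e / (2 * L + 1) * x) _ _ _ (ltW t0) d0) => p q tp pq q0.
  rewrite -mulrBr; apply: H => //; last lra.
  by rewrite (le_trans _ tp)// lerNl /L -normrN ler_norm.
exists (fun t => lim (D m t @[m --> \oo])) => a b e e0.
pose L := Num.max `|a| `|b|.
have [d [N [d0 NP]]] := loc L e e0.
exists d => // p c q ap pcq qb qpd.
apply: (@lim_norm_le _ \oo _ _ (fun m => D m q - D m p - (q - p) *: phi c)).
  by apply: cvgB; [apply: cvgB; exact: cvgD|exact: cvg_cst].
exists N => // m /NP; apply => //.
  by rewrite (le_trans _ ap)// lerNl /L le_max -normrN ler_norm.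
by rewrite (le_trans qb)// /L le_max ler_norm orbT.
Qed.

End existence.

(** * Rules and estimates for integrals *)

Section integral_calculus.
Context {R : realType}.
Implicit Types (V W : normedModType R).

Lemma ler_norm_r_int V (phi G : R -> V) (h H : R -> R) a b : a <= b ->
  is_primitive phi G -> is_primitive (h : R -> R^o) (H : R -> R^o) ->
  (forall r, a <= r <= b -> `|phi r| <= h r) ->
  `|r_int phi a b| <= H b - H a.
Proof.
move=> ab pG pH le_h; rewrite (r_intE _ _ pG).
have ba0 : 0 < b - a + 1 by rewrite ltr_wpDl// subr_ge0.
apply/ler_addgt0Pl => e e0.
(* The two primitives [G] and [H] each contribute an error [f * (q - p)]; an extra slope [2 * f]
   absorbs both and costs at most [e] over [[a, b]]. *)
pose f := e / (b - a + 1) / 2.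
have f0 : 0 < f by rewrite !divr_gt0.
have [d1 d10 P1] := pG a b f f0; have [d2 d20 P2] := pH a b f f0.
have d0 : 0 < Num.min d1 d2 by rewrite lt_min d10.
apply: (@le_trans _ _ (H b + 2 * f * b - (H a + 2 * f * a))); last first.
  have -> : H b + 2 * f * b - (H a + 2 * f * a) = 2 * f * (b - a) + (H b - H a) by ring.
  rewrite lerD2r (_ : 2 * f = e / (b - a + 1)); last by rewrite /f; field; rewrite gt_eqF.
  by rewrite mulrAC -mulrA ler_piMr ?(ltW e0)// ler_pdivrMr// mul1r; lra.
apply: (@ler_norm_primitive _ _ _ (fun x => H x + 2 * f * x) _ _ _ ab d0).
move=> p q ap pq qb; rewrite lt_min => /andP[qp1 qp2].
have pp : p <= p <= q by rewrite lexx.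
have := P1 p p q ap pp qb qp1; have := P2 p p q ap pp qb qp2.
have := le_h p; rewrite ap (le_trans pq qb) => /(_ isT).
move=> h1 h2 h3.
rewrite -[G q - G p](subrK ((q - p) *: phi p)).
rewrite (le_trans (ler_normD _ _))// normrZ ger0_norm ?subr_ge0//.
move: h2; rewrite ler_norml => /andP[h2 _].
have h4 : (q - p) * `|phi p| <= (q - p) * h p by rewrite ler_wpM2l// subr_ge0.
apply: (le_trans (lerD h3 h4)).
have -> : H q + 2 * f * q - (H p + 2 * f * p) = H q - H p + 2 * f * (q - p) by ring.
move: h2; rewrite -[_ *: _]/((q - p) * h p); lra.
Qed.

Lemma is_primitive_cst V (v : V) : is_primitive (fun=> v) (fun t => t *: v).
Proof.
move=> a b e e0; exists 1 => // p c q _ /andP[pc cq] _ _.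
by rewrite -scalerBl subrr normr0 mulr_ge0 ?(ltW e0)// subr_ge0 (le_trans pc).
Qed.

Lemma ler_norm_r_int_cst V (phi G : R -> V) (M a b : R) : a <= b ->
  is_primitive phi G -> (forall r, a <= r <= b -> `|phi r| <= M) ->
  `|r_int phi a b| <= M * (b - a).
Proof.
move=> ab pG H; rewrite mulrBr ![M * _]mulrC.
exact: (ler_norm_r_int ab pG (@is_primitive_cst R^o M)).
Qed.

Lemma is_primitiveD V (phi psi G H : R -> V) : is_primitive phi G ->
  is_primitive psi H -> is_primitive (fun r => phi r + psi r) (fun r => G r + H r).
Proof.
move=> pG pH a b e e0; have e20 : 0 < e / 2 by rewrite divr_gt0.
have [d1 d10 P1] := pG a b _ e20; have [d2 d20 P2] := pH a b _ e20.
exists (Num.min d1 d2); first by rewrite lt_min d10.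
move=> p c q ap pcq qb; rewrite lt_min => /andP[qp1 qp2].
have -> : G q + H q - (G p + H p) - (q - p) *: (phi c + psi c) =
  (G q - G p - (q - p) *: phi c) + (H q - H p - (q - p) *: psi c) by zmod.
rewrite (le_trans (ler_normD _ _))// (splitr e) mulrDl lerD//; [exact: P1|exact: P2].
Qed.

Lemma linear_funB V W (L : V -> W) u v : linear L -> L (u - v) = L u - L v.
Proof. by move=> linL; rewrite -[in LHS]scaleN1r addrC linL scaleN1r addrC. Qed.

Lemma linear_funZ V W (L : V -> W) k v : linear L -> L (k *: v) = k *: L v.
Proof.
move=> linL; have L0 : L 0 = 0 by rewrite -[X in L X](subrr (0 : V)) linear_funB// subrr.
by have := linL k v 0; rewrite L0 !addr0.
Qed.

Lemma linear_funD V W (L : V -> W) u v : linear L -> L (u + v) = L u + L v.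
Proof. by move=> linL; have := linL 1 u v; rewrite !scale1r. Qed.

Lemma is_primitive_linear V W (L : V -> W) (M : R) (phi G : R -> V) :
  linear L -> (forall v, `|L v| <= M * `|v|) ->
  is_primitive phi G -> is_primitive (L \o phi) (L \o G).
Proof.
move=> linL LM pG a b e e0.
pose N := Num.max M 1.
have N0 : 0 < N by rewrite lt_max ltr01 orbT.
have [d d0 P] := pG a b (e / N) (ltac:(by rewrite divr_gt0)).
exists d => // p c q ap pcq qb qpd /=.
rewrite -(linear_funB _ _ linL) -(linear_funZ _ _ linL) -(linear_funB _ _ linL) (le_trans (LM _))//.
apply: (@le_trans _ _ (N * `|G q - G p - (q - p) *: phi c|)).
  by rewrite ler_wpM2r// le_max lexx.
by rewrite -ler_pdivlMl// mulrA [N^-1 * _]mulrC P.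
Qed.

Lemma is_primitiveZ V (k : R) (phi G : R -> V) : is_primitive phi G ->
  is_primitive (fun r => k *: phi r) (fun r => k *: G r).
Proof.
move=> pG; apply: (@is_primitive_linear _ _ ( *:%R k) `|k| _ _ _ _ pG).
  by move=> c u v; rewrite scalerDr !scalerA mulrC.
by move=> v; rewrite normrZ.
Qed.

Lemma is_primitiveB V (phi psi G H : R -> V) : is_primitive phi G ->
  is_primitive psi H -> is_primitive (fun r => phi r - psi r) (fun r => G r - H r).
Proof.
move=> pG pH; have := is_primitiveD pG (is_primitiveZ (-1) pH).
by rewrite (_ : (fun r => phi r + _) = (fun r => phi r - psi r))
  1?(_ : (fun r => G r + _) = (fun r => G r - H r))//;
  apply/funext => r; rewrite scaleN1r.
Qed.

Lemma is_primitive_sym V (phi G : R -> V) : is_primitive phi G ->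
  forall a b e, 0 < e -> exists2 d, 0 < d & forall p c q,
    a <= Num.min p q -> Num.min p q <= c <= Num.max p q -> Num.max p q <= b ->
    `|q - p| < d -> `|G q - G p - (q - p) *: phi c| <= e * `|q - p|.
Proof.
move=> pG a b e e0; have [d d0 P] := pG a b e e0; exists d => // p c q.
have [pq|qp] := leP p q => ap pcq qb.
  by rewrite ger0_norm ?subr_ge0//; exact: P.
rewrite distrC gtr0_norm ?subr_gt0// => qpd.
have -> : G q - G p - (q - p) *: phi c = - (G p - G q - (p - q) *: phi c) by zmod.
by rewrite normrN; exact: P.
Qed.

(** Change of variables. A negative [k] reverses the order of the end points, which is why the
    symmetric form of the estimate is used. *)
Lemma is_primitive_affine V (k c0 : R) (phi G : R -> V) : is_primitive phi G ->
  is_primitive (fun r => k *: phi (c0 + k * r)) (fun r => G (c0 + k * r)).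
Proof.
move=> pG; have [->|k0] := eqVneq k 0.
  move=> a b e e0; exists 1 => // p c q _ /andP[pc cq] _ _.
  by rewrite !mul0r subrr scale0r scaler0 subr0 normr0 mulr_ge0 ?(ltW e0)// subr_ge0 (le_trans pc).
move=> a b e e0; have k1 : 0 < `|k| by rewrite normr_gt0.
pose A := Num.min (c0 + k * a) (c0 + k * b); pose B := Num.max (c0 + k * a) (c0 + k * b).
have [d d0 P] := is_primitive_sym pG A B (ltac:(by rewrite divr_gt0) : 0 < e / `|k|).
exists (d / `|k|); first by rewrite divr_gt0.
move=> p c q ap /andP[pc cq] qb qpd.
have E : c0 + k * q - (c0 + k * p) = k * (q - p) by ring.
have anti : k < 0 -> forall x y, x <= y -> c0 + k * y <= c0 + k * x.
  by move=> kn x y xy; rewrite lerD2l ler_wnM2l// ltW.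
have mono : 0 <= k -> forall x y, x <= y -> c0 + k * x <= c0 + k * y.
  by move=> kp x y xy; rewrite lerD2l ler_wpM2l.
have ab : a <= b by rewrite (le_trans ap)// (le_trans pc)// (le_trans cq).
have pq : p <= q by rewrite (le_trans pc).
have := P (c0 + k * p) (c0 + k * c) (c0 + k * q).
rewrite E scalerA [_ * k]mulrC normrM (ger0_norm (_ : 0 <= q - p)); last first.
  by rewrite subr_ge0 (le_trans pc).
rewrite mulrA mulfVK ?gt_eqF//; apply; last by rewrite mulrC -ltr_pdivlMr.
- by rewrite /A; have [kn|kp] := ltP k 0; [rewrite !min_r ?(anti kn)|rewrite !min_l ?(mono kp)].
- have [kn|kp] := ltP k 0.
    by rewrite min_r ?max_l ?(anti kn)// !(anti kn).
  by rewrite min_l ?max_r ?(mono kp)// !(mono kp).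
- by rewrite /B; have [kn|kp] := ltP k 0; [rewrite !max_l ?(anti kn)|rewrite !max_r ?(mono kp)].
Qed.

Lemma r_int_chasles V (phi G : R -> V) a b c : is_primitive phi G ->
  r_int phi a b + r_int phi b c = r_int phi a c.
Proof. by move=> pG; rewrite !(r_intE _ _ pG); zmod. Qed.

Lemma continuous_atP V (f : R -> V) t :
  (forall e, 0 < e -> exists2 d, 0 < d & forall s, `|s - t| < d -> `|f s - f t| <= e) ->
  f s @[s --> t] --> f t.
Proof.
move=> H; apply/cvgrPdist_le => e /H[d d0 P].
by apply/nbhs_normP; exists d => // s /= ts; rewrite distrC P// distrC.
Qed.

Lemma is_primitive_continuous V (phi G : R -> V) : continuous phi ->
  is_primitive phi G -> continuous G.
Proof.
move=> cphi pG t; apply: continuous_atP => e e0.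
have [M M0 MP] := bounded_itv (t - 1) (t + 1) cphi.
have [d d0 P] := is_primitive_sym pG (t - 1) (t + 1) (@ltr01 R).
have N0 : 0 < 1 + M by rewrite addr_gt0.
exists (Num.min (Num.min 1 d) (e / (1 + M))); first by rewrite !lt_min ltr01 d0 divr_gt0.
move=> s; rewrite !lt_min => /andP[/andP[st1 std] ste].
move: (st1); rewrite ltr_norml => /andP[h1 h2].
rewrite -[G s - G t](subrK ((s - t) *: phi t)) (le_trans (ler_normD _ _))//.
have /P : Num.min t s <= t <= Num.max t s by rewrite ge_min le_max lexx.
rewrite le_min ge_max mul1r => H.
rewrite (@le_trans _ _ (`|s - t| + `|s - t| * M))//.
  rewrite lerD//; first by apply: H => //; apply/andP; split; lra.
  by rewrite normrZ ler_wpM2l// MP//; apply/andP; split; lra.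
by rewrite -[X in X + _]mulr1 -mulrDr -ler_pdivlMr// ltW.
Qed.

Lemma is_primitive_derive (phi G : R -> R^o) t : continuous phi ->
  is_primitive phi G -> is_derive (t : R^o) 1 (G : R^o -> R^o) (phi t).
Proof.
move=> cphi pG.
have H : h^-1 *: (((G : R^o -> R^o) \o shift (t : R^o)) (h *: (1 : R^o)) - (G : R^o -> R^o) t)
    @[h --> (0 : R)^'] --> phi t.
  apply/cvgrPdist_le => e e0.
  have [d d0 P] := is_primitive_sym pG (t - 1) (t + 1) e0.
  rewrite /dnbhs near_withinE; apply/nbhs_normP.
  exists (Num.min 1 d); first by rewrite /= lt_min ltr01 d0.
  move=> h; rewrite /= sub0r normrN lt_min => /andP[h1 hd] h0.
  rewrite [h *: _]mulr1 -(ler_pM2l (_ : 0 < `|h|)) ?normr_gt0// -normrM mulrBr.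
  rewrite mulrA divff// mul1r distrC [`|h| * e]mulrC.
  have := P t t (h + t); rewrite addrK ge_min le_max lexx => /(_ _ isT); apply => //.
    by rewrite le_min; move: h1; rewrite ltr_norml => /andP[? ?]; apply/andP; split; lra.
  by rewrite ge_max; move: h1; rewrite ltr_norml => /andP[? ?]; apply/andP; split; lra.
apply: DeriveDef; first by apply/cvg_ex; exists (phi t).
exact: (cvg_lim (@Rhausdorff R) H).
Qed.

Lemma derive_is_primitive (phi G : R -> R) : continuous phi ->
  (forall t, is_derive (t : R^o) (1 : R^o) (G : R^o -> R^o) (phi t)) -> is_primitive (phi : R -> R^o) (G : R -> R^o).
Proof.
move=> cphi dG a b e e0.
have [d d0 P] := unif_cont_itv a b cphi e0.
exists d => // p c q ap /andP[pc cq] qb qpd.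
have [x] : exists2 x, x \in `[p, q] & G q - G p = phi x * (q - p).
  apply: MVT_segment => //; first exact: le_trans cq.
  apply: continuous_subspaceT => x.
  by apply: differentiable_continuous; apply/derivable1_diffP; case: (dG x).
rewrite in_itv/= => /andP[px xq] ->.
rewrite mulrC -[_ *: _]/((q - p) * phi c) -mulrBr normrM ger0_norm ?subr_ge0 1?(le_trans pc)//.
rewrite mulrC ler_wpM2r ?subr_ge0 1?(le_trans pc)// ltW//; apply: P.
  by rewrite (le_trans ap)// (le_trans cq).
by rewrite ltr_norml; apply/andP; split; lra.
Qed.

Lemma is_primitive_expR (C k : R) : k != 0 ->
  is_primitive ((fun r => C * expR (k * r)) : R -> R^o) (fun r => C / k * expR (k * r)).
Proof.
move=> k0; apply: derive_is_primitive.
  move=> t; apply: cvgM; first exact: cvg_cst.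
  by apply: continuous_comp; [exact: mulrl_continuous|exact: continuous_expR].
move=> t; have h := is_derive1_comp (is_derive_expR (k * t)) (is_deriveZ k (is_derive_id (t : R^o) (1 : R^o))).
apply: is_derive_eq (is_deriveZ (C / k) h) _.
by rewrite /GRing.scale /=; field.
Qed.

End integral_calculus.

Section integrals_of_continuous_functions.
Context {R : realType}.
Implicit Types (V W : completeNormedModType R).

Lemma r_int_cat V (phi : R -> V) a b c : continuous phi ->
  r_int phi a b + r_int phi b c = r_int phi a c.
Proof. by move=> /primitive_exists[G pG]; exact: r_int_chasles pG. Qed.

Lemma r_intxx V (phi : R -> V) a : r_int phi a a = 0.
Proof.
rewrite (@eq_r_int _ _ phi (fun=> phi a)) => [|//|r /le_anti -> //].
by rewrite (r_intE _ _ (is_primitive_cst _)) subrr.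
Qed.

Lemma r_intD V (phi psi : R -> V) a b : continuous phi -> continuous psi ->
  r_int (fun r => phi r + psi r) a b = r_int phi a b + r_int psi a b.
Proof.
move=> /primitive_exists[G pG] /primitive_exists[H pH].
by rewrite (r_intE _ _ pG) (r_intE _ _ pH) (r_intE _ _ (is_primitiveD pG pH)); zmod.
Qed.

Lemma r_intB V (phi psi : R -> V) a b : continuous phi -> continuous psi ->
  r_int (fun r => phi r - psi r) a b = r_int phi a b - r_int psi a b.
Proof.
move=> /primitive_exists[G pG] /primitive_exists[H pH].
by rewrite (r_intE _ _ pG) (r_intE _ _ pH) (r_intE _ _ (is_primitiveB pG pH)); zmod.
Qed.

Lemma r_intZ V (k : R) (phi : R -> V) a b : continuous phi ->
  r_int (fun r => k *: phi r) a b = k *: r_int phi a b.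
Proof.
by move=> /primitive_exists[G pG]; rewrite (r_intE _ _ pG) (r_intE _ _ (is_primitiveZ k pG)) scalerBr.
Qed.

Lemma r_int_linear V W (L : V -> W) (M : R) (phi : R -> V) a b :
  linear L -> (forall v, `|L v| <= M * `|v|) -> continuous phi ->
  r_int (L \o phi) a b = L (r_int phi a b).
Proof.
move=> linL LM /primitive_exists[G pG].
rewrite (r_intE _ _ (is_primitive_linear linL LM pG)) (r_intE _ _ pG) /=.
by rewrite linear_funB.
Qed.

Lemma r_int_shift V (phi : R -> V) a b c : continuous phi ->
  r_int (fun r => phi (c + r)) a b = r_int phi (c + a) (c + b).
Proof.
move=> /primitive_exists[G pG]; have := is_primitive_affine 1 c pG.
rewrite (_ : (fun r => 1 *: _) = (fun r => phi (c + r))) 1?(_ : (fun r => G _) = (fun r => G (c + r))).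
- by move=> /(r_intE a b) ->; rewrite (r_intE _ _ pG).
- by apply/funext => r; rewrite mul1r.
- by apply/funext => r; rewrite mul1r scale1r.
Qed.

Lemma norm_r_int_le V (phi : R -> V) (h H : R -> R) a b : a <= b -> continuous phi ->
  is_primitive (h : R -> R^o) (H : R -> R^o) ->
  (forall r, a <= r <= b -> `|phi r| <= h r) -> `|r_int phi a b| <= H b - H a.
Proof. by move=> ab /primitive_exists[G pG] pH; exact: (ler_norm_r_int ab pG pH). Qed.

Lemma norm_r_int_cst V (phi : R -> V) (M a b : R) : a <= b -> continuous phi ->
  (forall r, a <= r <= b -> `|phi r| <= M) -> `|r_int phi a b| <= M * (b - a).
Proof. by move=> ab /primitive_exists[G pG]; exact: (ler_norm_r_int_cst ab pG). Qed.

Lemma norm_r_int_exp V (phi : R -> V) (C k a b : R) : k != 0 -> a <= b -> continuous phi ->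
  (forall r, a <= r <= b -> `|phi r| <= C * expR (k * r)) ->
  `|r_int phi a b| <= C / k * (expR (k * b) - expR (k * a)).
Proof.
move=> k0 ab cphi H; rewrite mulrBr.
exact: norm_r_int_le ab cphi (is_primitive_expR C k0) H.
Qed.

(** The increment splits into the change of the integrand, small by the tube lemma on an interval
    that contains all the ranges of integration, and the piece between [t] and [s], small by
    boundedness. *)
Lemma r_int_continuous2 V (psi : R -> R -> V) a :
  continuous (fun p : R * R => psi p.1 p.2) ->
  continuous (fun t => r_int (psi t) a t).
Proof.
move=> cpsi t.
have cpsi1 s : continuous (psi s).
  move=> r; apply: (@continuous_comp R (R * R)%type V (fun r => (s, r))
    (fun p => psi p.1 p.2)); last exact: cpsi.
  by apply: (@cvg_pair _ _ _ _ (nbhs s) (nbhs r)); [exact: cvg_cst|exact: cvg_id].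
apply: continuous_atP => e e0.
have [M M0 MP] := bounded_itv (t - 1) (t + 1) (cpsi1 t).
pose A := Num.min a t - 1; pose B := Num.max a t + 1.
have AB : A <= B by rewrite /A /B; case: (leP a t) => ?; lra.
have L0 : 0 < B - A + 1 by lra.
have f0 : 0 < e / (B - A + 1) / 2 by rewrite !divr_gt0.
have := @near_uniform _ _ _ psi A B t _ (fun r => cpsi (t, r)) f0.
move=> /nbhs_normP[d d0 dP].
exists (Num.min (Num.min 1 d) (e / 2 / M)).
  by rewrite !lt_min ltr01 d0 !divr_gt0.
move=> s; rewrite !lt_min => /andP[/andP[st1 std] ste].
have -> : r_int (psi s) a s - r_int (psi t) a t =
    r_int (fun r => psi s r - psi t r) a s + r_int (psi t) t s.
  by rewrite r_intB// -(r_int_cat a t s (cpsi1 t)); zmod.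
have {}dP r : A <= r <= B -> `|psi s r - psi t r| <= e / (B - A + 1) / 2.
  by move=> /(dP s _); rewrite /= distrC => /(_ std)/ltW.
have h1 : `|r_int (fun r => psi s r - psi t r) a s| <= e / (B - A + 1) / 2 * `|s - a|.
  have cB : continuous (fun r => psi s r - psi t r).
    by move=> r; apply: cvgB; exact: cpsi1.
  move: st1; rewrite ltr_norml => /andP[st1 st2].
  have [as_|sa] := leP a s.
    rewrite (ger0_norm (_ : 0 <= s - a)) ?subr_ge0//; apply: norm_r_int_cst => // r rab.
    by apply: dP; rewrite /A /B; case: (leP a t) => ?; apply/andP; split; lra.
  rewrite r_intN normrN (ltr0_norm (_ : s - a < 0)) ?subr_lt0// [- (s - _)]opprB.
  apply: norm_r_int_cst => [|//|r rab]; first exact: ltW.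
  by apply: dP; rewrite /A /B; case: (leP a t) => ?; apply/andP; split; lra.
have h2 : `|r_int (psi t) t s| <= M * `|s - t|.
  move: st1; rewrite ltr_norml => /andP[st1 st2].
  have [ts|ts] := leP t s.
    rewrite (ger0_norm (_ : 0 <= s - t)) ?subr_ge0//; apply: norm_r_int_cst => // r rab.
    by apply: MP; apply/andP; split; lra.
  rewrite r_intN normrN (ltr0_norm (_ : s - t < 0)) ?subr_lt0// [- (s - _)]opprB.
  apply: norm_r_int_cst => [|//|r rab]; first exact: ltW.
  by apply: MP; apply/andP; split; lra.
rewrite (le_trans (ler_normD _ _))// (splitr e) lerD//.
  apply: (le_trans h1); rewrite -mulrA [2^-1 * _]mulrC mulrA ler_pM2r ?invr_gt0//.
  rewrite mulrAC ler_pdivrMr// ler_pM2l// ler_norml; move: st1; rewrite ltr_norml.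
  by rewrite /A /B; case: (leP a t) => ? /andP[? ?]; apply/andP; split; lra.
by apply: (le_trans h2); rewrite -ler_pdivlMl// mulrC ltW.
Qed.

End integrals_of_continuous_functions.

(** * Stieltjes integrals in which one factor is continuously differentiable *)

Section stieltjes.
Context {R : realType} {V : completeNormedModType R}.
Implicit Types (phi psi : R -> V) (beta : R -> R).

(** The integrand is C^1, so the integral exists against a merely continuous [beta], such as a
    Brownian path. *)
Lemma rs_int_by_parts phi psi beta a b : a <= b -> continuous beta -> continuous psi ->
  is_primitive psi phi ->
  rs_int phi beta a b =
    beta b *: phi b - beta a *: phi a - r_int (fun r => beta r *: psi r) a b.
Proof.
move=> ab cbeta cpsi pphi.
have cbpsi : continuous (fun r => beta r *: psi r).
  by move=> r; apply: continuousZ; [exact: cbeta|exact: cpsi].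
have [H pH] := primitive_exists cbpsi.
rewrite (r_intE _ _ pH) (_ : _ - _ = (beta b *: phi b - H b) - (beta a *: phi a - H a)).
  2: by zmod.
apply: rs_intE => //.
apply: (@is_rs_int_local _ _ _ _ (fun r => beta r *: phi r - H r)) => // e e0.
have [Mb Mb0 MbP] := @bounded_itv R R^o (beta : R -> R^o) a b cbeta.
have [Mp Mp0 MpP] := bounded_itv a b cpsi.
have S0 : 0 < Mb + 1 + Mp by lra.
pose f := e / (Mb + 1 + Mp).
have f0 : 0 < f by rewrite divr_gt0.
have [d1 d10 P1] := pphi a b f f0.
have [d2 d20 P2] := pH a b f f0.
have [d3 d30 P3] := @unif_cont_itv R R^o (beta : R -> R^o) a b f cbeta f0.
exists (Num.min (Num.min d1 d2) d3); first by rewrite !lt_min d10 d20 d30.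
move=> p c q ap /andP[pc cq] qb; rewrite !lt_min => /andP[/andP[qp1 qp2] qp3].
have cab : a <= c <= b by rewrite (le_trans ap)// (le_trans cq).
have pab : a <= p <= b by rewrite ap (le_trans pc)// (le_trans cq).
have qab : a <= q <= b by rewrite qb andbT (le_trans ap)// (le_trans pc).
(* The local defect consists of the errors of the primitives [H] on [[p, q]] and [phi] on either
   side of the tag, and of the oscillation of [beta] around the tag times a bounded slope; each is
   [o(q - p)]. *)
have -> : (beta q - beta p) *: phi c - (beta q *: phi q - H q - (beta p *: phi p - H p)) =
    (H q - H p - (q - p) *: (beta c *: psi c)) -
    beta q *: (phi q - phi c - (q - c) *: psi c) -
    beta p *: (phi c - phi p - (c - p) *: psi c) -
    (beta q - beta c) *: ((q - c) *: psi c) - (beta p - beta c) *: ((c - p) *: psi c).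
  have -> : (q - p) *: (beta c *: psi c) =
      beta q *: ((q - c) *: psi c) + beta p *: ((c - p) *: psi c) -
      (beta q - beta c) *: ((q - c) *: psi c) - (beta p - beta c) *: ((c - p) *: psi c).
    by rewrite !scalerA -scalerDl -!scalerBl; congr (_ *: _); ring.
  by zmod.
have cpq : p <= c <= q by rewrite pc.
have qc0 : 0 <= q - c by rewrite subr_ge0.
have cp0 : 0 <= c - p by rewrite subr_ge0.
have h1 := P2 p c q ap cpq qb qp2.
have h2 : `|beta q *: (phi q - phi c - (q - c) *: psi c)| <= Mb * (f * (q - c)).
  by rewrite normrZ ler_pM ?MbP// P1 ?lexx//; lra.
have h3 : `|beta p *: (phi c - phi p - (c - p) *: psi c)| <= Mb * (f * (c - p)).
  by rewrite normrZ ler_pM ?MbP// P1 ?lexx ?pc//; lra.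
have h4 : `|(beta q - beta c) *: ((q - c) *: psi c)| <= f * ((q - c) * Mp).
  rewrite !normrZ (ger0_norm qc0) ler_pM ?mulr_ge0//; last by rewrite ler_wpM2l// MpP.
  by apply: ltW; apply: P3 => //; rewrite ger0_norm//; lra.
have h5 : `|(beta p - beta c) *: ((c - p) *: psi c)| <= f * ((c - p) * Mp).
  rewrite !normrZ (ger0_norm cp0) ler_pM ?mulr_ge0//; last by rewrite ler_wpM2l// MpP.
  by apply: ltW; apply: P3 => //; rewrite distrC ger0_norm//; lra.
do 4 (apply: le_trans (ler_normB _ _) _; rewrite -lerBrDr).
apply: (le_trans h1).
have -> : e = f * (Mb + 1 + Mp) by rewrite /f mulfVK// gt_eqF.
lra.
Qed.

(** Used to write the Wong-Zakai forcing as a Stieltjes integral against the integrated process, the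
    form that the original forcing has. *)
Lemma rs_int_C1 phi beta (beta' : R -> R) a b : a <= b -> continuous phi ->
  continuous beta' -> is_primitive (beta' : R -> R^o) (beta : R -> R^o) ->
  rs_int phi beta a b = r_int (fun r => beta' r *: phi r) a b.
Proof.
move=> ab cphi cbeta pbeta.
have cbphi : continuous (fun r => beta' r *: phi r).
  by move=> r; apply: continuousZ; [exact: cbeta|exact: cphi].
have [H pH] := primitive_exists cbphi.
rewrite (r_intE _ _ pH); apply: rs_intE => //.
apply: is_rs_int_local => // e e0.
have [M M0 MP] := bounded_itv a b cphi.
have f0 : 0 < e / (M + 1) by rewrite divr_gt0// addr_gt0.
have [d1 d10 P1] := pbeta a b _ f0.
have [d2 d20 P2] := pH a b _ f0.
exists (Num.min d1 d2); first by rewrite !lt_min d10.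
move=> p c q ap pcq qb; rewrite !lt_min => /andP[qp1 qp2].
have cab : a <= c <= b.
  by case/andP: pcq => pc cq; rewrite (le_trans ap)// (le_trans cq).
have -> : (beta q - beta p) *: phi c - (H q - H p) =
    (beta q - beta p - (q - p) * beta' c) *: phi c -
    (H q - H p - (q - p) *: (beta' c *: phi c)).
  by rewrite scalerA; zmod.
rewrite (le_trans (ler_normB _ _))// normrZ.
have h1 := P1 p c q ap pcq qb qp1; have h2 := P2 p c q ap pcq qb qp2.
apply: (@le_trans _ _ (e / (M + 1) * (q - p) * M + e / (M + 1) * (q - p))).
  by rewrite lerD// ler_pM// MP.
rewrite -[X in _ + X]mulr1 -mulrDr mulrAC mulfVK// gt_eqF// addr_gt0//.
Qed.

End stieltjes.

(** * Improper integrals of exponentially bounded functions *)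

Section improper_integrals.
Context {R : realType} {V : completeNormedModType R}.
Implicit Types (phi : R -> V).

Lemma cauchy_at_cvg (F : set_system R) {FF : ProperFilter F} (u : R -> V) :
  (forall e, 0 < e -> exists x, \forall y \near F, `|u x - u y| <= e) ->
  cvg (u y @[y --> F]).
Proof.
move=> H; apply/cauchy_cvgP/cauchy_exP => e e0.
have [x xP] := H (e / 2) (ltac:(by rewrite divr_gt0)).
exists (u x); apply: filterS xP => y; rewrite -ball_normE /= => h.
by rewrite (le_lt_trans h)// ltr_pdivrMr// ltr_pMr// ltr1n.
Qed.

Lemma linear_cvg (W : normedModType R) (L : V -> W) (M : R) (T : Type)
    (F : set_system T) {FF : Filter F} (u : T -> V) (l : V) :
  linear L -> (forall v, `|L v| <= M * `|v|) ->
  u x @[x --> F] --> l -> L (u x) @[x --> F] --> L l.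
Proof.
move=> linL LM ul; apply/cvgrPdist_le => e e0.
pose N := Num.max M 1.
have N0 : 0 < N by rewrite lt_max ltr01 orbT.
have /cvgrPdist_le/(_ _ (divr_gt0 e0 N0)) := ul; apply: filterS => x h.
rewrite -linear_funB// (le_trans (LM _))// (@le_trans _ _ (N * `|l - u x|))//.
  by rewrite ler_wpM2r// le_max lexx.
by rewrite -ler_pdivlMl// mulrC.
Qed.

Definition int_from_ninfty phi t : V := lim (r_int phi a t @[a --> -oo]).
Definition int_to_pinfty phi t : V := lim (r_int phi t b @[b --> +oo]).

Lemma expR_small_pinfty (C d e : R) : 0 <= C -> 0 < d -> 0 < e ->
  exists t0, forall t, t0 <= t -> C * expR (- d * t) <= e.
Proof.
(* The witness comes from [1 + d * t <= expR (d * t)]. *)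
move=> C0 d0 e0; exists (C / (e * d)) => t Ct.
rewrite mulNr expRN ler_pdivrMr ?expR_gt0//.
apply: (@le_trans _ _ (e * (1 + d * t))); last by rewrite ler_pM2l// expR_ge1Dx.
by move: Ct; rewrite ler_pdivrMr ?mulr_gt0//; lra.
Qed.

Lemma cvg_int_to_pinfty phi (C d t0 t : R) : continuous phi -> 0 < d ->
  (forall r, t0 <= r -> `|phi r| <= C * expR (- d * r)) ->
  cvg (r_int phi t b @[b --> +oo]).
Proof.
move=> cphi d0 H.
have C0 : 0 <= C.
  have := le_trans (normr_ge0 _) (H t0 (lexx _)).
  by rewrite pmulr_lge0// expR_gt0.
apply: cauchy_at_cvg => e e0.
have [t1 t1P] := expR_small_pinfty (divr_ge0 C0 (ltW d0)) d0 e0.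
exists (Num.max t0 t1).
near=> b.
have b1 : Num.max t0 t1 <= b by near: b; apply: nbhs_pinfty_ge; exact: num_real.
rewrite distrC -(r_int_cat t (Num.max t0 t1) b cphi) addrAC subrr add0r.
apply: (le_trans (norm_r_int_exp _ b1 cphi (C := C) (k := - d) _)).
- by rewrite oppr_eq0 gt_eqF.
- by move=> r /andP[r1 _]; apply: H; rewrite (le_trans _ r1)// le_max lexx.
rewrite invrN mulrN mulNr -mulrN opprB.
apply: le_trans (t1P (Num.max t0 t1) _); last by rewrite le_max lexx orbT.
by rewrite ler_wpM2l ?divr_ge0 ?(ltW d0)// lerBlDr lerDl expR_ge0.
Unshelve. all: by end_near. Qed.

Lemma cvg_int_from_ninfty phi (C d t0 t : R) : continuous phi -> 0 < d ->
  (forall r, r <= t0 -> `|phi r| <= C * expR (d * r)) ->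
  cvg (r_int phi a t @[a --> -oo]).
Proof.
move=> cphi d0 H.
have C0 : 0 <= C.
  have := le_trans (normr_ge0 _) (H t0 (lexx _)).
  by rewrite pmulr_lge0// expR_gt0.
apply: cauchy_at_cvg => e e0.
have [t1 t1P] := expR_small_pinfty (divr_ge0 C0 (ltW d0)) d0 e0.
exists (Num.min t0 (- t1)).
near=> b.
have b1 : b <= Num.min t0 (- t1) by near: b; apply: nbhs_ninfty_le; exact: num_real.
rewrite distrC -(r_int_cat b (Num.min t0 (- t1)) t cphi) addrK.
apply: (le_trans (norm_r_int_exp _ b1 cphi (C := C) (k := d) _)).
- by rewrite gt_eqF.
- by move=> r /andP[_ r1]; apply: H; rewrite (le_trans r1)// ge_min lexx.
apply: le_trans (t1P (- Num.min t0 (- t1)) _); last first.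
  by rewrite lerNr ge_min lexx orbT.
by rewrite mulrNN ler_wpM2l ?divr_ge0 ?(ltW d0)// lerBlDr lerDl expR_ge0.
Unshelve. all: by end_near. Qed.

Lemma norm_int_to_pinfty phi (C d t : R) : continuous phi -> 0 < d ->
  (forall r, t <= r -> `|phi r| <= C * expR (- d * r)) ->
  `|int_to_pinfty phi t| <= C / d * expR (- d * t).
Proof.
move=> cphi d0 H; have cv := cvg_int_to_pinfty (t := t) cphi d0 H.
have C0 : 0 <= C.
  have := le_trans (normr_ge0 _) (H t (lexx _)).
  by rewrite pmulr_lge0// expR_gt0.
apply: (lim_norm_le cv); near=> b.
have tb : t <= b by near: b; apply: nbhs_pinfty_ge; exact: num_real.
apply: (le_trans (norm_r_int_exp _ tb cphi (C := C) (k := - d) _)).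
- by rewrite oppr_eq0 gt_eqF.
- by move=> r /andP[r1 _]; apply: H.
rewrite invrN mulrN mulNr -mulrN opprB.
by rewrite ler_wpM2l ?divr_ge0 ?(ltW d0)// lerBlDr lerDl expR_ge0.
Unshelve. all: by end_near. Qed.

Lemma norm_int_from_ninfty phi (C d t : R) : continuous phi -> 0 < d ->
  (forall r, r <= t -> `|phi r| <= C * expR (d * r)) ->
  `|int_from_ninfty phi t| <= C / d * expR (d * t).
Proof.
move=> cphi d0 H; have cv := cvg_int_from_ninfty (t := t) cphi d0 H.
have C0 : 0 <= C.
  have := le_trans (normr_ge0 _) (H t (lexx _)).
  by rewrite pmulr_lge0// expR_gt0.
apply: (lim_norm_le cv); near=> b.
have tb : b <= t by near: b; apply: nbhs_ninfty_le; exact: num_real.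
apply: (le_trans (norm_r_int_exp _ tb cphi (C := C) (k := d) _)).
- by rewrite gt_eqF.
- by move=> r /andP[_ r1]; apply: H.
by rewrite ler_wpM2l ?divr_ge0 ?(ltW d0)// lerBlDr lerDl expR_ge0.
Unshelve. all: by end_near. Qed.

Lemma int_to_pinfty_cat phi s t : continuous phi ->
  cvg (r_int phi t b @[b --> +oo]) ->
  int_to_pinfty phi s = r_int phi s t + int_to_pinfty phi t.
Proof.
move=> cphi cv; apply: cvg_lim => //.
rewrite (_ : (fun b => r_int phi s b) = (fun b => r_int phi s t + r_int phi t b)).
  by apply: cvgD => //; exact: cvg_cst.
by apply/funext => b; rewrite r_int_cat.
Qed.

Lemma int_from_ninfty_cat phi s t : continuous phi ->
  cvg (r_int phi a s @[a --> -oo]) ->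
  int_from_ninfty phi t = int_from_ninfty phi s + r_int phi s t.
Proof.
move=> cphi cv; apply: cvg_lim => //.
rewrite (_ : (fun b => r_int phi b t) = (fun b => r_int phi b s + r_int phi s t)).
  by apply: cvgD => //; exact: cvg_cst.
by apply/funext => b; rewrite r_int_cat.
Qed.

Lemma int_to_pinfty_linear (W : completeNormedModType R) (L : V -> W) M phi t :
  linear L -> (forall v, `|L v| <= M * `|v|) -> continuous phi ->
  cvg (r_int phi t b @[b --> +oo]) ->
  lim (r_int (L \o phi) t b @[b --> +oo]) = L (int_to_pinfty phi t).
Proof.
move=> linL LM cphi cv; apply: cvg_lim => //.
rewrite (_ : (fun b => _) = (fun b => L (r_int phi t b))).
  by apply: (linear_cvg linL LM).
by apply/funext => b; rewrite (r_int_linear _ _ linL LM).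
Qed.

Lemma int_from_ninfty_linear (W : completeNormedModType R) (L : V -> W) M phi t :
  linear L -> (forall v, `|L v| <= M * `|v|) -> continuous phi ->
  cvg (r_int phi a t @[a --> -oo]) ->
  lim (r_int (L \o phi) a t @[a --> -oo]) = L (int_from_ninfty phi t).
Proof.
move=> linL LM cphi cv; apply: cvg_lim => //.
rewrite (_ : (fun b => _) = (fun b => L (r_int phi b t))).
  by apply: (linear_cvg linL LM).
by apply/funext => b; rewrite (r_int_linear _ _ linL LM).
Qed.

End improper_integrals.

(** * Semigroups and groups *)

Section semigroup_theory.
Context {R : realType}.

(** Pass through [S s x]: strong continuity controls the change of time, and the local bound on the
    operators controls the change of vector. *)
Lemma joint_continuity (V W : normedModType R) (S : R -> V -> W) :
  (forall t, linear (S t)) ->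
  (forall t, exists M d, 0 < d /\ forall s x, `|s - t| < d -> `|S s x| <= M * `|x|) ->
  (forall x, continuous (fun t => S t x)) ->
  continuous (fun p : R * V => S p.1 p.2).
Proof.
move=> linS bS cS [t x]; apply/cvgrPdist_le => e e0 /=.
have [M [d [d0 MP]]] := bS t.
pose N := Num.max M 1.
have N0 : 0 < N by rewrite lt_max ltr01 orbT.
have e20 : 0 < e / 2 by rewrite divr_gt0.
have /cvgrPdist_le/(_ _ e20) h1 := cS x t.
have h2 : \forall s \near t, `|s - t| < d.
  by apply/nbhs_normP; exists d => // s; rewrite /= distrC.
have h3 : \forall y \near x, `|y - x| < e / 2 / N.
  by apply/nbhs_normP; exists (e / 2 / N); rewrite /= ?divr_gt0// => s; rewrite /= distrC.
exists ([set s | `|S t x - S s x| <= e / 2 /\ `|s - t| < d], [set y | `|y - x| < e / 2 / N]).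
  by split => //=; exact: filterI.
move=> [s y] /= [[st sd] yx].
rewrite (le_trans (ler_distD (S s x) _ _))// [leRHS](splitr e) lerD//.
rewrite -linear_funB// (le_trans (MP _ _ sd))// (@le_trans _ _ (N * `|x - y|))//.
  by rewrite ler_wpM2r// le_max lexx.
by rewrite -ler_pdivlMl// mulrC distrC ltW.
Qed.

Lemma continuous_linear_le (V W : normedModType R) (L : V -> W) :
  linear L -> continuous L -> exists2 M, 0 < M & forall x, `|L x| <= M * `|x|.
Proof.
move=> linL cL; have L0 : L 0 = 0 by rewrite -[X in L X](subrr (0 : V)) linear_funB// subrr.
have := cL 0 => /cvgrPdist_le/(_ _ ltr01) /nbhs_norm0P[d /= d0 dP].
exists (2 / d); first by rewrite divr_gt0.
move=> x; have [->|x0] := eqVneq x 0; first by rewrite L0 !normr0 mulr0.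
have nx0 : 0 < `|x| by rewrite normr_gt0.
have k0 : 0 < d / 2 / `|x| by rewrite !divr_gt0.
set k := d / 2 / `|x| in k0.
have kx : `|k *: x| < d.
  rewrite normrZ (gtr0_norm k0) /k mulfVK ?gt_eqF//.
  by rewrite ltr_pdivrMr// ltr_pMr// ltr1n.
have := dP _ kx; rewrite /= L0 sub0r normrN linear_funZ// normrZ (gtr0_norm k0) => h.
rewrite -(ler_pM2l k0) (le_trans h)//.
by have -> : k * (2 / d * `|x|) = 1; [rewrite /k; field; rewrite !gt_eqF|].
Qed.

Variables (V : completeNormedModType R) (S : R -> V -> V) (gamma : R).
Hypotheses (gamma0 : 0 < gamma) (S_sg : C0_semigroup S).
Hypothesis S_decay : forall t x, 0 <= t -> `|S t x| <= expR (- gamma * t) * `|x|.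

(* The extension to negative times makes the integrands of the convolutions
   continuous on the whole line. *)
Definition semigroup_ext (c t : R) : V -> V := S (c * Num.max 0 t).

Lemma semigroup_ext_linear c t : 0 <= c -> linear (semigroup_ext c t).
Proof.
move=> c0; have [linS _ _ _] := S_sg.
by apply: (linS _ _).1; rewrite mulr_ge0// le_max lexx.
Qed.

Lemma semigroup_ext_le0 c t x : t <= 0 -> semigroup_ext c t x = x.
Proof.
by move=> t0; rewrite /semigroup_ext max_l// mulr0; case: S_sg => _ + _ _; exact.
Qed.

Lemma semigroup_extD c s t x : 0 <= c -> 0 <= s -> 0 <= t ->
  semigroup_ext c (s + t) x = semigroup_ext c s (semigroup_ext c t x).
Proof.
move=> c0 s0 t0; rewrite /semigroup_ext !max_r ?addr_ge0// mulrDr.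
by case: S_sg => _ _ + _; apply; rewrite mulr_ge0.
Qed.

Lemma semigroup_ext_decay c t x : 0 <= c -> 0 <= t ->
  `|semigroup_ext c t x| <= expR (- (gamma * c) * t) * `|x|.
Proof.
move=> c0 t0; rewrite /semigroup_ext max_r//.
by have := S_decay x (mulr_ge0 c0 t0); rewrite mulrA mulNr.
Qed.

Lemma semigroup_ext_contraction c t x : 0 <= c -> `|semigroup_ext c t x| <= `|x|.
Proof.
move=> c0; have m0 : 0 <= c * Num.max 0 t by rewrite mulr_ge0// le_max lexx.
apply: (le_trans (S_decay x m0)); rewrite -[leRHS]mul1r ler_wpM2r//.
by rewrite -expR0 ler_expR mulNr oppr_le0 mulr_ge0// ltW.
Qed.

Lemma semigroup_ext_continuous c x : 0 <= c -> continuous (fun t => semigroup_ext c t x).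
Proof.
move=> c0 t; apply: continuous_atP => e e0.
have [_ S0 SD Sc] := S_sg.
have [d d0 dP] : exists2 d, 0 < d & forall h, 0 <= h -> h < d -> `|S h x - x| <= e.
  have /cvgrPdist_le/(_ _ e0) := Sc x; rewrite /at_right near_withinE.
  move=> /nbhs_norm0P[d /= d0 dP]; exists d => // h.
  rewrite le_eqVlt => /predU1P[<- _|h0 hd]; first by rewrite S0 subrr normr0 ltW.
  by rewrite distrC; apply: dP => //; rewrite /= gtr0_norm.
(* The axioms give right continuity at 0 only. Factoring out the contraction [S p] carries it to
   every time, with a [d] independent of [p], and so gives continuity from both sides. *)
have key p q : 0 <= p -> p <= q -> q - p < d -> `|S q x - S p x| <= e.
  move=> p0 pq pqd; have qp0 : 0 <= q - p by rewrite subr_ge0.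
  rewrite -[q in S q _](subrK p) [q - p + p]addrC SD// -linear_funB; last by case: S_sg => /(_ _ p0)[].
  apply: (le_trans (S_decay _ p0)); apply: (@le_trans _ _ `|S (q - p) x - x|); last exact: dP.
  rewrite -[leRHS]mul1r ler_wpM2r//.
  by rewrite -expR0 ler_expR mulNr oppr_le0 mulr_ge0// ltW.
have c1 : 0 < c + 1 by rewrite ltr_wpDl.
exists (d / (c + 1)); first by rewrite divr_gt0.
move=> s; rewrite ltr_pdivlMr// => std.
rewrite /semigroup_ext.
have m0 r : 0 <= c * Num.max 0 r by rewrite mulr_ge0// le_max lexx.
have lip p q : p <= q -> c * Num.max 0 p <= c * Num.max 0 q /\
    c * Num.max 0 q - c * Num.max 0 p <= (q - p) * (c + 1).
  move=> pq; split; first by rewrite ler_wpM2l// ge_max !le_max lexx pq orbT.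
  rewrite -mulrBr mulrC; apply: (@le_trans _ _ ((q - p) * c)).
    by rewrite ler_wpM2r//; have [?|?] := leP 0 q; have [?|?] := leP 0 p; lra.
  by rewrite ler_wpM2l ?subr_ge0// lerDl.
have [st|ts] := leP s t.
  have [h1 h2] := lip _ _ st; rewrite distrC; apply: key => //.
  by apply: (le_lt_trans h2); move: std; rewrite distrC ger0_norm ?subr_ge0.
have [h1 h2] := lip _ _ (ltW ts); apply: key => //.
by apply: (le_lt_trans h2); move: std; rewrite ger0_norm// subr_ge0 ltW.
Qed.

Lemma semigroup_ext_continuous2 c : 0 <= c ->
  continuous (fun p : R * V => semigroup_ext c p.1 p.2).
Proof.
move=> c0; apply: joint_continuity.
- by move=> t; exact: semigroup_ext_linear.
- by move=> t; exists 1, 1; split=> // s x _; rewrite mul1r semigroup_ext_contraction.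
- by move=> x; exact: semigroup_ext_continuous.
Qed.

End semigroup_theory.

(** * Orbits of vectors in the domain of a generator *)

Section generators.
Context {R : realType} (V : completeNormedModType R) (S : R -> V -> V) (gamma : R).
Hypotheses (gamma0 : 0 < gamma) (S_sg : C0_semigroup S).
Hypothesis S_decay : forall t x, 0 <= t -> `|S t x| <= expR (- gamma * t) * `|x|.

Let Se := semigroup_ext S 1.

Let SeE t x : 0 <= t -> Se t x = S t x.
Proof. by move=> t0; rewrite /Se /semigroup_ext mul1r max_r. Qed.

Let Se_cont x : continuous (fun t => Se t x).
Proof. exact: (semigroup_ext_continuous gamma0 S_sg S_decay). Qed.

(* With [I] the integral of [S x] over [0, t], the difference quotient
   [(S h I - I) / h] is both the integral of [S ((S h x - x) / h)] and a difference
   of two means of [S x], over [t, t + h] and over [0, h]. *)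
Lemma semigroup_generator_integral x y t :
  h^-1 *: (S h x - x) @[h --> 0^'+] --> y -> 0 <= t ->
  S t x = x + r_int (fun u => Se u y) 0 t.
Proof.
move=> genx t0; apply/eqP; rewrite addrC -subr_eq eq_sym -subr_eq0 -normr_le0.
apply/ler_addgt0Pl => e e0; rewrite addr0.
(* [e] is shared by the integral over [[0, t]], which costs [f * t], and the two means, which cost
   [f] each. *)
have f0 : 0 < e / (t + 2) by rewrite divr_gt0// ltr_wpDl.
set f := e / (t + 2) in f0.
have [G pG] := primitive_exists (@Se_cont x).
have [d d0 dP] := pG 0 (t + 1) f f0.
have /filter_ex[h [h0 hd hf]] : \forall h \near (0 : R)^'+,
    [/\ 0 < h, h < Num.min 1 d & `|y - h^-1 *: (S h x - x)| <= f].
  near=> h; split.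
  - by near: h; exact: nbhs_right_gt.
  - by near: h; apply: nbhs_right_lt; rewrite lt_min ltr01.
  - by near: h; move/cvgrPdist_le : genx; apply.
have {hd} [h1 hd] : h < 1 /\ h < d by move: hd; rewrite lt_min => /andP[].
have hle := ltW h0.
have [[linSh _]] : (linear (S h) /\ continuous (S h)) /\ True.
  by split=> //; case: S_sg => /(_ _ hle).
have Shle v : `|S h v| <= expR (- gamma * h) * `|v| by exact: S_decay.
have SD u v w : 0 <= u -> 0 <= v -> S (u + v) w = S u (S v w).
  by move=> u0 v0; case: S_sg => _ _ + _; exact.
have E : r_int (fun u => Se u (h^-1 *: (S h x - x))) 0 t =
    h^-1 *: ((G (t + h) - G t) - (G h - G 0)).
  transitivity (h^-1 *: (r_int (fun u => Se (h + u) x) 0 t - r_int (fun u => Se u x) 0 t)).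
    have c1 : continuous (fun u => Se (h + u) x).
      move=> u; apply: (@continuous_comp R R V (fun u => h + u) (fun u => Se u x)).
        by apply: cvgD; [exact: cvg_cst|exact: cvg_id].
      exact: Se_cont.
    rewrite -r_intB// -r_intZ; last by move=> u; apply: cvgB; [exact: c1|exact: Se_cont].
    apply: eq_r_int => // u /andP[u0 ut].
    have [[linSu _] _] : (linear (S u) /\ continuous (S u)) /\ True.
      by split=> //; case: S_sg => /(_ _ u0).
    by rewrite !SeE ?addr_ge0// linear_funZ// linear_funB// -SD// [u + h]addrC.
  rewrite (@r_int_shift _ _ (fun u => Se u x) _ _ _ (@Se_cont x)).
  by rewrite !(r_intE _ _ pG) addr0 [h + t]addrC; congr (_ *: _); zmod.
have e1 : `|r_int (fun u => Se u y) 0 t - r_int (fun u => Se u (h^-1 *: (S h x - x))) 0 t|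
    <= f * t.
  rewrite -r_intB//; rewrite -[X in _ * X](subr0 t); apply: norm_r_int_cst => //.
    by move=> u; apply: cvgB; exact: Se_cont.
  move=> u /andP[u0 _]; rewrite -linear_funB; last exact: semigroup_ext_linear.
  exact: (le_trans (semigroup_ext_contraction gamma0 S_decay _ _ ler01)).
have e2 : `|h^-1 *: (G (t + h) - G t) - S t x| <= f.
  have := dP t t (t + h) t0; rewrite lexx lerDl hle addrAC subrr add0r => /(_ isT _ hd) H.
  have {H} := H (ltac:(by rewrite lerD2l ltW)); rewrite SeE// => H.
  rewrite -(ler_pM2l h0) -[X in X * `|_|](gtr0_norm h0) -normrZ scalerBr scalerA divff ?gt_eqF//.
  by rewrite scale1r [h * f]mulrC.
have e3 : `|h^-1 *: (G h - G 0) - x| <= f.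
  have := dP 0 0 h (lexx _); rewrite lexx hle subr0 => /(_ isT _ hd) H.
  have {H} := H (ltac:(lra)); rewrite SeE//.
  have -> : S 0 x = x by case: S_sg => _ + _ _; exact.
  move=> H; rewrite -(ler_pM2l h0) -[X in X * `|_|](gtr0_norm h0) -normrZ scalerBr scalerA.
  by rewrite divff ?gt_eqF// scale1r [h * f]mulrC.
have -> : r_int (fun u => Se u y) 0 t - (S t x - x) =
  (r_int (fun u => Se u y) 0 t - r_int (fun u => Se u (h^-1 *: (S h x - x))) 0 t) +
  (h^-1 *: (G (t + h) - G t) - S t x) - (h^-1 *: (G h - G 0) - x).
  by rewrite E; zmod.
have -> : e = f * t + f + f by rewrite /f; field; rewrite gt_eqF// ltr_wpDl.
by rewrite (le_trans (ler_normB _ _))// lerD// (le_trans (ler_normD _ _))// lerD.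
Unshelve. all: by end_near. Qed.

(** For [x] in the domain the orbit is C^1, and integration by parts leaves only values of [beta],
    none of its increments. The convolutions of two noises are therefore as close as the noises are
    uniformly. *)
Lemma rs_int_semigroup (eps : R) (beta : R -> R) (x y : V) s t : 0 < eps ->
  h^-1 *: (S h x - x) @[h --> 0^'+] --> y -> continuous beta -> s <= t ->
  rs_int (fun r => S ((t - r) / eps) x) beta s t =
    beta t *: x - beta s *: S ((t - s) / eps) x +
    eps^-1 *: r_int (fun r => beta r *: semigroup_ext S eps^-1 (t - r) y) s t.
Proof.
move=> eps0 genx cbeta st.
have ei0 : 0 <= eps^-1 by rewrite invr_ge0 ltW.
have [G pG] := primitive_exists (@Se_cont y).
have SG r : r <= t -> S ((t - r) / eps) x = x - G 0 + G (t / eps + - eps^-1 * r).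
  move=> rt; rewrite (semigroup_generator_integral genx) ?mulr_ge0 ?subr_ge0//.
  by rewrite (r_intE _ _ pG) mulrBl mulNr [r / _]mulrC; zmod.
have pG' := is_primitive_affine (- eps^-1) (t / eps) pG.
have {pG'}pG' : is_primitive (fun r => - (eps^-1 *: semigroup_ext S eps^-1 (t - r) y))
    (fun r => x - G 0 + G (t / eps + - eps^-1 * r)).
  have -> : (fun r => - (eps^-1 *: semigroup_ext S eps^-1 (t - r) y)) =
      (fun r => - eps^-1 *: Se (t / eps + - eps^-1 * r) y).
    apply/funext => r; rewrite scaleNr /Se /semigroup_ext; congr (- (_ *: S _ y)).
    rewrite mul1r mulrC maxr_pMl//; congr (Num.max _ _); first by rewrite mul0r.
    by rewrite mulrBl mulNr [r / _]mulrC.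
  move=> a b e e0; have [d d0 dP] := pG' a b e e0; exists d => // p c q ap pcq qb qpd.
  by rewrite opprD addrACA subrr add0r; exact: dP.
have cSe : continuous (fun r => semigroup_ext S eps^-1 (t - r) y).
  move=> r; apply: (@continuous_comp R R V (fun r => t - r) (fun u => semigroup_ext S eps^-1 u y)).
    by apply: cvgB; [exact: cvg_cst|exact: cvg_id].
  exact: (semigroup_ext_continuous gamma0 S_sg S_decay).
rewrite (eq_rs_int (psi := fun r => x - G 0 + G (t / eps + - eps^-1 * r)) (beta' := beta))//;
  last by move=> r /andP[_ /SG].
rewrite (rs_int_by_parts st cbeta _ pG'); last first.
  by move=> r; apply: cvgN; apply: cvgZl_tmp; exact: cSe.
rewrite -!SG// subrr mul0r.
have -> : S 0 x = x by case: S_sg => _ + _ _; exact.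
congr (_ + _); rewrite -r_intZ; last first.
  by move=> r; apply: cvgZ; [exact: cbeta|exact: cSe].
rewrite -[RHS]opprK; congr (- _).
rewrite -[RHS]scaleN1r -r_intZ.
  by apply: eq_r_int => // r _; rewrite scalerN scaleN1r !scalerA mulrC.
by move=> r; apply: cvgZl_tmp; apply: cvgZ; [exact: cbeta|exact: cSe].
Qed.

End generators.

Section groups.
Context {R : realType} (V : completeNormedModType R) (S : R -> V -> V) (gamma : R).
Hypotheses (gamma0 : 0 < gamma) (S_grp : C0_group S).
Hypothesis S_decay : forall t x, t <= 0 -> `|S t x| <= expR (- gamma * t) * `|x|.

Lemma group_linear t : linear (S t).
Proof. by case: S_grp => /(_ t)[]. Qed.

Lemma groupD s t x : S (s + t) x = S s (S t x).
Proof. by case: S_grp => _ _ + _; exact. Qed.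

Lemma group0 x : S 0 x = x.
Proof. by case: S_grp => _ + _ _; exact. Qed.

(* [S t = S (t - T) S T]: the decay at negative times bounds all the [S t] with
   [t <= T] by the norm of the single operator [S T]. *)
Lemma group_bounded T : exists2 M, 0 < M &
  forall t x, - T <= t -> t <= T -> `|S t x| <= M * `|x|.
Proof.
have [linS cS] : linear (S T) /\ continuous (S T) by case: S_grp => /(_ T).
have [M M0 MP] := continuous_linear_le linS cS.
exists (expR (gamma * (2 * T)) * M); first by rewrite mulr_gt0// expR_gt0.
move=> t x tT1 tT2; rewrite -[t](subrK T) groupD.
have tT : t - T <= 0 by rewrite subr_le0.
apply: (le_trans (S_decay _ tT)); rewrite -mulrA ler_pM// ?expR_ge0//.
by rewrite ler_expR mulNr -mulrN ler_pM2l//; lra.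
Qed.

Lemma group_continuous x : continuous (fun t => S t x).
Proof.
move=> t; apply: continuous_atP => e e0.
have [M M0 MP] := group_bounded `|t|.
have /cvgrPdist_le : S h x @[h --> 0] --> x by case: S_grp.
have f0 : 0 < e / M by rewrite divr_gt0.
move=> /(_ _ f0) /nbhs_norm0P[d d0 dP]; exists d => // s st.
rewrite -[s in S s _](subrKC t) groupD -linear_funB; last exact: group_linear.
have h : `|S t (S (s - t) x - x)| <= M * `|S (s - t) x - x|.
  by apply: MP; [rewrite lerNl -normrN ler_norm|rewrite ler_norm].
by apply: (le_trans h); rewrite -ler_pdivlMl// mulrC distrC dP.
Qed.

Lemma group_continuous2 : continuous (fun p : R * V => S p.1 p.2).
Proof.
apply: joint_continuity; [exact: group_linear| |exact: group_continuous].
move=> t; have [M M0 MP] := group_bounded (`|t| + 1).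
exists M, 1; split => // s x; rewrite ltr_norml => /andP[h1 h2]; apply: MP.
  by have := ler_norm (- t); rewrite normrN; lra.
by have := ler_norm t; lra.
Qed.

End groups.

(** * Weighted contractions *)

Section sum_norm_theory.
Context {R : realType} {H1 H2 : normedModType R}.
Implicit Types z : H1 * H2.

Lemma sum_norm_ge0 z : 0 <= sum_norm z.
Proof. by rewrite addr_ge0. Qed.

Lemma sum_normD z z' : sum_norm (z + z') <= sum_norm z + sum_norm z'.
Proof. by rewrite /sum_norm addrACA lerD//= ler_normD. Qed.

Lemma sum_normN z : sum_norm (- z) = sum_norm z.
Proof. by rewrite /sum_norm /= !normrN. Qed.

Lemma sum_normC z z' : sum_norm (z - z') = sum_norm (z' - z).
Proof. by rewrite -sum_normN opprB. Qed.

Lemma sum_norm_dist z z' z'' : sum_norm (z - z') <= sum_norm (z - z'') + sum_norm (z'' - z').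
Proof. by have := sum_normD (z - z'') (z'' - z'); rewrite addrA subrK. Qed.

Lemma sum_norm_le0 z : sum_norm z <= 0 -> z = 0.
Proof.
case: z => x y; rewrite /sum_norm /= => h; congr (_, _); apply/eqP; rewrite -normr_le0.
  by rewrite (le_trans _ h)// lerDl.
by rewrite (le_trans _ h)// lerDr.
Qed.

Lemma sum_norm_continuous (z : R -> H1 * H2) : continuous z ->
  continuous (fun t => sum_norm (z t)).
Proof.
move=> cz t; apply: cvgD; apply: cvg_norm.
  exact: (cvg_comp _ _ (cz t) cvg_fst).
exact: (cvg_comp _ _ (cz t) cvg_snd).
Qed.

Lemma continuous_pair (x : R -> H1) (y : R -> H2) : continuous x -> continuous y ->
  continuous (fun t => (x t, y t)).
Proof. by move=> cx cy t; apply: cvg_pair; [exact: cx|exact: cy]. Qed.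

Lemma continuous_proj1 (z : R -> H1 * H2) : continuous z -> continuous (fun t => (z t).1).
Proof. by move=> cz t; exact: (cvg_comp _ _ (cz t) cvg_fst). Qed.

Lemma continuous_proj2 (z : R -> H1 * H2) : continuous z -> continuous (fun t => (z t).2).
Proof. by move=> cz t; exact: (cvg_comp _ _ (cz t) cvg_snd). Qed.

End sum_norm_theory.

Lemma congr_lim_near (R : realType) (T : Type) (V : normedModType R) (F : set_system T) {FF : Filter F}
    (f g : T -> V) : {near F, f =1 g} -> lim (f x @[x --> F]) = lim (g x @[x --> F]).
Proof.
move=> fg; congr (lim _); apply/seteqP; split; apply: near_eq_cvg => //.
by apply: filterS fg => x ->.
Qed.

(** * A contraction principle for families of weighted norms *)

Section fixed_point.
Context {R : realType}.

(* If every bound [N] of [h] can be improved to [q N + D], then the least bound is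
   at most [D / (1 - q)]. *)
Lemma self_improving_bound (T : Type) (J : set T) (h : T -> R) (q D B : R) :
  0 <= q -> q < 1 -> (forall t, J t -> h t <= B) ->
  (forall N, (forall t, J t -> h t <= N) -> forall t, J t -> h t <= q * N + D) ->
  forall t, J t -> h t <= D / (1 - q).
Proof.
move=> q0 q1 hB H t Jt.
have sh : has_sup (h @` J).
  by split; [exists (h t), t|exists B => _ [s Js <-]; exact: hB].
have ub s : J s -> h s <= sup (h @` J) by move=> Js; apply: ub_le_sup; [exact: sh.2|exists s].
have q10 : 0 < 1 - q by rewrite subr_gt0.
rewrite ler_pdivlMr// (le_trans (ler_wpM2r (ltW q10) (ub t Jt)))//.
suff : sup (h @` J) <= q * sup (h @` J) + D by lra.
apply: ge_sup; first exact: sh.1.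
by move=> _ [s Js <-]; exact: H.
Qed.

Lemma geometric_dist (V : normedModType R) (u : nat -> V) (C q : R) : 0 <= q -> q < 1 ->
  (forall n, `|u n.+1 - u n| <= C * q ^+ n) ->
  forall n k, `|u (n + k)%N - u n| <= C * q ^+ n / (1 - q).
Proof.
move=> q0 q1 H n k.
have q10 : 0 < 1 - q by rewrite subr_gt0.
have C0 : 0 <= C by have := le_trans (normr_ge0 _) (H 0%N); rewrite mulr1.
have : `|u (n + k)%N - u n| <= C * q ^+ n * (1 - q ^+ k) / (1 - q).
  elim: k => [|k IH]; first by rewrite addn0 subrr normr0 expr0 subrr mulr0 mul0r.
  rewrite addnS (le_trans (ler_distD (u (n + k)%N) _ _))//.
  rewrite (le_trans (lerD (H _) IH))// le_eqVlt; apply/orP; left; apply/eqP.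
  by rewrite exprD [q ^+ k.+1]exprS; field; rewrite gt_eqF.
move=> /le_trans; apply; rewrite ler_wpM2r ?invr_ge0 ?(ltW q10)//.
by rewrite ler_piMr ?mulr_ge0 ?exprn_ge0// lerBlDr lerDl exprn_ge0.
Qed.

Lemma geometric_small (C q e : R) : 0 <= q -> q < 1 -> 0 < e ->
  exists n, forall m, (n <= m)%N -> C * q ^+ m <= e.
Proof.
move=> q0 q1 e0.
have h : C * q ^+ m @[m --> \oo] --> C * 0.
  apply: cvgM; first exact: cvg_cst.
  by apply: cvg_expr; rewrite ger0_norm.
move: h => /cvgrPdist_le/(_ _ e0)[n _ nP]; exists n => m nm.
by have := nP m nm; rewrite mulr0 sub0r normrN => /(le_trans (ler_norm _)).
Qed.

Lemma geometric_limit (V : completeNormedModType R) (u : nat -> R -> V) (q : R) :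
  0 <= q -> q < 1 -> (forall n, continuous (u n)) ->
  (forall T, exists M, forall n t, `|t| <= T -> `|u n.+1 t - u n t| <= M * q ^+ n) ->
  exists v : R -> V, continuous v /\ forall t, u n t @[n --> \oo] --> v t.
Proof.
move=> q0 q1 cu H.
have q10 : 0 < 1 - q by rewrite subr_gt0.
have cv t : cvg (u n t @[n --> \oo]).
  have [M MP] := H `|t|; have tt := lexx `|t|.
  apply: cauchy_seq_cvg => e e0.
  have [N NP] := geometric_small (M / (1 - q) * 2) q0 q1 e0.
  exists N => m m' Nm Nm'; apply: le_trans (NP N (leqnn _)).
  have G := geometric_dist q0 q1 (fun n => MP n t tt) N.
  rewrite (le_trans (ler_distD (u N t) _ _))//.
  have -> : M / (1 - q) * 2 * q ^+ N = M * q ^+ N / (1 - q) + M * q ^+ N / (1 - q).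
    by field; rewrite gt_eqF.
  rewrite lerD//; first by have := G (m - N)%N; rewrite subnKC.
  by rewrite distrC; have := G (m' - N)%N; rewrite subnKC.
exists (fun t => lim (u n t @[n --> \oo])); split=> //.
move=> t; apply: continuous_atP => e e0.
have [M MP] := H (`|t| + 1).
have e30 : 0 < e / 3 by rewrite divr_gt0.
have [N NP] := geometric_small (M / (1 - q)) q0 q1 e30.
have close s : `|s| <= `|t| + 1 -> `|lim (u n s @[n --> \oo]) - u N s| <= e / 3.
  move=> st; apply: (@lim_norm_le _ _ \oo _ _ (fun m => u m s - u N s)).
    by apply: cvgB; [exact: cv|exact: cvg_cst].
  exists N => // m Nm; apply: le_trans (NP N (leqnn _)).
  have := geometric_dist q0 q1 (fun n => MP n s st) N (m - N)%N; rewrite subnKC//.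
  by rewrite mulrAC.
have /cvgrPdist_le/(_ _ e30)/nbhs_normP[d d0 dP] := cu N t.
exists (Num.min 1 d); first by rewrite lt_min ltr01.
move=> s; rewrite lt_min => /andP[st1 std].
have s1 : `|s| <= `|t| + 1.
  by rewrite -[s](subrKC t) (le_trans (ler_normD _ _))// lerD2l ltW.
rewrite (le_trans (ler_distD (u N s) _ _))//.
rewrite (_ : e = e / 3 + (e / 3 + e / 3)); last by field.
rewrite lerD ?close// (le_trans (ler_distD (u N t) _ _))// lerD//.
  by rewrite distrC; apply: dP; rewrite /= distrC.
by rewrite distrC close// lerDl.
Qed.

Variables (H1 H2 : completeNormedModType R) (I : Type) (J : I -> set R) (om : I -> R -> R).
Variables (q : R) (T : (R -> H1 * H2) -> R -> H1 * H2) (z0 : R -> H1 * H2).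
Hypotheses (q0 : 0 <= q) (q1 : q < 1).
Hypothesis om_local : forall L, exists i M, forall t, `|t| <= L -> J i t /\ om i t <= M.
Hypothesis z0_continuous : continuous z0.

(** Distances are measured from [z0], which may itself have infinite norm. The index [i] lets a
    family of seminorms share one fixed point: forward existence takes one for each time horizon,
    since the bound on the slow group depends on it, while tracking takes a single weight on the
    whole line. *)
Definition weighted_class (z : R -> H1 * H2) := continuous z /\
  forall i, exists D, 0 <= D /\ forall t, J i t -> sum_norm (z t - z0 t) <= D * om i t.

Hypothesis T_continuous : forall z, weighted_class z -> continuous (T z).
Hypothesis T_contraction : forall z z' i D, weighted_class z -> weighted_class z' -> 0 <= D ->
  (forall t, J i t -> sum_norm (z t - z' t) <= D * om i t) ->
  forall t, J i t -> sum_norm (T z t - T z' t) <= q * D * om i t.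
Hypothesis T_start : forall i, exists D, 0 <= D /\
  forall t, J i t -> sum_norm (T z0 t - z0 t) <= D * om i t.

Lemma contraction_fixed_point : exists z, weighted_class z /\ forall t, T z t = z t.
Proof.
pose u n := iter n T z0.
have q10 : 0 < 1 - q by rewrite subr_gt0.
have X0 : weighted_class z0.
  split=> // i; exists 0; split=> // t _.
  by rewrite subrr mul0r /sum_norm /= !normr0 addr0.
have XT z : weighted_class z -> weighted_class (T z).
  move=> Xz; split; first exact: T_continuous.
  move=> i; have [D [D0 DP]] := Xz.2 i; have [E [E0 EP]] := T_start i.
  exists (q * D + E); split; first by rewrite addr_ge0// mulr_ge0.
  move=> t Jt; rewrite (le_trans (sum_norm_dist _ _ (T z0 t)))// mulrDl lerD//; last exact: EP.
  exact: T_contraction.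
have Xu n : weighted_class (u n) by elim: n => //= n; exact: XT.
have step i : exists D, 0 <= D /\ forall n t, J i t ->
    sum_norm (u n.+1 t - u n t) <= D * q ^+ n * om i t.
  have [E [E0 EP]] := T_start i; exists E; split=> //; elim=> [t Jt|n IH t Jt].
    by rewrite mulr1; exact: EP.
  rewrite exprS mulrCA; apply: T_contraction => //; first exact: Xu n.+1.
  by rewrite mulr_ge0// exprn_ge0.
have lim1 : exists v : R -> H1, continuous v /\ forall t, (u n t).1 @[n --> \oo] --> v t.
  apply: (geometric_limit q0 q1) => [n|L].
    by apply: continuous_proj1; exact: (Xu n).1.
  have [i [M MP]] := om_local L; have [D [D0 DP]] := step i.
  exists (D * M) => n t /MP[Jt tM].
  apply: (@le_trans _ _ (sum_norm (u n.+1 t - u n t))); first by rewrite lerDl.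
  by rewrite (le_trans (DP n t Jt))// mulrAC ler_wpM2r ?exprn_ge0// ler_wpM2l.
have lim2 : exists v : R -> H2, continuous v /\ forall t, (u n t).2 @[n --> \oo] --> v t.
  apply: (geometric_limit q0 q1) => [n|L].
    by apply: continuous_proj2; exact: (Xu n).1.
  have [i [M MP]] := om_local L; have [D [D0 DP]] := step i.
  exists (D * M) => n t /MP[Jt tM].
  apply: (@le_trans _ _ (sum_norm (u n.+1 t - u n t))); first by rewrite lerDr.
  by rewrite (le_trans (DP n t Jt))// mulrAC ler_wpM2r ?exprn_ge0// ler_wpM2l.
have [x [cx xP]] := lim1; have [y [cy yP]] := lim2.
pose z t := (x t, y t).
have close i : exists E, 0 <= E /\ forall n t, J i t ->
    sum_norm (z t - u n t) <= E * q ^+ n * om i t.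
  have [D [D0 DP]] := step i.
  exists (2 * (D / (1 - q))); split; first by rewrite mulr_ge0// divr_ge0// ltW.
  move=> n t Jt.
  have gd1 : `|x t - (u n t).1| <= D * om i t * q ^+ n / (1 - q).
    apply: (@lim_norm_le _ _ \oo _ _ (fun m => (u m t).1 - (u n t).1)).
      by apply: cvgB; [exact: xP|exact: cvg_cst].
    exists n => // m /= nm.
    have G : forall n, `|(u n.+1 t).1 - (u n t).1| <= D * om i t * q ^+ n.
      by move=> k; rewrite mulrAC; apply: le_trans (DP k t Jt); rewrite lerDl.
    by have := geometric_dist q0 q1 G n (m - n)%N; rewrite subnKC.
  have gd2 : `|y t - (u n t).2| <= D * om i t * q ^+ n / (1 - q).
    apply: (@lim_norm_le _ _ \oo _ _ (fun m => (u m t).2 - (u n t).2)).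
      by apply: cvgB; [exact: yP|exact: cvg_cst].
    exists n => // m /= nm.
    have G : forall n, `|(u n.+1 t).2 - (u n t).2| <= D * om i t * q ^+ n.
      by move=> k; rewrite mulrAC; apply: le_trans (DP k t Jt); rewrite lerDr.
    by have := geometric_dist q0 q1 G n (m - n)%N; rewrite subnKC.
  apply: (le_trans (lerD gd1 gd2)); rewrite le_eqVlt; apply/orP; left; apply/eqP.
  by field; rewrite gt_eqF.
have Xz : weighted_class z.
  split; first exact: continuous_pair.
  by move=> i; have [E [E0 EP]] := close i; exists E; split=> // t /(EP 0%N); rewrite mulr1.
exists z; split=> // t; apply/eqP; rewrite -subr_eq0; apply/eqP; apply: sum_norm_le0.
(* [T z t] and [z t] are both geometrically close to the iterate [u n.+1 t = T (u n) t]; any index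
   [i] whose domain contains [t] will do. *)
apply/ler_addgt0Pl => e e0; rewrite addr0.
have [i [M MP]] := om_local `|t|; have [Jt _] := MP t (lexx _).
have [E [E0 EP]] := close i.
have [n nP] := geometric_small (2 * (E * om i t)) q0 q1 e0.
apply: le_trans (nP n.+1 (leqnSn n)).
rewrite (le_trans (sum_norm_dist _ _ (u n.+1 t)))//.
have h1 := EP n.+1 t Jt.
have h2 : sum_norm (T z t - T (u n) t) <= q * (E * q ^+ n) * om i t.
  apply: T_contraction => //; first by rewrite mulr_ge0// exprn_ge0.
  by move=> s Js; exact: EP.
rewrite sum_normC in h1.
apply: (le_trans (lerD h2 h1)); rewrite le_eqVlt; apply/orP; left; apply/eqP.
by rewrite exprS; ring.
Qed.

End fixed_point.

(** * Mild solutions of slow-fast systems *)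

Section convolutions.
Context {R : realType} {V : completeNormedModType R}.
Variable S : R -> V -> V.
Implicit Types q : R -> V.
Hypothesis S_linear : forall t, linear (S t).
Hypothesis S_bounded : forall t, exists M, forall v, `|S t v| <= M * `|v|.
Hypothesis S_continuous : continuous (fun p : R * V => S p.1 p.2).

Definition convol q s t : V := r_int (fun r => S (t - r) (q r)) s t.

Lemma convol_integrand_continuous2 q : continuous q ->
  continuous (fun p : R * R => S (p.1 - p.2) (q p.2)).
Proof.
move=> cq p.
apply: (@continuous_comp (R * R)%type (R * V)%type V (fun p => (p.1 - p.2, q p.2))
  (fun p => S p.1 p.2)); last exact: S_continuous.
apply: (@cvg_pair _ _ _ _ (nbhs (p.1 - p.2)) (nbhs (q p.2))).
  by apply: cvgB; [exact: cvg_fst|exact: cvg_snd].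
by apply: (cvg_comp snd q _ (cq p.2)); exact: cvg_snd.
Qed.

Lemma convol_integrand_continuous q t : continuous q ->
  continuous (fun r => S (t - r) (q r)).
Proof.
move=> cq r; apply: (@continuous_comp R (R * R)%type V (fun r => (t, r))
    (fun p => S (p.1 - p.2) (q p.2))); last exact: convol_integrand_continuous2.
by apply: (@cvg_pair _ _ _ _ (nbhs t) (nbhs r)); [exact: cvg_cst|exact: cvg_id].
Qed.

Lemma orbit_continuous v : continuous (fun t => S t v).
Proof.
move=> t; apply: (@continuous_comp R (R * V)%type V (fun t => (t, v))
    (fun p => S p.1 p.2)); last exact: S_continuous.
by apply: (@cvg_pair _ _ _ _ (nbhs t) (nbhs v)); [exact: cvg_id|exact: cvg_cst].
Qed.

Lemma convol_continuous q s : continuous q -> continuous (convol q s).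
Proof.
move=> cq; apply: (@r_int_continuous2 _ _ (fun t r => S (t - r) (q r))).
exact: convol_integrand_continuous2.
Qed.

Lemma convolB q q' s t : continuous q -> continuous q' ->
  convol q s t - convol q' s t = r_int (fun r => S (t - r) (q r - q' r)) s t.
Proof.
move=> cq cq'; rewrite -r_intB; [|exact: convol_integrand_continuous..].
apply: eq_r_intT => r.
by rewrite linear_funB.
Qed.

Lemma convolB_le q q' s t C k : s <= t -> k != 0 -> continuous q -> continuous q' ->
  (forall r, s <= r <= t -> `|S (t - r) (q r - q' r)| <= C * expR (k * r)) ->
  `|convol q s t - convol q' s t| <= C / k * (expR (k * t) - expR (k * s)).
Proof.
move=> st k0 cq cq' H; rewrite convolB//; apply: norm_r_int_exp => //.
apply: (@convol_integrand_continuous (fun r => q r - q' r)).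
by move=> r; apply: cvgB; [exact: cq|exact: cq'].
Qed.

(** The order [s <= t <= u] keeps both times in the semigroup law nonnegative, which is where the
    extended fast semigroup satisfies it. *)
Lemma convol_cat q s t u : s <= t -> t <= u -> continuous q ->
  (forall a b v, 0 <= a -> 0 <= b -> S (a + b) v = S a (S b v)) ->
  convol q s u = S (u - t) (convol q s t) + convol q t u.
Proof.
move=> st tu cq SD; rewrite /convol -(r_int_cat s t u (convol_integrand_continuous (t := u) cq)).
have [M MP] := S_bounded (u - t).
rewrite -(r_int_linear _ _ (S_linear _) MP) ?convol_integrand_continuous//; last first.
  exact: convol_integrand_continuous.
congr (_ + _); apply: eq_r_int => // r /andP[_ rt] /=.
by rewrite -SD ?subr_ge0//; congr (S _ _); ring.
Qed.

Lemma convol_cat_group q s t u : continuous q ->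
  (forall a b v, S (a + b) v = S a (S b v)) ->
  convol q s u = S (u - t) (convol q s t) + convol q t u.
Proof.
move=> cq SD; rewrite /convol -(r_int_cat s t u (convol_integrand_continuous (t := u) cq)).
have [M MP] := S_bounded (u - t).
rewrite -(r_int_linear _ _ (S_linear _) MP); last exact: convol_integrand_continuous.
congr (_ + _); apply: eq_r_intT => r /=.
by rewrite -SD; congr (S _ _); ring.
Qed.

End convolutions.

(** * Slow-fast systems whose fast nonlinearity depends on time *)

Section slow_fast_theory.
Context {R : realType} {H1 H2 : completeNormedModType R}.
Variables (S1 : R -> H1 -> H1) (S2 : R -> H2 -> H2).
Variables (F : R -> H1 * H2 -> H1) (G : H1 * H2 -> H2) (a b k1 k2 : R).
Hypotheses (a0 : 0 < a) (b0 : 0 < b) (k10 : 0 < k1) (k20 : 0 < k2).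
Hypothesis S1_linear : forall t, linear (S1 t).
Hypothesis S1_continuous : continuous (fun p : R * H1 => S1 p.1 p.2).
Hypothesis S1_0 : forall x, S1 0 x = x.
Hypothesis S1D : forall s t x, 0 <= s -> 0 <= t -> S1 (s + t) x = S1 s (S1 t x).
Hypothesis S1_contraction : forall t x, `|S1 t x| <= `|x|.
Hypothesis S1_decay : forall t x, 0 <= t -> `|S1 t x| <= expR (- a * t) * `|x|.
Hypothesis S2_linear : forall t, linear (S2 t).
Hypothesis S2_continuous : continuous (fun p : R * H2 => S2 p.1 p.2).
Hypothesis S2_0 : forall y, S2 0 y = y.
Hypothesis S2D : forall s t y, S2 (s + t) y = S2 s (S2 t y).
Hypothesis S2_bounded : forall T, exists2 M, 0 < M &
  forall t y, - T <= t -> t <= T -> `|S2 t y| <= M * `|y|.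
Hypothesis S2_decay : forall t y, t <= 0 -> `|S2 t y| <= expR (- b * t) * `|y|.
Hypothesis F_continuous : continuous (fun p : R * (H1 * H2) => F p.1 p.2).
Hypothesis F_lip : forall t z z', `|F t z - F t z'| <= k1 * sum_norm (z - z').
Hypothesis G_continuous : continuous G.
Hypothesis G_lip : forall z z', `|G z - G z'| <= k2 * sum_norm (z - z').
Implicit Types z : R -> H1 * H2.

Let S1_bounded t : exists M, forall v, `|S1 t v| <= M * `|v|.
Proof. by exists 1 => v; rewrite mul1r. Qed.

Let S2_bounded_at t : exists M, forall v, `|S2 t v| <= M * `|v|.
Proof.
have [M _ MP] := S2_bounded `|t|; exists M => v; apply: MP; last exact: ler_norm.
by rewrite lerNl -normrN ler_norm.
Qed.

Definition mild (J : set R) z := forall s t, J s -> J t -> s <= t ->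
  (z t).1 = S1 (t - s) (z s).1 + convol S1 (fun r => F r (z r)) s t /\
  (z t).2 = S2 (t - s) (z s).2 + convol S2 (fun r => G (z r)) s t.

Let F_path z : continuous z -> continuous (fun r => F r (z r)).
Proof.
move=> cz t; apply: (@continuous_comp R (R * (H1 * H2))%type H1 (fun t => (t, z t))
    (fun p => F p.1 p.2)); last exact: F_continuous.
by apply: (@cvg_pair _ _ _ _ (nbhs t) (nbhs (z t))); [exact: cvg_id|exact: cz].
Qed.

Let G_path z : continuous z -> continuous (fun r => G (z r)).
Proof. by move=> cz t; apply: continuous_comp; [exact: cz|exact: G_continuous]. Qed.

Let C1cont := convol_integrand_continuous S1_continuous.
Let C2cont := convol_integrand_continuous S2_continuous.

Lemma mild_from_start z t0 : continuous z ->
  (forall t, t0 <= t ->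
    (z t).1 = S1 (t - t0) (z t0).1 + convol S1 (fun r => F r (z r)) t0 t /\
    (z t).2 = S2 (t - t0) (z t0).2 + convol S2 (fun r => G (z r)) t0 t) ->
  mild [set t | t0 <= t] z.
Proof.
move=> cz H s t /= s0 t0' st; have [-> ->] := H t t0'; have [-> ->] := H s s0.
have cF := F_path cz; have cG := G_path cz.
split.
  rewrite (convol_cat S1_linear S1_bounded S1_continuous s0 st cF S1D) addrA.
  rewrite linear_funD// -S1D ?subr_ge0//.
  by congr (S1 _ _ + _ + _); ring.
rewrite (convol_cat_group S2_linear S2_bounded_at S2_continuous t0 s t cG S2D) addrA.
rewrite linear_funD// -S2D.
by congr (S2 _ _ + _ + _); ring.
Qed.

Lemma max0_continuous : continuous (fun t : R => Num.max 0 t).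
Proof. by move=> t; apply: continuous_max; [exact: cvg_cst|exact: cvg_id]. Qed.

(** Picard iteration in the weight [expR (lam * t)], which makes the integral operator a contraction
    on any horizon, however long. *)
Lemma mild_forward_exists zeta : exists z,
  [/\ continuous z, mild [set t | 0 <= t] z & forall t, t <= 0 -> z t = zeta].
Proof.
(* An index is a time horizon together with a bound for the slow group on it. *)
pose I := {p : R * R | 0 < p.2 /\
  forall t y, - p.1 <= t -> t <= p.1 -> `|S2 t y| <= p.2 * `|y|}.
(* Integrating the weight gains a factor [1 / lam]; twice the total Lipschitz constant makes the
   rate [2^-1]. *)
pose lam (i : I) := 2 * (k1 + (sval i).2 * k2).
have iM (i : I) : 0 < (sval i).2 by case: i => p h; exact: h.1.
have iP (i : I) t y : - (sval i).1 <= t -> t <= (sval i).1 -> `|S2 t y| <= (sval i).2 * `|y|.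
  by case: i => p h; exact: h.2.
have lam0 i : 0 < lam i.
  by rewrite /lam mulr_gt0// addr_gt0// mulr_gt0.
pose J (i : I) := [set t : R | `|t| <= (sval i).1].
pose om (i : I) t := expR (lam i * Num.max 0 t).
(* [Num.max 0 t] freezes the image for negative times, so that the fixed point equals [zeta] there
   and is continuous on the line. *)
pose T z (t : R) := (S1 (Num.max 0 t) zeta.1 + convol S1 (fun r => F r (z r)) 0 (Num.max 0 t),
  S2 (Num.max 0 t) zeta.2 + convol S2 (fun r => G (z r)) 0 (Num.max 0 t)).
have T_cont z : continuous z -> continuous (T z).
  move=> cz; apply: continuous_pair.
    move=> t; apply: (@continuous_comp R R H1 (fun t => Num.max 0 t)
      (fun t => S1 t zeta.1 + convol S1 (fun r => F r (z r)) 0 t)).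
      exact: max0_continuous.
    apply: cvgD; first exact: orbit_continuous.
    by apply: convol_continuous => //; exact: F_path.
  move=> t; apply: (@continuous_comp R R H2 (fun t => Num.max 0 t)
    (fun t => S2 t zeta.2 + convol S2 (fun r => G (z r)) 0 t)).
    exact: max0_continuous.
  apply: cvgD; first exact: orbit_continuous.
  by apply: convol_continuous => //; exact: G_path.
have max_ge0 (t : R) : 0 <= Num.max 0 t by rewrite le_max lexx.
have T_contr z z' i D : continuous z -> continuous z' -> 0 <= D ->
    (forall t, J i t -> sum_norm (z t - z' t) <= D * om i t) ->
    forall t, J i t -> sum_norm (T z t - T z' t) <= 2^-1 * D * om i t.
  move=> cz cz' D0 zz' t.
  have M0 := iM i; have MP := iP i; have l0 := lam0 i.
  move: zz'; rewrite /J /om /=.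
  set l := lam i in l0 *; set L := (sval i).1 in MP *; set M := (sval i).2 in M0 MP *.
  move=> zz' tL; have lE : l = 2 * (k1 + M * k2) by [].
  pose u := Num.max 0 t; have u0 : 0 <= u by exact: max_ge0.
  have uL : u <= L.
    by rewrite ge_max (le_trans (normr_ge0 _) tL) (le_trans (ler_norm _) tL).
  have zz r : 0 <= r <= u -> sum_norm (z r - z' r) <= D * expR (l * r).
    move=> /andP[r0 ru]; have := zz' r; rewrite max_r//; apply.
    by rewrite ger0_norm// (le_trans ru).
  rewrite /sum_norm /= -/u.
  have -> : S1 u zeta.1 + convol S1 (fun r => F r (z r)) 0 u -
    (S1 u zeta.1 + convol S1 (fun r => F r (z' r)) 0 u) =
    convol S1 (fun r => F r (z r)) 0 u - convol S1 (fun r => F r (z' r)) 0 u by zmod.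
  have -> : S2 u zeta.2 + convol S2 (fun r => G (z r)) 0 u -
    (S2 u zeta.2 + convol S2 (fun r => G (z' r)) 0 u) =
    convol S2 (fun r => G (z r)) 0 u - convol S2 (fun r => G (z' r)) 0 u by zmod.
  have h1 : `|convol S1 (fun r => F r (z r)) 0 u - convol S1 (fun r => F r (z' r)) 0 u| <=
      k1 * D / l * (expR (l * u) - expR (l * 0)).
    apply: convolB_le => //; [by rewrite gt_eqF|exact: F_path|exact: F_path|].
    move=> r ru; apply: (le_trans (S1_contraction _ _)); apply: (le_trans (F_lip _ _ _)).
    by rewrite -mulrA ler_pM2l// zz.
  have h2 : `|convol S2 (fun r => G (z r)) 0 u - convol S2 (fun r => G (z' r)) 0 u| <=
      M * k2 * D / l * (expR (l * u) - expR (l * 0)).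
    apply: convolB_le => //; [by rewrite gt_eqF|exact: G_path|exact: G_path|].
    move=> r /andP[r0 ru].
    apply: (le_trans (MP _ _ _ _)); [lra|lra|].
    rewrite -(mulrA M) -(mulrA M) -(mulrA k2) ler_pM2l//.
    by apply: (le_trans (G_lip _ _)); apply: ler_wpM2l; [exact: ltW|apply: zz; rewrite r0].
  rewrite mulr0 expR0 in h1 h2.
  apply: (le_trans (lerD h1 h2)).
  have -> : k1 * D / l * (expR (l * u) - 1) + M * k2 * D / l * (expR (l * u) - 1) =
    2^-1 * D * (expR (l * u) - 1).
    by rewrite lE; field; rewrite gt_eqF// addr_gt0// mulr_gt0.
  by rewrite ler_wpM2l// ?mulr_ge0// lerBlDr lerDl.
have T_loc : forall L, exists i M, forall t, `|t| <= L -> J i t /\ om i t <= M.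
  move=> L; have [M M0 MP] := S2_bounded L.
  pose i : I := exist _ (L, M) (conj M0 MP).
  exists i, (expR (lam i * `|L|)) => t tL; split=> //.
  rewrite ler_expR ler_pM2l// ge_max normr_ge0 /=.
  by rewrite (le_trans (ler_norm t))// (le_trans tL) ?ler_norm.
have czeta : continuous (fun _ : R => zeta) by move=> t; exact: cvg_cst.
have h0 : 0 <= 2^-1 :> R by [].
have h1 : 2^-1 < 1 :> R by rewrite invf_lt1 ?ltr1n.
have [|||z [[cz _] Tz]] :=
    @contraction_fixed_point _ _ _ I J om 2^-1 T (fun=> zeta) h0 h1 T_loc czeta.
- by move=> z [cz _]; exact: T_cont.
- by move=> z z' i D [cz _] [cz' _]; exact: T_contr.
- move=> i.
  have cs : continuous (fun t => sum_norm (T (fun=> zeta) t - zeta) : R^o).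
    apply: sum_norm_continuous => t; apply: cvgB; last exact: cvg_cst.
    exact: T_cont.
  have [M M0 MP] := bounded_itv (- (sval i).1) (sval i).1 cs.
  exists M; split; first exact: ltW.
  move=> t; rewrite /J /= ler_norml => /MP; rewrite ger0_norm ?sum_norm_ge0// => h.
  rewrite (le_trans h)// ler_peMr ?(ltW M0)// -expR0 ler_expR mulr_ge0// ?ltW//.
exists z; split=> //.
  have z00 : z 0 = zeta.
    rewrite -Tz /T maxxx S1_0 S2_0 /convol !r_intxx !addr0.
    by rewrite -surjective_pairing.
  apply: mild_from_start => // t t0; rewrite subr0 z00 -{1 2}Tz /T /=.
  by rewrite !max_r.
move=> t t0; rewrite -Tz /T max_l// S1_0 S2_0 /convol !r_intxx !addr0.
by rewrite -surjective_pairing.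
Qed.

(* [M] has to be uniform in [F'], which carries the noise. *)
Lemma mild_perturbation (T : R) : exists2 M, 0 < M &
  forall (F' : R -> H1 * H2 -> H1) z w (d : R -> H1) (delta : R),
  continuous (fun p : R * (H1 * H2) => F' p.1 p.2) ->
  (forall t v v', `|F' t v - F' t v'| <= k1 * sum_norm (v - v')) ->
  continuous z -> continuous w -> 0 <= delta -> (forall t, 0 <= t <= T -> `|d t| <= delta) ->
  (forall t, 0 <= t <= T ->
    (z t).1 = S1 t (z 0).1 + convol S1 (fun r => F' r (z r)) 0 t /\
    (z t).2 = S2 t (z 0).2 + convol S2 (fun r => G (z r)) 0 t) ->
  (forall t, 0 <= t <= T ->
    (w t).1 = S1 t (z 0).1 + convol S1 (fun r => F' r (w r)) 0 t + d t /\
    (w t).2 = S2 t (z 0).2 + convol S2 (fun r => G (w r)) 0 t) ->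
  forall t, 0 <= t <= T -> sum_norm (w t - z t) <= M * delta.
Proof.
have [M M0 MP] := S2_bounded T.
pose l := 2 * (k1 + M * k2).
have l0 : 0 < l by rewrite mulr_gt0// addr_gt0// mulr_gt0.
(* [2] is [1 / (1 - 2^-1)], from the self-improving bound with rate [2^-1]; [expR (l * T)] removes
   the weight. *)
exists (2 * expR (l * T)); first by rewrite mulr_gt0// expR_gt0.
move=> F' z w d delta cF' F'_lip cz cw delta0 dP zP wP t /andP[t0 tT].
have F'_path z' : continuous z' -> continuous (fun r => F' r (z' r)).
  move=> cz' r; apply: (@continuous_comp R (R * (H1 * H2))%type H1 (fun t => (t, z' t))
      (fun p => F' p.1 p.2)); last exact: cF'.
  by apply: (@cvg_pair _ _ _ _ (nbhs r) (nbhs (z' r))); [exact: cvg_id|exact: cz'].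
have cwz : continuous (fun t => sum_norm (w t - z t) : R^o).
  by apply: sum_norm_continuous => s; apply: cvgB; [exact: cw|exact: cz].
have [B B0 BP] := bounded_itv 0 T cwz.
have := @self_improving_bound R R [set t | 0 <= t <= T]
  (fun t => expR (- l * t) * sum_norm (w t - z t)) 2^-1 delta B.
have -> : delta / (1 - 2^-1) = 2 * delta by field.
move=> /(_ _ _ _ _ t) H.
have {}H : expR (- l * t) * sum_norm (w t - z t) <= 2 * delta.
  apply: H => //; last 1 first.
  - by rewrite /= t0.
  - by rewrite invf_lt1 ?ltr1n.
  - move=> s /= sT; have := BP s sT; rewrite ger0_norm ?sum_norm_ge0//; apply: le_trans.
    rewrite ler_piMl ?sum_norm_ge0// -expR0 ler_expR mulNr oppr_le0 mulr_ge0 ?(ltW l0)//.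
    by case/andP: sT.
  move=> N NP s /= /andP[s0 sT]; have sI : 0 <= s <= T by rewrite s0.
  have {}NP r : 0 <= r <= s -> sum_norm (w r - z r) <= N * expR (l * r).
    move=> /andP[r0 rs]; have := NP r; rewrite /= r0 (le_trans rs)// => /(_ isT).
    by rewrite mulNr expRN mulrC ler_pdivrMr ?expR_gt0.
  have [z1 z2] := zP s sI; have [w1 w2] := wP s sI.
  have h1 : `|convol S1 (fun r => F' r (w r)) 0 s - convol S1 (fun r => F' r (z r)) 0 s| <=
      k1 * N / l * (expR (l * s) - expR (l * 0)).
    apply: convolB_le => //; [by rewrite gt_eqF|exact: F'_path|exact: F'_path|].
    move=> r rs; apply: (le_trans (S1_contraction _ _)); apply: (le_trans (F'_lip _ _ _)).
    by rewrite -mulrA ler_pM2l// NP.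
  have h2 : `|convol S2 (fun r => G (w r)) 0 s - convol S2 (fun r => G (z r)) 0 s| <=
      M * k2 * N / l * (expR (l * s) - expR (l * 0)).
    apply: convolB_le => //; [by rewrite gt_eqF|exact: G_path|exact: G_path|].
    move=> r /andP[r0 rs].
    apply: (le_trans (MP _ _ _ _)); [lra|lra|].
    rewrite -(mulrA M) -(mulrA M) -(mulrA k2) ler_pM2l//.
    by apply: (le_trans (G_lip _ _)); apply: ler_wpM2l; [exact: ltW|apply: NP; rewrite r0].
  rewrite mulr0 expR0 in h1 h2.
  have N0 : 0 <= N.
    by have := NP 0; rewrite lexx s0 mulr0 expR0 mulr1 => /(_ isT); apply: le_trans; exact: sum_norm_ge0.
  have h : sum_norm (w s - z s) <= 2^-1 * N * (expR (l * s) - 1) + delta.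
    rewrite /sum_norm /= w1 w2 z1 z2.
    set A := convol S1 _ 0 s in h1 *; set A' := convol S1 _ 0 s in h1 *.
    set A2 := convol S2 _ 0 s in h2 *; set A2' := convol S2 _ 0 s in h2 *.
    have -> : S1 s (z 0).1 + A + d s - (S1 s (z 0).1 + A') = (A - A') + d s by zmod.
    have -> : S2 s (z 0).2 + A2 - (S2 s (z 0).2 + A2') = A2 - A2' by zmod.
    have -> : 2^-1 * N * (expR (l * s) - 1) + delta =
        (k1 * N / l * (expR (l * s) - 1) + delta) + M * k2 * N / l * (expR (l * s) - 1).
      by rewrite /l; field; rewrite gt_eqF// addr_gt0// mulr_gt0.
    by rewrite lerD// (le_trans (ler_normD _ _))// lerD// dP.
  rewrite mulNr expRN mulrC ler_pdivrMr ?expR_gt0// (le_trans h)//.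
  have E1 : 1 <= expR (l * s) by rewrite -expR0 ler_expR mulr_ge0// ltW.
  rewrite mulrDl lerD//; first by rewrite ler_wpM2l ?mulr_ge0// lerBlDr lerDl.
  by rewrite ler_peMr.
rewrite mulNr expRN mulrC ler_pdivrMr ?expR_gt0// in H.
apply: (le_trans H); rewrite mulrAC ler_wpM2r// ler_pM2l// ler_expR ler_pM2l//.
Qed.

Variable eta : R.
Hypotheses (b_eta : b < eta) (eta_a : eta < a).
(** Lipschitz constants times the integrals over [[0, +oo[] of [expR (- (a - eta) * r)] and
    [expR (- (eta - b) * r)], the kernels of the fast and the slow convolution after weighting. *)
Let q := k1 / (a - eta) + k2 / (eta - b).
Hypothesis q_lt1 : q < 1.

Let ae0 : 0 < a - eta. Proof. by rewrite subr_gt0. Qed.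
Let eb0 : 0 < eta - b. Proof. by rewrite subr_gt0. Qed.
Let eta0 : 0 < eta. Proof. exact: lt_trans b_eta. Qed.
Let q_ge0 : 0 <= q.
Proof. by rewrite addr_ge0// divr_ge0// ltW. Qed.

Let S1F_lip_le t r N v v' : r <= t -> sum_norm (v - v') <= N * expR (- eta * r) ->
  `|S1 (t - r) (F r v - F r v')| <= k1 * N * expR (- a * t) * expR ((a - eta) * r).
Proof.
move=> rt H; have tr : 0 <= t - r by rewrite subr_ge0.
apply: (le_trans (S1_decay _ tr)).
have -> : k1 * N * expR (- a * t) * expR ((a - eta) * r) =
    expR (- a * (t - r)) * (k1 * (N * expR (- eta * r))).
  rewrite (_ : (a - eta) * r = a * r + - eta * r); last by ring.
  rewrite (_ : - a * (t - r) = - a * t + a * r); last by ring.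
  by rewrite !expRD; ring.
rewrite ler_wpM2l ?expR_ge0// (le_trans (F_lip _ _ _))//.
by rewrite ler_pM2l.
Qed.

Let S2G_lip_le t r N v v' : t <= r -> sum_norm (v - v') <= N * expR (- eta * r) ->
  `|S2 (t - r) (G v - G v')| <= k2 * N * expR (- b * t) * expR (- (eta - b) * r).
Proof.
move=> rt H; have tr : t - r <= 0 by rewrite subr_le0.
apply: (le_trans (S2_decay _ tr)).
have -> : k2 * N * expR (- b * t) * expR (- (eta - b) * r) =
    expR (- b * (t - r)) * (k2 * (N * expR (- eta * r))).
  rewrite (_ : - (eta - b) * r = b * r + - eta * r); last by ring.
  rewrite (_ : - b * (t - r) = - b * t + b * r); last by ring.
  by rewrite !expRD; ring.
rewrite ler_wpM2l ?expR_ge0// (le_trans (G_lip _ _))//.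
by rewrite ler_pM2l.
Qed.

(** Only the slow component can be run backwards, because [S2] is a group. *)
Lemma mild_reverse (J : set R) z s t : continuous z -> mild J z -> J t -> J s -> t <= s ->
  (z t).2 = S2 (t - s) (z s).2 + convol S2 (fun r => G (z r)) s t.
Proof.
move=> cz mz Jt Js ts; have [_ ->] := mz t s Jt Js ts.
rewrite (linear_funD _ _ (S2_linear _)) -S2D.
rewrite (_ : t - s + (s - t) = 0) ?S2_0; last by ring.
have := convol_cat_group S2_linear S2_bounded_at S2_continuous t s t (G_path cz) S2D.
by rewrite {1}/convol r_intxx -addrA => <-; rewrite addr0.
Qed.

(** The fast difference is an integral from -oo, and the slow one an integral from 0, where it
    vanishes by hypothesis. So a weighted bound [N] improves to [q * N], and the difference is 0.
    This makes the slow manifold a graph over the slow space. *)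
Lemma mild_backward_unique z z' D : continuous z -> continuous z' ->
  mild [set t | t <= 0] z -> mild [set t | t <= 0] z' ->
  (forall t, t <= 0 -> sum_norm (z t - z' t) <= D * expR (- eta * t)) ->
  (z 0).2 = (z' 0).2 -> z 0 = z' 0.
Proof.
move=> cz cz' mz mz' zD zz'0.
have cF := F_path cz; have cF' := F_path cz'; have cG := G_path cz; have cG' := G_path cz'.
have : forall t, t <= 0 -> expR (eta * t) * sum_norm (z t - z' t) <= 0 / (1 - q).
  apply: (@self_improving_bound _ _ [set t | t <= 0] _ q 0 D) => // [t t0|N NP t t0].
    have := zD t t0; rewrite mulNr expRN mulrC => /le_trans H.
    by rewrite -ler_pdivlMl ?expR_gt0// mulrC; apply: H; rewrite mulrC.
  have {}NP r : r <= 0 -> sum_norm (z r - z' r) <= N * expR (- eta * r).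
    move=> /NP; rewrite mulNr expRN -ler_pdivlMl ?expR_gt0// mulrC; apply.
  have N0 : 0 <= N.
    have := le_trans (sum_norm_ge0 _) (NP 0 (lexx _)).
    by rewrite mulr0 expR0 mulr1.
  rewrite addr0 -ler_pdivlMl ?expR_gt0// -expRN -mulNr mulrC.
  have X : `|(z t).1 - (z' t).1| <= k1 * N / (a - eta) * expR (- eta * t).
    apply/ler_addgt0Pl => e e0.
    (* Far enough in the past the initial term [S1 (t - s)] of the difference is below [e], because
       [eta < a]. *)
    have [t1 t1P] := expR_small_pinfty (mulr_ge0 N0 (expR_ge0 (- a * t))) ae0 e0.
    pose s := Num.min t (- t1).
    have st : s <= t by rewrite ge_min lexx.
    have s0 : s <= 0 by exact: le_trans t0.
    have [-> _] := mz s t s0 t0 st; have [-> _] := mz' s t s0 t0 st.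
    have -> : S1 (t - s) (z s).1 + convol S1 (fun r => F r (z r)) s t -
      (S1 (t - s) (z' s).1 + convol S1 (fun r => F r (z' r)) s t) =
      S1 (t - s) ((z s).1 - (z' s).1) +
      (convol S1 (fun r => F r (z r)) s t - convol S1 (fun r => F r (z' r)) s t).
      by rewrite (linear_funB _ _ (S1_linear _)); zmod.
    rewrite (le_trans (ler_normD _ _))// lerD//.
      have ts0 : 0 <= t - s by rewrite subr_ge0.
      apply: (le_trans (S1_decay _ ts0)).
      apply: (@le_trans _ _ (expR (- a * (t - s)) * (N * expR (- eta * s)))).
        rewrite ler_wpM2l ?expR_ge0// (le_trans _ (NP s s0))// lerDl//.
      have := t1P (- s); rewrite lerNr ge_min lexx orbT => /(_ isT); apply: le_trans.
      rewrite le_eqVlt; apply/orP; left; apply/eqP.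
      rewrite (_ : - (a - eta) * - s = a * s + - eta * s); last by ring.
      rewrite (_ : - a * (t - s) = - a * t + a * s); last by ring.
      by rewrite !expRD; ring.
    have h := @convolB_le _ _ S1 S1_linear S1_continuous _ _ s t
      (k1 * N * expR (- a * t)) (a - eta) st (lt0r_neq0 ae0) cF cF'.
    apply: (le_trans (h _)).
      by move=> r /andP[_ rt]; apply: S1F_lip_le => //; apply: NP; exact: le_trans t0.
    apply: (@le_trans _ _ (k1 * N * expR (- a * t) / (a - eta) * expR ((a - eta) * t))).
      rewrite ler_wpM2l ?lerBlDr ?lerDl ?expR_ge0// divr_ge0 ?(ltW ae0)//.
      by rewrite !mulr_ge0// ?expR_ge0// ltW.
    rewrite le_eqVlt; apply/orP; left; apply/eqP.
    rewrite (_ : - eta * t = - a * t + (a - eta) * t); last by ring.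
    by rewrite expRD; ring.
  have Y : `|(z t).2 - (z' t).2| <= k2 * N / (eta - b) * expR (- eta * t).
    have h1 := mild_reverse cz mz t0 (lexx 0) t0.
    have h2 := mild_reverse cz' mz' t0 (lexx 0) t0.
    rewrite h1 h2 zz'0 (_ : forall u v w : H2, u + v - (u + w) = v - w); last by move=> *; zmod.
    rewrite (convolB S2_linear S2_continuous _ _ cG cG') r_intN normrN.
    have cGG : continuous (fun r => S2 (t - r) (G (z r) - G (z' r))).
      apply: (@convol_integrand_continuous _ _ S2 S2_continuous (fun r => G (z r) - G (z' r))).
      by move=> r; apply: cvgB; [exact: cG|exact: cG'].
    have k0 : - (eta - b) != 0 by rewrite oppr_eq0 gt_eqF.
    apply: (le_trans (norm_r_int_exp (C := k2 * N * expR (- b * t)) k0 t0 cGG _)).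
      by move=> r /andP[tr r0]; apply: S2G_lip_le => //; exact: NP.
    rewrite mulr0 expR0 invrN mulrN mulNr -mulrN opprB.
    apply: (@le_trans _ _ (k2 * N * expR (- b * t) / (eta - b) * expR (- (eta - b) * t))).
      by rewrite ler_wpM2l ?lerBlDr ?lerDl// divr_ge0 ?(ltW eb0)// !mulr_ge0// ?expR_ge0// ltW.
    rewrite le_eqVlt; apply/orP; left; apply/eqP.
    rewrite (_ : - eta * t = - b * t + - (eta - b) * t); last by ring.
    by rewrite expRD; ring.
  rewrite /sum_norm /=; apply: (le_trans (lerD X Y)).
  by rewrite /q; lra.
move=> /(_ 0 (lexx _)); rewrite mulr0 expR0 mul1r mul0r => /sum_norm_le0 /eqP.
by rewrite subr_eq0 => /eqP.
Qed.

(** * The Lyapunov-Perron operator attached to a forward orbit *)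

Section tracking.
Variables (zb : R -> H1 * H2) (CF : R).
Hypotheses (zb_continuous : continuous zb) (zb_mild : mild [set t | 0 <= t] zb).
Hypothesis zb_neg : forall t, t <= 0 -> zb t = zb 0.
Hypothesis F_growth : forall r, r <= 0 -> `|F r 0| <= CF * expR (- eta * r).

Let in_class z := continuous z /\
  exists D, 0 <= D /\ forall t, sum_norm (z t - zb t) <= D * expR (- eta * t).

Let yb t := S2 t (zb 0).2 + convol S2 (fun r => G (zb r)) 0 t.

(** The nonlinearity along an orbit need not decay; only this difference can be integrated against
    the backward group up to +oo. *)
Let dG z r := G (z r) - G (zb r).

(* The fixed points of [lp] are the solutions that are bounded in the weighted
   norm at [-oo] and approach [zb] at rate [eta] at [+oo]. *)
Let lp z t := (int_from_ninfty (fun r => S1 (t - r) (F r (z r))) t,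
  yb t - int_to_pinfty (fun r => S2 (t - r) (dG z r)) t).

Let dG_path z : continuous z -> continuous (dG z).
Proof. by move=> cz r; apply: cvgB; apply: G_path. Qed.

Let ytail_bound z t : in_class z -> exists C, forall r, t <= r ->
  `|S2 (t - r) (dG z r)| <= C * expR (- (eta - b) * r).
Proof.
move=> [cz [D [D0 DP]]]; exists (k2 * D * expR (- b * t)) => r tr.
by apply: S2G_lip_le => //; exact: DP.
Qed.

Let xhead_bound z t : in_class z -> exists C t0, forall r, r <= t0 ->
  `|S1 (t - r) (F r (z r))| <= C * expR ((a - eta) * r).
Proof.
move=> [cz [D [D0 DP]]].
exists ((CF + k1 * (D + sum_norm (zb 0))) * expR (- a * t)), (Num.min 0 t) => r.
rewrite le_min => /andP[r0 rt].
have er : 1 <= expR (- eta * r) by rewrite -expR0 ler_expR mulNr oppr_ge0 pmulr_rle0.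
have Fr : `|F r (z r)| <= (CF + k1 * (D + sum_norm (zb 0))) * expR (- eta * r).
  rewrite -[F r (z r)](subrK (F r 0)) addrC (le_trans (ler_normD _ _))// mulrDl lerD ?F_growth//.
  rewrite (le_trans (F_lip _ _ _))// -mulrA ler_pM2l// subr0.
  rewrite -[z r](subrK (zb r)) (le_trans (sum_normD _ _))// mulrDl lerD//.
  by rewrite zb_neg// ler_peMr// sum_norm_ge0.
have tr : 0 <= t - r by rewrite subr_ge0.
apply: (le_trans (S1_decay _ tr)).
set C := CF + _ in Fr *.
have -> : C * expR (- a * t) * expR ((a - eta) * r) =
    expR (- a * (t - r)) * (C * expR (- eta * r)).
  rewrite (_ : (a - eta) * r = a * r + - eta * r); last by ring.
  rewrite (_ : - a * (t - r) = - a * t + a * r); last by ring.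
  by rewrite !expRD; ring.
by rewrite ler_wpM2l ?expR_ge0.
Qed.

Let xhead_cvg z t s : in_class z ->
  cvg (r_int (fun r => S1 (t - r) (F r (z r))) u s @[u --> -oo]).
Proof.
move=> Xz; have [C [t0 CP]] := xhead_bound t Xz.
apply: (cvg_int_from_ninfty _ ae0 CP).
by apply: convol_integrand_continuous => //; apply: F_path; exact: Xz.1.
Qed.

Let ytail_cvg z t s : in_class z ->
  cvg (r_int (fun r => S2 (t - r) (dG z r)) s u @[u --> +oo]).
Proof.
move=> Xz; have [C CP] := ytail_bound t Xz.
apply: (cvg_int_to_pinfty _ eb0 CP).
by apply: convol_integrand_continuous => //; apply: dG_path; exact: Xz.1.
Qed.

Let lp1_mild z s t : in_class z -> s <= t ->
  (lp z t).1 = S1 (t - s) (lp z s).1 + convol S1 (fun r => F r (z r)) s t.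
Proof.
move=> Xz st; have cF := F_path Xz.1; rewrite /lp /=.
have ci u := C1cont (t := u) cF.
rewrite (int_from_ninfty_cat (s := s) t (ci t) (@xhead_cvg z t s Xz)); congr (_ + _).
rewrite -(int_from_ninfty_linear (S1_linear _) (M := 1) _ (ci s) (@xhead_cvg z s s Xz)); last first.
  by move=> v; rewrite mul1r.
(* The integrands agree on [[u, s]] once [u <= s], where [s - r] is nonnegative and the semigroup
   law applies; hence equality near -oo only. *)
rewrite /int_from_ninfty; apply: congr_lim_near.
near=> u; have us : u <= s by near: u; apply: nbhs_ninfty_le; exact: num_real.
apply: eq_r_int => // r /andP[_ rs] /=.
by rewrite -S1D ?subr_ge0//; congr (S1 _ _); ring.
Unshelve. all: by end_near. Qed.

Let ytail_group z s t : in_class z ->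
  int_to_pinfty (fun r => S2 (t - r) (dG z r)) t =
  S2 (t - s) (int_to_pinfty (fun r => S2 (s - r) (dG z r)) s) - convol S2 (dG z) s t.
Proof.
move=> Xz; have cG := dG_path Xz.1.
have ci u := C2cont (t := u) cG.
have [M MP] := S2_bounded_at (t - s).
rewrite -(int_to_pinfty_linear (S2_linear _) MP (ci s) (@ytail_cvg z s s Xz)).
have -> : S2 (t - s) \o (fun r => S2 (s - r) (dG z r)) = (fun r => S2 (t - r) (dG z r)).
  by apply/funext => r /=; rewrite -S2D; congr (S2 _ _); ring.
rewrite -/(int_to_pinfty _ s) (int_to_pinfty_cat s (ci t) (@ytail_cvg z t t Xz)) /convol.
by rewrite addrAC subrr add0r.
Qed.

Let yb_mild s t : yb t = S2 (t - s) (yb s) + convol S2 (fun r => G (zb r)) s t.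
Proof.
rewrite /yb (convol_cat_group S2_linear S2_bounded_at S2_continuous 0 s t (G_path zb_continuous) S2D).
rewrite (linear_funD _ _ (S2_linear _)) -S2D addrA; congr (S2 _ _ + _ + _).
by ring.
Qed.

Let lp2_mild z s t : in_class z ->
  (lp z t).2 = S2 (t - s) (lp z s).2 + convol S2 (fun r => G (z r)) s t.
Proof.
move=> Xz; rewrite /lp /= (ytail_group s t Xz) (yb_mild s t).
have -> : convol S2 (dG z) s t =
    convol S2 (fun r => G (z r)) s t - convol S2 (fun r => G (zb r)) s t.
  by rewrite (convolB S2_linear S2_continuous)//; apply: G_path => //; exact: Xz.1.
by rewrite (linear_funB _ _ (S2_linear _)); zmod.
Qed.

(** Continuity is read off the mild formula, started at [t - 1] for the fast part, which only moves
    forward, and at 0 for the slow part. *)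
Let lp_continuous z : in_class z -> continuous (lp z).
Proof.
move=> Xz; apply: continuous_pair => t.
  pose s := t - 1.
  have cg : continuous (fun t => S1 (t - s) (lp z s).1 + convol S1 (fun r => F r (z r)) s t).
    move=> u; apply: cvgD.
      apply: (@continuous_comp R R H1 (fun t => t - s) (fun t => S1 t (lp z s).1)).
        by apply: cvgB; [exact: cvg_id|exact: cvg_cst].
      exact: orbit_continuous.
    by apply: convol_continuous => //; apply: F_path; exact: Xz.1.
  have E : {near t, (fun t => S1 (t - s) (lp z s).1 + convol S1 (fun r => F r (z r)) s t) =1
      (fun t => (lp z t).1)}.
    near=> u; rewrite -lp1_mild//.
    by near: u; apply: lt_le_nbhsr; rewrite /s ltrBlDr ltrDl.
  have := cg t; rewrite /continuous_at /= -(lp1_mild Xz (_ : s <= t)); last by rewrite gerBl.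
  exact: (cvg_trans (near_eq_cvg E)).
have -> : (fun t => yb t - int_to_pinfty (fun r => S2 (t - r) (dG z r)) t) =
    (fun t => S2 t (lp z 0).2 + convol S2 (fun r => G (z r)) 0 t).
  by apply/funext => u; have := lp2_mild 0 u Xz; rewrite subr0.
apply: cvgD; first exact: orbit_continuous.
by apply: convol_continuous => //; apply: G_path; exact: Xz.1.
Unshelve. all: by end_near. Qed.

Let lp1_le z z' N t : in_class z -> in_class z' ->
  (forall r, r <= t -> sum_norm (z r - z' r) <= N * expR (- eta * r)) ->
  `|(lp z t).1 - (lp z' t).1| <= k1 / (a - eta) * N * expR (- eta * t).
Proof.
move=> Xz Xz' H; have cF := F_path Xz.1; have cF' := F_path Xz'.1.
have ci := C1cont (t := t) cF; have ci' := C1cont (t := t) cF'.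
pose phi r := S1 (t - r) (F r (z r)) - S1 (t - r) (F r (z' r)).
have cphi : continuous phi by move=> r; apply: cvgB; [exact: ci|exact: ci'].
have -> : (lp z t).1 - (lp z' t).1 = int_from_ninfty phi t.
  rewrite /lp /int_from_ninfty /=; apply/esym/cvg_lim => //.
  rewrite (_ : (fun u => r_int phi u t) = (fun u => r_int (fun r => S1 (t - r) (F r (z r))) u t -
      r_int (fun r => S1 (t - r) (F r (z' r))) u t)).
    by apply: cvgB; [exact: (@xhead_cvg z t t Xz)|exact: (@xhead_cvg z' t t Xz')].
  by apply/funext => u; rewrite r_intB.
have phi_le r : r <= t -> `|phi r| <= k1 * N * expR (- a * t) * expR ((a - eta) * r).
  move=> rt; rewrite /phi -(linear_funB _ _ (S1_linear _)).
  by apply: S1F_lip_le => //; exact: H.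
apply: (le_trans (norm_int_from_ninfty cphi ae0 phi_le)).
rewrite le_eqVlt; apply/orP; left; apply/eqP.
rewrite (_ : - eta * t = - a * t + (a - eta) * t); last by ring.
by rewrite expRD; ring.
Qed.

(** Only the future of [t] enters, so the bound can be used with information on [[0, +oo[] alone. *)
Let lp2_le z z' N t : in_class z -> in_class z' ->
  (forall r, t <= r -> sum_norm (z r - z' r) <= N * expR (- eta * r)) ->
  `|(lp z t).2 - (lp z' t).2| <= k2 / (eta - b) * N * expR (- eta * t).
Proof.
move=> Xz Xz' H; have cG := dG_path Xz.1; have cG' := dG_path Xz'.1.
have ci := C2cont (t := t) cG; have ci' := C2cont (t := t) cG'.
pose phi r := S2 (t - r) (dG z' r) - S2 (t - r) (dG z r).
have cphi : continuous phi by move=> r; apply: cvgB; [exact: ci'|exact: ci].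
have -> : (lp z t).2 - (lp z' t).2 = int_to_pinfty phi t.
  transitivity (int_to_pinfty (fun r => S2 (t - r) (dG z' r)) t -
      int_to_pinfty (fun r => S2 (t - r) (dG z r)) t); first by rewrite /lp /=; zmod.
  rewrite /int_to_pinfty /=; apply/esym/cvg_lim => //.
  rewrite (_ : (fun u => r_int phi t u) = (fun u => r_int (fun r => S2 (t - r) (dG z' r)) t u -
      r_int (fun r => S2 (t - r) (dG z r)) t u)).
    by apply: cvgB; [exact: (@ytail_cvg z' t t Xz')|exact: (@ytail_cvg z t t Xz)].
  by apply/funext => u; rewrite r_intB.
have phi_le r : t <= r -> `|phi r| <= k2 * N * expR (- b * t) * expR (- (eta - b) * r).
  move=> tr; rewrite /phi -(linear_funB _ _ (S2_linear _)) /dG.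
  rewrite (_ : forall u v w : H2, u - v - (w - v) = u - w); last by move=> *; zmod.
  apply: S2G_lip_le => //; rewrite sum_normC; exact: H.
apply: (le_trans (norm_int_to_pinfty cphi eb0 phi_le)).
rewrite le_eqVlt; apply/orP; left; apply/eqP.
rewrite (_ : - eta * t = - b * t + - (eta - b) * t); last by ring.
by rewrite expRD; ring.
Qed.

Let yb_pos t : 0 <= t -> yb t = (zb t).2.
Proof.
by move=> t0; have [_ ->] := zb_mild (lexx 0) t0 t0; rewrite /yb subr0.
Qed.

Let class_zb : in_class zb.
Proof.
split=> //; exists 0; split=> // t.
by rewrite subrr mul0r /sum_norm /= !normr0 addr0.
Qed.

(** For [t >= 0] the slow parts agree and the fast ones differ by [S1 t] of a fixed vector, which
    decays faster than the weight. For [t <= 0] the growth of the forcing and of the backward group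
    stays within the weight, and [zb] is constant. *)
Let lp_start : exists D, 0 <= D /\ forall t, sum_norm (lp zb t - zb t) <= D * expR (- eta * t).
Proof.
have lp2E t : (lp zb t).2 = yb t.
  rewrite /lp /= (_ : int_to_pinfty _ _ = 0) ?subr0//; apply/eqP; rewrite -normr_le0.
  have ci := C2cont (t := t) (dG_path zb_continuous).
  rewrite -[leRHS](mul0r (expR (- (eta - b) * t))) -[X in X * expR _](mul0r (eta - b)^-1).
  apply: (norm_int_to_pinfty ci eb0) => r _; rewrite mul0r /dG subrr.
  by rewrite -[X in S2 _ X](subrr (0 : H2)) linear_funB// subrr normr0.
have CF0 : 0 <= CF.
  have := le_trans (normr_ge0 _) (F_growth (lexx 0)).
  by rewrite mulr0 expR0 mulr1.
set x0 := (zb 0).1; set y0 := (zb 0).2; set g0 := G (zb 0).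
set CX := (CF + k1 * sum_norm (zb 0)) / (a - eta).
have CX0 : 0 <= CX.
  by rewrite divr_ge0 ?(ltW ae0)// addr_ge0// mulr_ge0 ?(ltW k10)// sum_norm_ge0.
have x_neg t : t <= 0 -> `|(lp zb t).1| <= CX * expR (- eta * t).
  move=> t0; have ci := C1cont (t := t) (F_path zb_continuous).
  have hb r : r <= t -> `|S1 (t - r) (F r (zb r))| <=
      (CF + k1 * sum_norm (zb 0)) * expR (- a * t) * expR ((a - eta) * r).
    move=> rt; have r0 := le_trans rt t0.
    have er : 1 <= expR (- eta * r) by rewrite -expR0 ler_expR mulNr oppr_ge0 pmulr_rle0.
    have Fr : `|F r (zb r)| <= (CF + k1 * sum_norm (zb 0)) * expR (- eta * r).
      rewrite -[F r (zb r)](subrK (F r 0)) addrC (le_trans (ler_normD _ _))//.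
      rewrite mulrDl lerD ?F_growth// (le_trans (F_lip _ _ _))// subr0 zb_neg//.
      by rewrite ler_peMr// mulr_ge0 ?(ltW k10)// sum_norm_ge0.
    have tr : 0 <= t - r by rewrite subr_ge0.
    apply: (le_trans (S1_decay _ tr)).
    set C := CF + _ in Fr *.
    have -> : C * expR (- a * t) * expR ((a - eta) * r) =
        expR (- a * (t - r)) * (C * expR (- eta * r)).
      rewrite (_ : (a - eta) * r = a * r + - eta * r); last by ring.
      rewrite (_ : - a * (t - r) = - a * t + a * r); last by ring.
      by rewrite !expRD; ring.
    by rewrite ler_wpM2l ?expR_ge0.
  apply: (le_trans (norm_int_from_ninfty ci ae0 hb)).
  rewrite le_eqVlt; apply/orP; left; apply/eqP.
  rewrite /CX (_ : - eta * t = - a * t + (a - eta) * t); last by ring.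
  by rewrite expRD; ring.
have x_pos t : 0 <= t -> `|(lp zb t).1 - (zb t).1| <= (CX + `|x0|) * expR (- eta * t).
  move=> t0; have [-> _] := zb_mild (lexx 0) t0 t0; rewrite (lp1_mild class_zb t0) subr0.
  rewrite (_ : forall u v w : H1, u + v - (w + v) = u - w); last by move=> *; zmod.
  rewrite -(linear_funB _ _ (S1_linear _)) (le_trans (S1_decay _ t0))// mulrC.
  rewrite ler_pM ?expR_ge0//.
    rewrite (le_trans (ler_normB _ _))// lerD//.
    by have := x_neg 0 (lexx 0); rewrite mulr0 expR0 mulr1.
  by rewrite ler_expR !mulNr lerN2 ler_wpM2r// ltW.
have y_neg t : t <= 0 -> `|yb t| <= (`|y0| + `|g0| / b) * expR (- eta * t).
  move=> t0; rewrite /yb.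
  have e_le : expR (- b * t) <= expR (- eta * t).
    by rewrite ler_expR !mulNr lerN2 ler_wnM2r// ltW.
  apply: (le_trans (ler_normD _ _)); rewrite mulrDl lerD//.
    by rewrite (le_trans (S2_decay _ t0))// mulrC ler_wpM2l.
  rewrite /convol r_intN normrN.
  have ci := C2cont (t := t) (G_path zb_continuous).
  have hb r : t <= r <= 0 -> `|S2 (t - r) (G (zb r))| <= `|g0| * expR (- b * t) * expR (b * r).
    move=> /andP[tr r0]; have tr0 : t - r <= 0 by rewrite subr_le0.
    rewrite (le_trans (S2_decay _ tr0))// zb_neg// -mulrA -expRD mulrC.
    by rewrite (_ : - b * (t - r) = - b * t + b * r)//; ring.
  apply: (le_trans (norm_r_int_exp (lt0r_neq0 b0) t0 ci hb)).
  rewrite mulr0 expR0 [_ / b]mulrAC -[leRHS]mulr1.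
  have gb0 : 0 <= `|g0| / b by rewrite divr_ge0// ltW.
  apply: ler_pM => //.
  - by rewrite mulr_ge0 ?expR_ge0.
  - by rewrite subr_ge0 -expR0 ler_expR pmulr_rle0.
  - by rewrite ler_wpM2l// divr_ge0// ltW.
exists (CX + `|x0| + (`|y0| + `|g0| / b + `|y0|)); split.
  by rewrite !addr_ge0// divr_ge0// ltW.
move=> t; rewrite /sum_norm.
have -> : (lp zb t - zb t).2 = yb t - (zb t).2 by rewrite -lp2E.
have -> : (lp zb t - zb t).1 = (lp zb t).1 - (zb t).1 by [].
rewrite mulrDl; have [t0|t0'] := leP 0 t.
  apply: lerD; first exact: x_pos.
  rewrite yb_pos// subrr normr0 mulr_ge0 ?expR_ge0//.
  by rewrite addr_ge0// addr_ge0// divr_ge0// ltW.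
have t0 := ltW t0'.
have er : 1 <= expR (- eta * t) by rewrite -expR0 ler_expR mulNr oppr_ge0 pmulr_rle0.
rewrite lerD//.
  by rewrite (le_trans (ler_normB _ _))// mulrDl lerD ?x_neg// zb_neg// ler_peMr.
by rewrite (le_trans (ler_normB _ _))// [leRHS]mulrDl lerD ?y_neg// zb_neg// ler_peMr.
Qed.

Lemma exponential_tracking : exists z, [/\ continuous z, mild setT z,
  exists D, forall t, t <= 0 -> sum_norm (z t) <= D * expR (- eta * t) &
  forall t, 0 <= t ->
    sum_norm (zb t - z t) <= (1 - q)^-1 * expR (- eta * t) * sum_norm (zb 0 - z 0)].
Proof.
pose om (_ : unit) t := expR (- eta * t).
have classE z : weighted_class (fun _ : unit => setT) om zb z -> in_class z.
  move=> [cz /(_ tt)[D [D0 DP]]]; split=> //; exists D; split=> // t.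
  exact: DP.
have om_loc L : exists (i : unit) M, forall t, `|t| <= L -> setT t /\ om i t <= M.
  exists tt, (expR (eta * L)) => t tL; split=> //; rewrite ler_expR mulNr -mulrN ler_pM2l//.
  by rewrite (le_trans _ tL)// -normrN ler_norm.
have [|||z [Xz lpz]] := @contraction_fixed_point _ _ _ unit (fun=> setT) om q lp zb q_ge0 q_lt1 om_loc zb_continuous.
- by move=> z /classE; exact: lp_continuous.
- move=> z z' i D /classE Xz /classE Xz' D0 H t _.
  rewrite /sum_norm /= /q mulrDl mulrDl lerD//.
    by apply: lp1_le => // r _; exact: H.
  by apply: lp2_le => // r _; exact: H.
- by move=> i; have [D [D0 DP]] := lp_start; exists D; split=> // t _; exact: DP.
move/classE in Xz; have cz := Xz.1.
exists z; split=> //.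
- by move=> s t _ _ st; rewrite -!lpz (lp1_mild Xz st) (lp2_mild s t Xz) !lpz.
- have [D [D0 DP]] := Xz.2; exists (D + sum_norm (zb 0)) => t t0.
  have er : 1 <= expR (- eta * t) by rewrite -expR0 ler_expR mulNr oppr_ge0 pmulr_rle0.
  rewrite -[z t](subrK (zb t)) (le_trans (sum_normD _ _))// mulrDl lerD//.
  by rewrite zb_neg// ler_peMr// sum_norm_ge0.
have [D [D0 DP]] := Xz.2.
(* The [D] of the fixed point depends on the noise and serves only as an a priori bound. In forward
   time the fast difference starts from [z 0 - zb 0] and the slow one is an integral from +oo, so
   that bound improves to the one with the initial distance. *)
suff H : forall t, 0 <= t ->
    expR (eta * t) * sum_norm (z t - zb t) <= sum_norm (z 0 - zb 0) / (1 - q).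
  move=> t t0; rewrite sum_normC [sum_norm (zb 0 - z 0)]sum_normC.
  have := H t t0; rewrite -ler_pdivlMl ?expR_gt0// -expRN -mulNr => /le_trans; apply.
  by rewrite le_eqVlt; apply/orP; left; apply/eqP; ring.
apply: (@self_improving_bound _ _ [set t | 0 <= t] _ q (sum_norm (z 0 - zb 0)) D) => //.
  move=> s _; have := DP s; rewrite mulNr expRN => h.
  by rewrite -ler_pdivlMl ?expR_gt0// mulrC.
move=> N NP s s0; have {}NP r : 0 <= r -> sum_norm (z r - zb r) <= N * expR (- eta * r).
  move=> /NP; rewrite mulNr expRN -ler_pdivlMl ?expR_gt0// mulrC; apply.
rewrite -ler_pdivlMl ?expR_gt0// -expRN -mulNr mulrC.
have -> : (q * N + sum_norm (z 0 - zb 0)) * expR (- eta * s) =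
    (sum_norm (z 0 - zb 0) * expR (- eta * s) + k1 / (a - eta) * N * expR (- eta * s)) +
    k2 / (eta - b) * N * expR (- eta * s) by rewrite /q; ring.
have N0 : 0 <= N.
  have := le_trans (sum_norm_ge0 _) (NP 0 (lexx _)).
  by rewrite mulr0 expR0 mulr1.
rewrite /sum_norm /= lerD//; last first.
  have -> : (zb s).2 = (lp zb s).2.
    rewrite -yb_pos// /lp /= (_ : int_to_pinfty _ _ = 0) ?subr0//.
    apply/eqP; rewrite -normr_le0.
    have ci := C2cont (t := s) (dG_path zb_continuous).
    rewrite -[leRHS](mul0r (expR (- (eta - b) * s))) -[X in X * expR _](mul0r (eta - b)^-1).
    apply: (norm_int_to_pinfty ci eb0) => r _; rewrite mul0r /dG subrr.
    by rewrite -[X in S2 _ X](subrr (0 : H2)) linear_funB// subrr normr0.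
  rewrite -[z s]lpz; apply: lp2_le => // r sr; apply: NP; exact: le_trans sr.
have [-> _] := zb_mild (lexx 0) s0 s0; rewrite -lpz (lp1_mild Xz s0) lpz subr0.
rewrite (_ : forall u v w x : H1, u + v - (w + x) = (u - w) + (v - x)); last by move=> *; zmod.
rewrite (le_trans (ler_normD _ _))// lerD//.
  rewrite -(linear_funB _ _ (S1_linear _)) (le_trans (S1_decay _ s0))// mulrC.
  rewrite ler_pM ?expR_ge0//; first by rewrite lerDl.
  by rewrite ler_expR !mulNr lerN2 ler_wpM2r// ltW.
have cF := F_path cz; have cF' := F_path zb_continuous.
have h := @convolB_le _ _ S1 S1_linear S1_continuous _ _ 0 s
  (k1 * N * expR (- a * s)) (a - eta) s0 (lt0r_neq0 ae0) cF cF'.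
apply: (le_trans (h _)).
  by move=> r /andP[r0 rs]; apply: S1F_lip_le => //; exact: NP.
apply: (@le_trans _ _ (k1 * N * expR (- a * s) / (a - eta) * expR ((a - eta) * s))).
  rewrite ler_wpM2l ?lerBlDr ?lerDl ?expR_ge0// divr_ge0 ?(ltW ae0)//.
  by rewrite !mulr_ge0// ?expR_ge0// ltW.
rewrite le_eqVlt; apply/orP; left; apply/eqP.
rewrite (_ : - eta * s = - a * s + (a - eta) * s); last by ring.
by rewrite expRD; ring.
Qed.

End tracking.

End slow_fast_theory.

(** * The Ornstein-Uhlenbeck process *)

Section stieltjes_shift.
Context {R : realType} {V : normedModType R}.

(** [k] stands for the constant subtracted by the Wiener shift, which increments of the integrator
    do not see. *)
Lemma is_rs_int_shift (phi : R -> V) (beta : R -> R) (c k a b : R) v :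
  is_rs_int phi beta (c + a) (c + b) v ->
  is_rs_int (fun s => phi (c + s)) (fun s => beta (c + s) - k) a b v.
Proof.
move=> H e e0; have [d d0 dP] := H e e0; exists d => // n p t p0 pn pt.
have := dP n (fun i => c + p i) (fun i => c + t i).
rewrite p0 pn => /(_ erefl erefl) h.
rewrite (eq_big_nat _ _ (F2 := fun i => (beta (c + p i.+1) - beta (c + p i)) *: phi (c + t i))).
  apply: h => i /pt[/andP[h1 h2] h3]; rewrite !lerD2l h1 h2; split=> //.
  by rewrite opprD addrACA subrr add0r.
by move=> i _; congr (_ *: _); ring.
Qed.

Lemma rs_int_shift (phi : R -> V) (beta : R -> R) (c k a b : R) :
  rs_int (fun s => phi (c + s)) (fun s => beta (c + s) - k) a b =
  rs_int phi beta (c + a) (c + b).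
Proof.
have E a' b' : [set v | is_rs_int (fun s => phi (c + s)) (fun s => beta (c + s) - k) a' b' v] =
    [set v | is_rs_int phi beta (c + a') (c + b') v].
  apply/seteqP; split=> v /=; last exact: is_rs_int_shift.
  have := @is_rs_int_shift (fun s => phi (c + s)) (fun s => beta (c + s) - k) (- c) (- k)
    (c + a') (c + b') v.
  rewrite !addKr (_ : (fun s => phi (c + (- c + s))) = phi).
    rewrite (_ : (fun s => beta (c + (- c + s)) - k - - k) = beta)//.
    by apply/funext => s; rewrite addNKr opprK subrK.
  by apply/funext => s; rewrite addNKr.
by rewrite /rs_int lerD2l !E.
Qed.

Lemma lim_ninfty_shift (h : R -> V) (c : R) :
  lim (h (c + a) @[a --> -oo]) = lim (h a @[a --> -oo]).
Proof.
congr (lim _); apply/seteqP; split=> A [M [Mr MA]].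
  exists (c + M); split; first exact: num_real.
  by move=> x xM; have := MA (x - c); rewrite /= subrKC; apply; rewrite ltrBlDl.
exists (M - c); split; first exact: num_real.
by move=> x xM; apply: MA; rewrite -ltrBrDl.
Qed.

End stieltjes_shift.

Lemma is_derive_smoothing (R : realType) (m t j : R) (J : R -> R) :
  is_derive (t : R^o) (1 : R^o) (J : R^o -> R^o) j ->
  is_derive (t : R^o) (1 : R^o) (fun s => m * (expR (- m * s) * J s) : R^o)
    (m * (expR (- m * t) * j - m * expR (- m * t) * J t)).
Proof.
move=> dJ.
have dE : is_derive (t : R^o) (1 : R^o) (fun s => expR (- m * s) : R^o)
    (expR (- m * t) * (- m *: (1 : R^o))).
  exact: is_derive1_comp (is_derive_expR (- m * t))
    (is_deriveZ (- m) (is_derive_id (t : R^o) (1 : R^o))).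
have dP := is_deriveZ m (is_deriveM dE dJ).
rewrite (_ : (fun s => m * (expR (- m * s) * J s)) =
    m \*: ((fun s => expR (- m * s) : R^o) * (J : R^o -> R^o))); last exact/funext.
apply: (is_derive_eq dP); rewrite /GRing.scale/=; ring.
Qed.

Lemma ler_normD_bound (R : realType) (V : normedModType R) (x y : V) (C D : R) :
  `|x| <= C -> `|y| <= D -> `|x + y| <= C + D.
Proof. by move=> xC yD; rewrite (le_trans (ler_normD _ _))// lerD. Qed.

Section ornstein_uhlenbeck.
Context {R : realType}.
Implicit Types (w : wpath R) (mu : R).

Lemma wpath_continuous w : continuous (w : R -> R).
Proof. by have [] := traj_C0 w. Qed.

(** The form in which sublinearity is used: far in the past [d * |r|] is below [expR (- d * r)], and
    the remaining compact interval is absorbed in the constant. *)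
Lemma sublinear_growth (h : R -> R) (d : R) : continuous h -> 0 < d ->
  h t / t @[t --> -oo] --> 0 ->
  exists C, 0 <= C /\ forall r, r <= 0 -> `|h r| <= C * expR (- d * r).
Proof.
move=> ch d0 /cvgrPdist_le/(_ _ d0)[M [_ MP]].
have [B B0 BP] := @bounded_itv R R^o (h : R -> R^o) (Num.min M 0 - 1) 0 ch.
exists (1 + B); split; first by rewrite addr_ge0// ltW.
move=> r r0.
have er : 1 <= expR (- d * r) by rewrite -expR0 ler_expR mulNr oppr_ge0 pmulr_rle0.
have [rM|Mr] := ltP r (Num.min M 0 - 1).
  have m1 : Num.min M 0 <= M by rewrite ge_min lexx.
  have m2 : Num.min M 0 <= 0 by rewrite ge_min lexx orbT.
  have rlt0 : r < 0 by lra.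
  have := MP r; rewrite sub0r normrN normrM normfV => /(_ _).
  rewrite ler_pdivrMr ?normr_gt0 ?lt_eqF// => h1.
  have {}h1 := h1 (ltac:(lra)).
  rewrite (le_trans h1)// mulrDl mul1r.
  have h2 := expR_ge1Dx (- d * r).
  rewrite (ltr0_norm rlt0) mulrN -mulNr.
  have : 0 <= B * expR (- d * r) by rewrite mulr_ge0 ?expR_ge0// ltW.
  lra.
have := BP r; rewrite Mr r0 => /(_ isT) h1; rewrite (le_trans h1)//.
by rewrite (@le_trans _ _ (1 + B))// ?lerDr// ler_peMr// addr_ge0// ltW.
Qed.

Variables (w : wpath R) (mu : R).
Hypothesis mu0 : 0 < mu.
Hypothesis w_growth : w t / t @[t --> -oo] --> 0.

Let k := mu^-1.
Let k0 : 0 < k. Proof. by rewrite invr_gt0. Qed.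

Let kern t s : R := expR (- (t - s) / mu).

Let kernE t s : kern t s = expR (- k * t) * expR (k * s).
Proof. by rewrite /kern -expRD; congr expR; rewrite /k; ring. Qed.

Let kern_primitive t : is_primitive (fun s => k * kern t s : R^o) (kern t : R -> R^o).
Proof.
have := is_primitive_expR (k * expR (- k * t)) (lt0r_neq0 k0).
have -> : (fun r => k * expR (- k * t) * expR (k * r)) = (fun s => k * kern t s).
  by apply/funext => s; rewrite kernE mulrA.
have -> : (fun r => k * expR (- k * t) / k * expR (k * r)) = kern t.
  by apply/funext => s; rewrite kernE; field; exact: lt0r_neq0.
by [].
Qed.

Let expk_continuous : continuous (fun s => expR (k * s)).
Proof.
by move=> s; apply: continuous_comp; [exact: mulrl_continuous|exact: continuous_expR].
Qed.

Let kern_continuous t : continuous (kern t).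
Proof.
have -> : kern t = (fun s => expR (- k * t) * expR (k * s)).
  by apply/funext => s; rewrite kernE.
by move=> s; apply: cvgM; [exact: cvg_cst|exact: expk_continuous].
Qed.

Let wkern_continuous t : continuous (fun s => w s *: (k * kern t s) : R^o).
Proof.
move=> s; apply: cvgZ; first exact: wpath_continuous.
by apply: cvgM; [exact: cvg_cst|exact: kern_continuous].
Qed.

Let rs_kern a t : a <= t -> rs_int (kern t : R -> R^o) w a t =
  w t - w a * kern t a - r_int (fun s => w s *: (k * kern t s) : R^o) a t.
Proof.
move=> at_; rewrite (rs_int_by_parts at_ (@wpath_continuous w) _ (kern_primitive t)).
  have -> : kern t t = 1 by rewrite /kern subrr oppr0 mul0r expR0.
  by rewrite -[w t *: _]/(w t * 1) mulr1.
by move=> s; apply: cvgM; [exact: cvg_cst|exact: kern_continuous].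
Qed.

Let wexp := (fun s => w s * expR (k * s) : R^o).

Let wexp_continuous : continuous wexp.
Proof. by move=> s; apply: cvgM; [exact: wpath_continuous|exact: expk_continuous]. Qed.

Let wexp_bound : exists C, forall r, r <= 0 -> `|wexp r| <= C * expR (k / 2 * r).
Proof.
have k20 : 0 < k / 2 by rewrite divr_gt0.
have [C [C0 CP]] := sublinear_growth (@wpath_continuous w) k20 w_growth.
exists C => r r0; rewrite /wexp normrM (ger0_norm (expR_ge0 _)).
rewrite (le_trans (ler_wpM2r (expR_ge0 _) (CP r r0)))// -[C * _ * _]mulrA -expRD.
by rewrite (_ : - (k / 2) * r + k * r = k / 2 * r)//; field.
Qed.

Let I t : R := int_from_ninfty wexp t.

Let I_cvg t : cvg (r_int wexp a t @[a --> -oo]).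
Proof.
have k20 : 0 < k / 2 by rewrite divr_gt0.
have [C CP] := wexp_bound; exact: (cvg_int_from_ninfty wexp_continuous k20 CP).
Qed.

Let I_primitive : is_primitive wexp (I : R -> R^o).
Proof.
have [G pG] := primitive_exists wexp_continuous.
have [c0 E] : exists c, forall t, I t = c + G t.
  exists (I 0 - G 0) => t; rewrite /I (int_from_ninfty_cat t wexp_continuous (@I_cvg 0)) (r_intE _ _ pG).
  by rewrite -addrA [- _ + _]addrC.
move=> a b e e0; have [d d0 dP] := pG a b e e0; exists d => // p c q ap pcq qb qpd.
by rewrite !E opprD addrACA subrr add0r; exact: dP.
Qed.

(* Up to a constant, this is the integrated process. *)
Definition ou_smoothing t : R := mu^-1 * (expR (- mu^-1 * t) * I t).

(** After integration by parts the boundary term [w a * kern t a] tends to 0 by the growth of [w],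
    and what is left is [w t] minus an exponential average of the past of [w]. *)
Let kern_lim t : rs_int (kern t : R -> R^o) w a t @[a --> -oo] --> w t - ou_smoothing t.
Proof.
have E : {near -oo, (fun a => w t - w a * kern t a - k * (expR (- k * t) * r_int wexp a t)) =1
    (rs_int (kern t : R -> R^o) w)^~ t}.
  near=> a; have at_ : a <= t by near: a; apply: nbhs_ninfty_le; exact: num_real.
  rewrite rs_kern//; congr (_ - _).
  have -> : r_int (fun s => w s *: (k * kern t s) : R^o) a t =
      (k * expR (- k * t)) *: (r_int wexp a t : R^o).
    rewrite -(r_intZ _ a t wexp_continuous); apply: eq_r_int => // s _.
    by rewrite kernE /wexp /GRing.scale/=; ring.
  by rewrite /GRing.scale/= mulrA.
apply: cvg_trans (near_eq_cvg E) _.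
apply: cvgB; last first.
  by apply: cvgM; [exact: cvg_cst|apply: cvgM; [exact: cvg_cst|exact: I_cvg]].
rewrite -[X in _ --> X]subr0; apply: cvgB; first exact: cvg_cst.
have k20 : 0 < k / 2 by rewrite divr_gt0.
have [C CP] := wexp_bound.
have C0 : 0 <= C by have := le_trans (normr_ge0 _) (CP 0 (lexx 0)); rewrite mulr0 expR0 mulr1.
apply/cvgrPdist_le => e e0.
have [t1 t1P] := expR_small_pinfty (mulr_ge0 (expR_ge0 (- k * t)) C0) k20 e0.
near=> a; have a0 : a <= Num.min 0 (- t1).
  by near: a; apply: nbhs_ninfty_le; exact: num_real.
move: a0; rewrite le_min => /andP[a0 at1].
rewrite sub0r normrN kernE mulrCA normrM (ger0_norm (expR_ge0 _)).
apply: (@le_trans _ _ (expR (- k * t) * (C * expR (k / 2 * a)))).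
  by rewrite ler_wpM2l ?expR_ge0//; exact: CP.
by have := t1P (- a); rewrite mulrA mulrNN; apply; rewrite lerNr.
Unshelve. all: by end_near. Qed.

Lemma ouE t : ou mu w t = mu^-1 * (w t - ou_smoothing t).
Proof. by rewrite /ou; congr (_ * _); apply: cvg_lim => //; exact: kern_lim. Qed.

Lemma ou_continuous : continuous (ou mu w).
Proof.
have -> : ou mu w = (fun t => mu^-1 * (w t - ou_smoothing t)).
  by apply/funext => t; exact: ouE.
move=> t; apply: cvgM; first exact: cvg_cst.
apply: cvgB; first exact: wpath_continuous.
apply: cvgM; first exact: cvg_cst.
apply: cvgM; last exact: (is_primitive_continuous wexp_continuous I_primitive).
by apply: continuous_comp; [exact: mulrl_continuous|exact: continuous_expR].
Qed.

(** The exponential average [y] solves [mu y' = w - y], and the right side is [mu * ou mu w] by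
    [ouE]. So the integrated process is the path smoothed at time scale [mu]. *)
Lemma ou_primitive : is_primitive (ou mu w : R -> R^o) (ou_smoothing : R -> R^o).
Proof.
apply: derive_is_primitive; first exact: ou_continuous.
move=> t; have dI := is_primitive_derive t wexp_continuous I_primitive.
have -> : ou mu w t = mu^-1 * (expR (- mu^-1 * t) * wexp t - mu^-1 * expR (- mu^-1 * t) * I t).
  rewrite ouE /ou_smoothing /wexp; move: (I t) => It.
  have -> : expR (- mu^-1 * t) * (w t * expR (k * t)) = w t.
    by rewrite mulrCA -expRD /k mulNr addNr expR0 mulr1.
  by ring.
exact: is_derive_smoothing dI.
Qed.

Lemma integrated_ouE t : integrated_ou mu w t = ou_smoothing t - ou_smoothing 0.
Proof. by rewrite /integrated_ou (r_intE _ _ ou_primitive). Qed.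

Lemma integrated_ou_primitive :
  is_primitive (ou mu w : R -> R^o) (integrated_ou mu w : R -> R^o).
Proof.
have := ou_primitive => pG a b e e0; have [d d0 dP] := pG a b e e0.
exists d => // p c q ap pcq qb qpd; rewrite !integrated_ouE.
by rewrite opprB addrA subrK; exact: dP.
Qed.

Lemma integrated_ou_deriv r : ((integrated_ou mu w)^`())%classic r = ou mu w r.
Proof.
have := is_primitive_derive r ou_continuous integrated_ou_primitive.
by move=> d; rewrite derive1E; exact: derive_val.
Qed.

Lemma integrated_ou_dist t : integrated_ou mu w t - w t = mu * ou mu w 0 - mu * ou mu w t.
Proof.
rewrite integrated_ouE !ouE !mulrA divff ?gt_eqF// !mul1r.
have -> : w 0 = 0 by have [] := traj_C0 w.
ring.
Qed.

(** [mu * ou mu w t] averages [w t - w s] over the past with the kernel [expR (- (t - s) / mu)]. The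
    allowed growth uses up half of that decay; the boundary term is then at most [D] and the
    integral at most [2 * D]. *)
Lemma ou_small (D t : R) : 0 <= D ->
  (forall s, s <= t -> `|w t - w s| <= D * expR ((t - s) / (2 * mu))) ->
  `|mu * ou mu w t| <= 3 * D.
Proof.
move=> D0 H.
have ker0 s : 0 <= kern t s by exact: expR_ge0.
have E a : a <= t -> rs_int (kern t : R -> R^o) w a t =
    (w t - w a) *: (kern t a : R^o) + r_int (fun s => (w t - w s) *: (k * kern t s) : R^o) a t.
  move=> at_; rewrite rs_kern//.
  have -> : (fun s => (w t - w s) *: (k * kern t s) : R^o) =
      (fun s => w t *: (k * kern t s : R^o) - w s *: (k * kern t s : R^o)).
    by apply/funext => s; rewrite scalerBl.
  have ck : continuous (fun s => k * kern t s : R^o).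
    by move=> s; apply: cvgM; [exact: cvg_cst|exact: kern_continuous].
  rewrite r_intB//; last by move=> s; apply: cvgZl_tmp; exact: ck.
  rewrite r_intZ// (r_intE _ _ (@kern_primitive t)).
  have -> : kern t t = 1 by rewrite /kern subrr oppr0 mul0r expR0.
  by rewrite /GRing.scale/=; ring.
have k20 : 0 < k / 2 by rewrite divr_gt0.
have small s : s <= t -> `|w t - w s| * kern t s <= D * expR (- (k / 2) * t) * expR (k / 2 * s).
  move=> st; rewrite (le_trans (ler_wpM2r (ker0 s) (H s st)))//.
  rewrite /kern -[leLHS]mulrA -[leRHS]mulrA -!expRD ler_wpM2l// ler_expR.
  by rewrite le_eqVlt; apply/orP; left; apply/eqP; rewrite /k; field; exact: lt0r_neq0.
have -> : mu * ou mu w t = lim (rs_int (kern t : R -> R^o) w a t @[a --> -oo]).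
  by rewrite /ou mulrA divff ?gt_eqF// mul1r.
have cv : cvg (rs_int (kern t : R -> R^o) w a t @[a --> -oo]) by apply/cvg_ex; eexists; exact: kern_lim.
apply: (lim_norm_le cv); near=> a.
have at_ : a <= t by near: a; apply: nbhs_ninfty_le; exact: num_real.
rewrite E// (_ : 3 * D = D + 2 * D); last by ring.
have le1 s : s <= t -> expR (- (k / 2) * t) * expR (k / 2 * s) <= 1.
  move=> st; rewrite -expRD -[leRHS]expR0 ler_expR.
  have -> : - (k / 2) * t + k / 2 * s = k / 2 * (s - t) by ring.
  by rewrite pmulr_rle0// subr_le0.
have h1 : `|(w t - w a) *: (kern t a : R^o)| <= D.
  rewrite normrZ (ger0_norm (ker0 a)); apply: (le_trans (small a at_)).
  by rewrite -[D * _ * _]mulrA ler_piMr// le1.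
apply: (@ler_normD_bound R R^o _ _ _ _ h1).
have cint : continuous (fun s => (w t - w s) *: (k * kern t s) : R^o).
  move=> s; apply: cvgZ; first by apply: cvgB; [exact: cvg_cst|exact: wpath_continuous].
  by apply: cvgM; [exact: cvg_cst|exact: kern_continuous].
have hb s : a <= s <= t -> `|(w t - w s) *: (k * kern t s) : R^o| <=
    k * D * expR (- (k / 2) * t) * expR (k / 2 * s).
  move=> /andP[_ st]; rewrite normrZ normrM (ger0_norm (ker0 s)) (gtr0_norm k0) mulrCA.
  by rewrite -2!(mulrA k) ler_pM2l// small.
apply: (le_trans (norm_r_int_exp (lt0r_neq0 k20) at_ cint hb)).
apply: (@le_trans _ _ (k * D * expR (- (k / 2) * t) / (k / 2) * expR (k / 2 * t))).
  rewrite ler_wpM2l ?lerBlDr ?lerDl ?expR_ge0// divr_ge0 ?(ltW k20)//.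
  by rewrite !mulr_ge0// ?expR_ge0// ltW.
rewrite (_ : _ * expR (k / 2 * t) = 2 * D * (expR (- (k / 2) * t) * expR (k / 2 * t))); last first.
  by field; exact: lt0r_neq0.
by rewrite ler_piMr ?mulr_ge0// le1.
Unshelve. all: by end_near. Qed.

Lemma ou_shift c t : ou mu (wiener_shift c w) t = ou mu w (c + t).
Proof.
rewrite /ou; congr (_ * _).
pose h a := rs_int (fun s => expR (- (c + t - s) / mu) : R^o) w a (c + t).
have E : (fun a => rs_int (fun s => expR (- (t - s) / mu) : R^o) (wiener_shift c w) a t) =
    (fun a => h (c + a)).
  apply/funext => a.
  have -> : (fun s => expR (- (t - s) / mu) : R^o) =
      (fun s => expR (- (c + t - (c + s)) / mu) : R^o).
    by apply/funext => s; have -> : c + t - (c + s) = t - s by ring.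
  exact: (@rs_int_shift _ _ (fun s => expR (- (c + t - s) / mu) : R^o) w c (w c) a t).
by rewrite E (lim_ninfty_shift h).
Qed.

End ornstein_uhlenbeck.

(** * Hoelder continuity of Wiener paths *)

Section wiener_paths.
Context {R : realType}.

(** A singleton is compact, so evaluations are continuous for the compact-open topology; the events
    on increments become open, hence measurable in [wpath]. *)
Lemma evaluation_continuous (t : R) : continuous (fun w : C0 R => set_val w t : R).
Proof.
move=> w A /= Anbhs.
have c1 : continuous (set_val : C0 R -> {compact-open, R -> R}) by exact: initial_continuous.
have c2 : {for (set_val w : {compact-open, R -> R}),
    continuous (fun f : {compact-open, R -> R} => f t : R)}.
  move=> B; rewrite /= !nbhsE; case=> U [oU Ut] UB.
  exists [set f | f @` [set t] `<=` U].
    split; first by apply: compact_open_open => //; exact: compact_set1.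
    by move=> _ [_ -> <-].
  by move=> f /= fU; apply: UB; apply: fU; exists t.
exact: (@continuous_comp _ _ _ (set_val : C0 R -> {compact-open, R -> R})
  (fun f : {compact-open, R -> R} => f t : R) w (c1 w) c2).
Qed.

Lemma measurable_increment (x s t : R) : measurable [set w : wpath R | x < `|w t - w s|].
Proof.
apply: sub_sigma_algebra.
have cd : continuous (fun w : C0 R => `|set_val w t - set_val w s| : R).
  move=> w.
  pose et := (fun w : C0 R => set_val w t : R^o); pose es := (fun w : C0 R => set_val w s : R^o).
  have ct : et u @[u --> w] --> et w := @evaluation_continuous t w.
  have cs : es u @[u --> w] --> es w := @evaluation_continuous s w.
  exact: (cvg_norm (cvgB ct cs)).
have := open_comp (fun w _ => cd w) (@open_gt R x).
exact.
Qed.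

Lemma measurable_normr_gt (x : R) : measurable [set y : R | x < `|y|].
Proof.
apply: open_measurable.
exact: open_comp (fun (y : R) _ => @norm_continuous R R^o y) (@open_gt R x).
Qed.

(* Comparing the density of the variance [s ^ 2] with twice that of the variance
   [(2 s) ^ 2] gives the tail bound without integrating. *)
Lemma normal_tail (s x : R) : 0 < s -> 0 <= x ->
  (normal_prob 0 s [set y | (x < `|y|)%R] <= (2 * expR (- (3 / 8 * (x / s) ^+ 2)))%:E)%E.
Proof.
move=> s0 x0; set c := 2 * _.
have s20 : 0 < 2 * s by rewrite mulr_gt0.
have c0 : 0 <= c by rewrite mulr_ge0// expR_ge0.
have mD := measurable_normr_gt x.
have pdfE (v y : R) : 0 < v ->
    normal_pdf 0 v y = normal_peak v * expR (- y ^+ 2 / (v ^+ 2 *+ 2)).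
  by move=> v0; rewrite normal_pdfE ?gt_eqF// /normal_fun subr0.
(* The densities have the ratio [2 * expR (- (3 / 8 * (y / s) ^+ 2))], with [3 / 8 = 1 / 2 - 1 / 8],
   and it decreases in [|y|]. *)
have pdf_le y : x < `|y| -> normal_pdf 0 s y <= c * normal_pdf 0 (2 * s) y.
  move=> xy; rewrite !pdfE//.
  have -> : normal_peak s = 2 * normal_peak (2 * s).
    rewrite /normal_peak.
    have -> : (2 * s) ^+ 2 * pi *+ 2 = 2 ^+ 2 * (s ^+ 2 * pi *+ 2).
      by rewrite exprMn mulrnAr mulrA.
    rewrite sqrtrM ?exprn_ge0// sqrtr_sqr ger0_norm// invfM mulrA divff ?mul1r//.
  rewrite /c -(mulrA 2) -(mulrA 2) ler_pM2l// mulrCA ler_wpM2l ?normal_peak_ge0//.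
  rewrite -expRD ler_expR.
  have xy2 : x ^+ 2 <= y ^+ 2.
    by rewrite -(real_normK (num_real y)) lerXn2r ?nnegrE// ltW.
  have E : - y ^+ 2 / (s ^+ 2 *+ 2) =
      - (3 / 8 * (y / s) ^+ 2) + - y ^+ 2 / ((2 * s) ^+ 2 *+ 2).
    by rewrite -[s ^+ 2 *+ 2]mulr_natr -[_ *+ 2]mulr_natr; field; rewrite gt_eqF.
  rewrite E lerD2r lerN2 ler_pM2l ?divr_gt0// !exprMn ler_wpM2r//.
  by rewrite exprn_ge0// invr_ge0 ltW.
have mf : measurable_fun setT (fun y => (normal_pdf 0 (2 * s) y)%:E).
  by apply/measurable_EFinP; exact: measurable_normal_pdf.
have mf1 : measurable_fun [set y : R | x < `|y|] (fun y => (normal_pdf 0 (2 * s) y)%:E).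
  exact: measurable_funTS.
rewrite /normal_prob.
apply: (@le_trans _ _ (\int[lebesgue_measure]_(y in [set y | (x < `|y|)%R])
    (c%:E * (normal_pdf 0 (2 * s) y)%:E))%E).
  apply: ge0_le_integral => //.
  - by move=> y _; rewrite lee_fin normal_pdf_ge0.
  - by apply: measurable_funTS; apply/measurable_EFinP; exact: measurable_normal_pdf.
  - by apply: measurable_funeM.
have pdf0 y : [set y : R | (x < `|y|)%R] y -> (0 <= (normal_pdf 0 (2 * s) y)%:E)%E.
  by move=> _; rewrite lee_fin normal_pdf_ge0.
have -> := @ge0_integralZl_EFin _ _ _ lebesgue_measure _ mD _ pdf0 mf1 _ c0.
rewrite -[leRHS]mule1 lee_wpmul2l ?lee_fin// -(@integral_normal_pdf R 0 (2 * s)).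
apply: ge0_subset_integral => //.
by move=> y _; rewrite lee_fin normal_pdf_ge0.
Qed.

(** Raise [u / m <= expR (u / m)] to the power [m]. A suitable [m] turns the Gaussian tail into
    geometric decay. *)
Lemma expRN_le_power (u : R) (m : nat) : 0 < u -> (0 < m)%N ->
  expR (- u) <= (m%:R / u) ^+ m.
Proof.
move=> u0 m0; have mR : 0 < m%:R :> R by rewrite ltr0n.
rewrite expRN -[leLHS]invrK -invf_div exprVn lef_pV2 ?posrE ?exprn_gt0 ?divr_gt0//.
- rewrite invrK.
  have -> : u = m%:R * (u / m%:R) by rewrite mulrCA divff ?gt_eqF// mulr1.
  rewrite expRM_natl [_ * _ / _]mulrAC divff ?gt_eqF// mul1r.
  rewrite lerXn2r ?nnegrE ?expR_ge0 ?divr_ge0// ?ltW//.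
  by rewrite (lt_le_trans _ (expR_ge1Dx _))// ltrDr.
- by rewrite invr_gt0 invr_gt0 expR_gt0.
Qed.

Definition dyadic (L n k : nat) : R := k%:R / 2 ^+ n - L%:R.

(** The [2 * L * 2 ^ n] cells cover [[-L, L]]. For [r = hoelder_base beta] the threshold is the mesh
    to the power [beta]. *)
Definition bad_increment (r : R) (L n : nat) : set (wpath R) :=
  \big[setU/set0]_(k < 2 * L * 2 ^ n)
    [set w : wpath R | r ^+ n < `|w (dyadic L n k.+1) - w (dyadic L n k)|].

Lemma measurable_bad_increment r L n : measurable (bad_increment r L n).
Proof. by apply: bigsetU_measurable => k _; exact: measurable_increment. Qed.

(** A union bound. Each increment has variance [2 ^- n], so the squared threshold in units of the
    deviation is [(2 * r ^+ 2) ^+ n]. *)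
Lemma bad_increment_le (P : probability (wpath R) R) (r : R) (L n : nat) :
  is_wiener P -> 0 < r ->
  (P (bad_increment r L n) <=
    (4 * L%:R * 2 ^+ n * expR (- (3 / 8 * (2 * r ^+ 2) ^+ n)))%:E)%E.
Proof.
move=> [PW _] r0.
pose ev k := [set w : wpath R | r ^+ n < `|w (dyadic L n k.+1) - w (dyadic L n k)|].
have mev i : (i < 2 * L * 2 ^ n)%N -> measurable (ev i).
  by move=> _; exact: measurable_increment.
apply: (le_trans (le_mu_bigsetU P mev)).
pose c := (2 * expR (- (3 / 8 * (2 * r ^+ 2) ^+ n)))%:E.
apply: (@le_trans _ _ (\sum_(k < 2 * L * 2 ^ n) c)%E).
  apply: lee_sum => k _.
  have dk : dyadic L n k.+1 - dyadic L n k = (2 ^+ n)^-1.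
    by rewrite /dyadic -natr1 mulrDl mul1r; ring.
  have dlt : dyadic L n k < dyadic L n k.+1.
    by rewrite -subr_gt0 dk invr_gt0 exprn_gt0.
  have mA := measurable_normr_gt (r ^+ n).
  suff : (P (ev k) <= c)%E by [].
  have -> : P (ev k) = _ := PW _ _ _ dlt mA.
  rewrite dk.
  have s0 : 0 < Num.sqrt ((2 ^+ n)^-1 : R) by rewrite sqrtr_gt0 invr_gt0 exprn_gt0.
  apply: (le_trans (normal_tail s0 (exprn_ge0 n (ltW r0)))).
  rewrite /c lee_fin le_eqVlt; apply/orP; left; apply/eqP; congr (2 * expR (- (_ * _))).
  rewrite exprMn exprVn sqr_sqrtr ?invr_ge0 ?exprn_ge0// invrK.
  by rewrite [in RHS]exprMn mulrC -!exprM mulnC.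
rewrite sumEFin lee_fin sumr_const card_ord.
by rewrite -[_ *+ _]mulr_natr !natrM natrX le_eqVlt; apply/orP; left; apply/eqP; ring.
Qed.

Lemma bad_increment_summable (P : probability (wpath R) R) (r : R) (L : nat) :
  is_wiener P -> 0 < r -> 1 < 2 * r ^+ 2 ->
  (\big[+%E/0%R]_(0 <= n <oo) P (bad_increment r L n) < +oo)%E.
Proof.
move=> PW r0 c1; set c := 2 * r ^+ 2 in c1.
have c0 : 0 < c by exact: lt_trans c1.
(* With [c ^+ m >= 4] the number of cells, of order [2 ^+ n], times the tail [(c ^+ m) ^- n] is at
   most of order [2 ^- n]. *)
have [m [m0 cm]] : exists m, (0 < m)%N /\ 4 <= c ^+ m.
  have ci0 : 0 <= c^-1 by rewrite invr_ge0 ltW.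
  have ci1 : c^-1 < 1 by rewrite invf_lt1.
  have e0 : 0 < 4^-1 :> R by rewrite invr_gt0.
  have [m mP] := geometric_small 1 ci0 ci1 e0.
  exists m.+1; split=> //; have := mP m.+1 (leqnSn m).
  by rewrite mul1r exprVn lef_pV2 ?posrE ?exprn_gt0.
pose C := 4 * L%:R * (m%:R / (3 / 8)) ^+ m : R.
have C0 : 0 <= C by rewrite !mulr_ge0// exprn_ge0// divr_ge0.
have bound n : (P (bad_increment r L n) <= (C * 2^-1 ^+ n)%:E)%E.
  apply: (le_trans (bad_increment_le L n PW r0)); rewrite lee_fin /C -/c.
  have u0 : 0 < 3 / 8 * c ^+ n by rewrite mulr_gt0// exprn_gt0.
  apply: (@le_trans _ _ (4 * L%:R * 2 ^+ n * (m%:R / (3 / 8 * c ^+ n)) ^+ m)).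
    by rewrite ler_wpM2l ?expRN_le_power// !mulr_ge0// exprn_ge0.
  have -> : (m%:R / (3 / 8 * c ^+ n)) ^+ m = (m%:R / (3 / 8)) ^+ m * (c ^+ m)^-1 ^+ n.
    by rewrite invfM mulrA exprMn [in RHS]exprVn -exprM mulnC exprM exprVn.
  have h : (2 / c ^+ m) ^+ n <= 2^-1 ^+ n.
    rewrite lerXn2r ?nnegrE// ?divr_ge0 ?exprn_ge0 ?(ltW c0)//.
    by rewrite ler_pdivrMr ?exprn_gt0//; lra.
  rewrite exprMn in h.
  have X0 : 0 <= 4 * L%:R * (m%:R / (3 / 8)) ^+ m :> R.
    by rewrite !mulr_ge0// exprn_ge0// divr_ge0.
  apply: le_trans (ler_wpM2l X0 h); rewrite le_eqVlt; apply/orP; left; apply/eqP.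
  by ring.
apply: (@le_lt_trans _ _ (C * 2)%:E); last exact: ltry.
apply: lime_le; first by apply: is_cvg_nneseries => n _ _; exact: measure_ge0.
apply: nearW => N.
apply: (@le_trans _ _ (\sum_(0 <= n < N) (C * 2^-1 ^+ n)%:E)%E).
  by apply: lee_sum => n _; exact: bound.
rewrite sumEFin lee_fin -mulr_sumr ler_wpM2l//.
elim: N => [|N IH]; first by rewrite big_nil.
suff : \sum_(0 <= i < N.+1) 2^-1 ^+ i = 2 - 2^-1 ^+ N :> R.
  by move=> ->; rewrite lerBlDr lerDl exprn_ge0.
elim: N {IH} => [|N IH]; first by rewrite big_nat1 !expr0; ring.
by rewrite big_nat_recr//= IH exprS; field.
Qed.

(** Borel-Cantelli for each [L], then a countable union of null sets. *)
Lemma ae_dyadic_increments (P : probability (wpath R) R) (r : R) :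
  is_wiener P -> 0 < r -> 1 < 2 * r ^+ 2 ->
  {ae P, forall w : wpath R, forall L : nat, exists n0, forall n, (n0 <= n)%N ->
    forall k, (k < 2 * L * 2 ^ n)%N ->
      `|w (dyadic L n k.+1) - w (dyadic L n k)| <= r ^+ n}.
Proof.
move=> PW r0 c1; apply: ae_foralln => L.
exists (lim_sup_set (bad_increment r L)); split.
- by apply: bigcap_measurable => // n _; apply: bigcup_measurable => k _; exact: measurable_bad_increment.
- apply: lim_sup_set_cvg0 => [n|]; first exact: measurable_bad_increment.
  exact: bad_increment_summable.
move=> w /= nP n _; apply: contrapT => nB; apply: nP; exists n => m nm k km.
rewrite leNgt; apply/negP => H; apply: nB; exists m => //.
rewrite /bad_increment -(bigcup_mkord _ (fun k =>
  [set w : wpath R | r ^+ m < `|w (dyadic L m k.+1) - w (dyadic L m k)|])).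
by exists k.
Qed.

End wiener_paths.

(** * From dyadic increments to a modulus of continuity *)

Section dyadic_chaining.
Context {R : realType}.
Variables (w : R -> R) (r : R) (L n0 : nat).
Hypotheses (w_continuous : continuous w) (r0 : 0 < r) (r1 : r < 1).
Hypothesis w_dyadic : forall n, (n0 <= n)%N -> forall k, (k < 2 * L * 2 ^ n)%N ->
  `|w (dyadic L n k.+1) - w (dyadic L n k)| <= r ^+ n.

(** For [t >= - L], [dyadic L n (rank n t)] is the last dyadic point of rank [n] not above [t]. *)
Let rank n (t : R) := Num.truncn (2 ^+ n * (t + L%:R)).

Let rank_itv n t : - L%:R <= t ->
  (rank n t)%:R <= 2 ^+ n * (t + L%:R) /\ 2 ^+ n * (t + L%:R) < (rank n t).+1%:R.
Proof.
move=> Lt; have /truncn_itv/andP[] : 0 <= 2 ^+ n * (t + L%:R).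
  by rewrite mulr_ge0 ?exprn_ge0// -lerBlDr sub0r.
by [].
Qed.

Let rank_lt n t : - L%:R <= t -> t < L%:R -> (rank n t < 2 * L * 2 ^ n)%N.
Proof.
move=> Lt tL; have [h _] := rank_itv n Lt.
rewrite -(ltr_nat R) (le_lt_trans h)// !natrM natrX mulrC ltr_pM2r ?exprn_gt0//.
lra.
Qed.

Let rank_dist n t : - L%:R <= t -> `|dyadic L n (rank n t) - t| <= 2^-1 ^+ n.
Proof.
move=> Lt; have [h1 h2] := rank_itv n Lt.
have p0 : 0 < 2 ^+ n :> R by rewrite exprn_gt0.
rewrite distrC ger0_norm; last first.
  by rewrite /dyadic opprB addrA subr_ge0 ler_pdivrMr// mulrC.
rewrite /dyadic exprVn.
have : (t + L%:R) < ((rank n t).+1%:R) / 2 ^+ n by rewrite ltr_pdivlMr// mulrC.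
rewrite -natr1 mulrDl mul1r; lra.
Qed.

(** Refining the mesh either keeps the point below [t] or moves it by one cell of the finer mesh:
    the new index is [2 k] or [2 k + 1]. *)
Let rank_step n t : - L%:R <= t -> t < L%:R -> (n0 <= n)%N ->
  `|w (dyadic L n.+1 (rank n.+1 t)) - w (dyadic L n (rank n t))| <= r * r ^+ n.
Proof.
move=> Lt tL n0n; have [h1 h2] := rank_itv n Lt; have [h3 h4] := rank_itv n.+1 Lt.
have lt1 := rank_lt n.+1 Lt tL.
rewrite -exprS; set k := rank n t in h1 h2 *; set k' := rank n.+1 t in h3 h4 lt1 *.
rewrite exprS -mulrA in h3 h4.
have Ek : dyadic L n k = dyadic L n.+1 k.*2 :> R.
  rewrite /dyadic -muln2 natrM exprS; congr (_ - _); field.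
  by rewrite expf_neq0.
have k'1 : (k.*2 <= k')%N.
  rewrite -ltnS -(ltr_nat R) (le_lt_trans _ h4)// -muln2 natrM mulrC ler_pM2l//.
have k'2 : (k' <= k.*2.+1)%N.
  rewrite -ltnS -(ltr_nat R) (le_lt_trans h3)//.
  rewrite (_ : k.*2.+2 = (2 * k.+1)%N); last by rewrite mul2n doubleS.
  by rewrite natrM ltr_pM2l.
have [->|] := eqVneq k' k.*2; first by rewrite Ek subrr normr0 exprn_ge0// ltW.
move=> nk; have {nk k'1 k'2} E : k' = k.*2.+1.
  by apply/eqP; rewrite eqn_leq k'2 ltn_neqAle eq_sym nk.
rewrite E Ek; apply: w_dyadic; first exact: leqW.
by apply: leq_trans lt1; rewrite E ltnS.
Qed.

Let rank_close n t : - L%:R <= t -> t < L%:R -> (n0 <= n)%N ->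
  `|w t - w (dyadic L n (rank n t))| <= r ^+ n / (1 - r).
Proof.
move=> Lt tL n0n.
pose u j := w (dyadic L (n + j) (rank (n + j) t)).
have step j : `|u j.+1 - u j : R^o| <= r ^+ n * r ^+ j.
  rewrite /u addnS -exprD; apply: le_trans (rank_step Lt tL _) _; first exact: leq_trans (leq_addr _ _).
  by rewrite ler_piMl ?exprn_ge0// ltW.
have cvu : (u j : R^o) @[j --> \oo] --> (w t : R^o).
  apply/cvgrPdist_le => e e0.
  have /cvgrPdist_le/(_ _ e0)/nbhs_normP[d d0 dP] := @w_continuous t.
  have h2 : 0 <= 2^-1 :> R by [].
  have h2' : 2^-1 < 1 :> R by rewrite invf_lt1// ltr1n.
  have d20 : 0 < d / 2 by rewrite divr_gt0.
  have [N NP] := geometric_small 1 h2 h2' d20.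
  exists N => // j /= Nj; apply: dP; rewrite /= distrC.
  rewrite (le_lt_trans (rank_dist (n + j) Lt))//.
  have := NP (n + j)%N (leq_trans Nj (leq_addl _ _)); rewrite mul1r => h.
  by rewrite (le_lt_trans h)// ltr_pdivrMr// ltr_pMr// ltr1n.
apply: (@lim_norm_le R _ \oo _ R^o (fun j => u j - u 0%N)).
  rewrite (_ : w (dyadic L n (rank n t)) = u 0%N); last by rewrite /u addn0.
  by apply: cvgB => //; exact: cvg_cst.
apply: nearW => j.
have := @geometric_dist R R^o u (r ^+ n) r (ltW r0) r1 step 0 j.
by rewrite add0n expr0 mulr1.
Qed.

(** Chaining at each end costs [r ^+ m / (1 - r)], and at most [1 + 2 ^+ m * (t - s)] cells separate
    the two points of rank [m]. The rank is left free, to be matched with [mu] rather than with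
    [t - s]. *)
Lemma dyadic_modulus m s t : (n0 <= m)%N -> - L%:R <= s -> s <= t -> t < L%:R ->
  `|w t - w s| <= r ^+ m * (2 / (1 - r) + 1 + 2 ^+ m * (t - s)).
Proof.
move=> n0m Ls st tL.
have Lt := le_trans Ls st; have sL := le_lt_trans st tL.
have [s1 s2] := rank_itv m Ls; have [t1 t2] := rank_itv m Lt.
have p0 : 0 < 2 ^+ m :> R by rewrite exprn_gt0.
have kst : (rank m s <= rank m t)%N.
  by apply: le_truncn; rewrite ler_pM2l// lerD2r.
have mid : `|w (dyadic L m (rank m t)) - w (dyadic L m (rank m s))| <=
    r ^+ m * (1 + 2 ^+ m * (t - s)).
  apply: (@le_trans _ _ (r ^+ m * ((rank m t)%:R - (rank m s)%:R))).
    rewrite -(telescope_sumr (fun k => w (dyadic L m k)) kst).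
    rewrite -(telescope_sumr (fun k => k%:R) kst) mulr_sumr.
    apply: le_trans (ler_norm_sum _ _ _) _.
    rewrite big_nat [leRHS]big_nat; apply: ler_sum => k /andP[_ kt].
    rewrite -natrB// subSnn mulr1; apply: w_dyadic => //.
    exact: ltn_trans kt (rank_lt m Lt tL).
  rewrite ler_wpM2l ?exprn_ge0 ?(ltW r0)//.
  rewrite -[(rank m s).+1]addn1 natrD in s2; rewrite mulrBr.
  rewrite !mulrDr in s2 t1; lra.
have close1 := rank_close Lt tL n0m; have close2 := rank_close Ls sL n0m.
rewrite (le_trans (ler_distD (w (dyadic L m (rank m t))) _ _))//.
have h := ler_distD (w (dyadic L m (rank m s))) (w (dyadic L m (rank m t))) (w s).
rewrite [`|w (dyadic L m (rank m s)) - w s|]distrC in h.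
have -> : r ^+ m * (2 / (1 - r) + 1 + 2 ^+ m * (t - s)) =
  r ^+ m / (1 - r) + (r ^+ m * (1 + 2 ^+ m * (t - s)) + r ^+ m / (1 - r)).
  by field; rewrite gt_eqF// subr_gt0.
by rewrite lerD// (le_trans h)// lerD.
Qed.

End dyadic_chaining.

(** * Increments of a path seen at the time scale [mu] *)

Section hoelder_smallness.
Context {R : realType}.

Definition hoelder_base (beta : R) : R := 2 `^ (- beta).

Lemma hoelder_base_gt0 beta : 0 < hoelder_base beta.
Proof. exact: powR_gt0. Qed.

Lemma hoelder_base_lt1 beta : 0 < beta -> hoelder_base beta < 1.
Proof.
move=> b0; rewrite /hoelder_base powRN invf_lt1 ?powR_gt0//.
apply: (@le_lt_trans _ _ (1 `^ beta)); first by rewrite powR1.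
apply: gt0_ltr_powR => //; rewrite ?nnegrE//.
by rewrite ltr1n.
Qed.

(** Here the bound 1/2 on the exponent enters: it is the condition under which the bad increments
    are summable. *)
Lemma hoelder_base_sqr beta : beta < 2^-1 -> 1 < 2 * hoelder_base beta ^+ 2.
Proof.
move=> b2; rewrite /hoelder_base -powR_mulrn ?powR_ge0// -powRrM.
rewrite -[X in X * _](powRr1 (_ : 0 <= 2))// -powRD; last by rewrite pnatr_eq0 implybT.
have s0 : 0 < 1 + - beta * 2 :> R by lra.
apply: (@le_lt_trans _ _ (1 `^ (1 + - beta * 2))); first by rewrite powR1.
apply: gt0_ltr_powR => //; rewrite ?nnegrE//.
by rewrite ltr1n.
Qed.

Lemma hoelder_baseX beta m : hoelder_base beta ^+ m = (2^-1 ^+ m) `^ beta.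
Proof.
rewrite /hoelder_base -powR_mulrn ?powR_ge0// -powRrM mulNr -mulrN mulrC powRrM.
by rewrite powR_invn// exprVn.
Qed.

Lemma dyadic_scale (mu : R) (n0 : nat) : 0 < mu -> mu < 2^-1 ^+ n0 ->
  exists m, [/\ (n0 <= m)%N, 2^-1 ^+ m.+1 < mu & mu <= 2^-1 ^+ m].
Proof.
move=> mu0 mun.
have h2 : 0 <= 2^-1 :> R by [].
have h2' : 2^-1 < 1 :> R by rewrite invf_lt1// ltr1n.
have ex : exists m, 2^-1 ^+ m < mu.
  have mu20 : 0 < mu / 2 by rewrite divr_gt0.
  have [N NP] := geometric_small 1 h2 h2' mu20.
  exists N; have := NP N (leqnn N); rewrite mul1r => /le_lt_trans; apply.
  by rewrite ltr_pdivrMr// ltr_pMr// ltr1n.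
case: (ex_minnP ex) => -[|m] mP mmin.
  have := lt_trans mP mun; rewrite expr0 ltNge exprn_ile1//.
  by rewrite ltW.
exists m; split=> //.
  rewrite leqNgt; apply/negP => mn.
  have := lt_trans mP mun; rewrite ltNge ler_wiXn2l//; exact: ltW.
by rewrite leNgt; apply/negP => /mmin; rewrite ltnn.
Qed.

(** Provides the hypothesis of [ou_small] with [D] of order [mu] to the power [beta]. For [s >= -1]
    this is chaining at scale [mu]. For older [s] only sublinear growth is available, but then
    [t - s >= 1] and the exponential factor is large enough to pay for the power of [mu]. *)
Lemma wiener_smallness (w : wpath R) (beta : R) : 0 < beta -> beta < 2^-1 ->
  (forall L : nat, exists n0, forall n, (n0 <= n)%N ->
    forall k, (k < 2 * L * 2 ^ n)%N ->
      `|w (dyadic L n k.+1) - w (dyadic L n k)| <= hoelder_base beta ^+ n) ->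
  w t / t @[t --> -oo] --> 0 ->
  forall T, 0 <= T -> exists C d, [/\ 0 < C, 0 < d &
    forall mu t s, 0 < mu -> mu < d -> 0 <= t -> t <= T -> s <= t ->
      `|w t - w s| <= C * mu `^ beta * expR ((t - s) / (2 * mu))].
Proof.
move=> b0 b2 H wg T T0.
(* [[-1, T]] must lie inside [[-L, L[]. *)
have [L LP] : exists L : nat, T + 1 < L%:R.
  by exists (Num.bound (T + 1)); apply: archi_boundP; rewrite addr_ge0.
have [n0 n0P] := H L.
set r := hoelder_base beta in n0P.
have r0 : 0 < r := hoelder_base_gt0 beta.
have r1 : r < 1 := hoelder_base_lt1 b0.
have cw := @wpath_continuous _ w.
have [B B0 BP] := @bounded_itv R R^o (w : R -> R^o) 0 T cw.
have [C1 [C10 C1P]] := sublinear_growth cw ltr01 wg.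
pose A := 2 / (1 - r) + 1.
have A1 : 1 <= A by rewrite /A lerDr divr_ge0// subr_ge0 ltW.
pose C := 2 * A / r + 4 * (B + C1).
have Ar0 : 0 < 2 * A / r by rewrite divr_gt0// mulr_gt0// (lt_le_trans ltr01).
have BC0 : 0 <= 4 * (B + C1) by rewrite mulr_ge0// addr_ge0// ltW.
exists C, (Num.min 4^-1 (2^-1 ^+ n0)); split.
- by rewrite /C ltr_wpDr.
- by rewrite lt_min; apply/andP; split; [rewrite invr_gt0|rewrite exprn_gt0// invr_gt0].
move=> mu t s mu0; rewrite lt_min => /andP[mu4 mun] t0 tT st.
pose v := (t - s) / (2 * mu).
have v0 : 0 <= v by rewrite divr_ge0 ?subr_ge0// mulr_ge0// ltW.
have E0 := expR_ge0 v; have P0 := powR_ge0 mu beta.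
rewrite /C mulrDl mulrDl -/v.
have [s1|s1] := leP (-1) s.
  apply: (@le_trans _ _ (2 * A / r * mu `^ beta * expR v)); last first.
    by rewrite lerDl; apply: mulr_ge0 => //; apply: mulr_ge0.
  (* [mu] lies between two consecutive powers of 1/2: the lower one bounds [r ^+ m] by the [beta]
     power of [mu] over [r], the upper one gives [2 ^+ m <= mu^-1]. *)
  have [m [n0m mum1 mum]] := dyadic_scale mu0 mun.
  have Ls : - L%:R <= s by lra.
  have tL : t < L%:R by lra.
  apply: (le_trans (dyadic_modulus cw r0 r1 n0P n0m Ls st tL)).
  have rm : r ^+ m <= mu `^ beta / r.
    rewrite ler_pdivlMr// -exprSr hoelder_baseX.
    by apply: ge0_ler_powR; rewrite ?nnegrE ?exprn_ge0 ?ltW.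
  have m2 : 2 ^+ m * (t - s) <= 2 * v.
    have -> : 2 * v = mu^-1 * (t - s) by rewrite /v; field; rewrite gt_eqF.
    rewrite ler_wpM2r ?subr_ge0// -[leLHS]invrK lef_pV2 ?posrE ?invr_gt0 ?exprn_gt0//.
    by rewrite -exprVn.
  apply: (@le_trans _ _ (mu `^ beta / r * (2 * A * expR v))); last first.
    by rewrite le_eqVlt; apply/orP; left; apply/eqP; ring.
  apply: ler_pM => //; first by rewrite exprn_ge0// ltW.
    by rewrite addr_ge0 ?mulr_ge0 ?exprn_ge0 ?subr_ge0// (le_trans ler01).
  have := expR_ge1Dx v => h.
  have : A * (1 + v) <= A * expR v by rewrite ler_wpM2l// (le_trans ler01).
  have : v <= A * v by rewrite ler_peMl.
  rewrite -/A; lra.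
apply: (@le_trans _ _ (4 * (B + C1) * mu `^ beta * expR v)); last first.
  by rewrite lerDr; apply: mulr_ge0 => //; apply: mulr_ge0 => //; exact: ltW.
have ts1 : 1 <= t - s by lra.
(* Since [mu < 1 / 4] and [t - s >= 1], the exponent [v] exceeds [t - s] by at least [1 / (4 * mu)],
   whose exponential is at least [1 / (4 * mu)]; this produces the factor [4 * mu]. *)
have big : expR (t - s) <= 4 * mu `^ beta * expR v.
  have mu1 : mu <= mu `^ beta by apply: ger1_powR; rewrite ?mu0/=; lra.
  apply: (@le_trans _ _ (4 * mu * expR v)); last first.
    by rewrite ler_wpM2r// ler_pM2l.
  have vE : (t - s) + 1 / (4 * mu) <= v.
    pose i := (4 * mu)^-1; have i1 : 1 <= i.
      by rewrite -[leLHS]invr1 lef_pV2 ?posrE ?mulr_gt0//; lra.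
    have -> : v = 2 * ((t - s) * i) by rewrite /v /i; field; rewrite gt_eqF.
    have h1 : t - s <= (t - s) * i by rewrite ler_peMr// (le_trans ler01).
    have h2 : i <= (t - s) * i by rewrite ler_peMl// (le_trans ler01).
    rewrite div1r -/i; lra.
  have : expR ((t - s) + 1 / (4 * mu)) <= expR v by rewrite ler_expR.
  rewrite expRD => h1.
  have h2 : 1 / (4 * mu) <= expR (1 / (4 * mu)).
    by rewrite (le_trans _ (expR_ge1Dx _))// lerDr.
  have h3 : expR (t - s) * (1 / (4 * mu)) <= expR v.
    by rewrite (le_trans _ h1)// ler_wpM2l// expR_ge0.
  by move: h3; rewrite mulrA mulr1 ler_pdivrMr ?mulr_gt0// mulrC.
apply: (@le_trans _ _ ((B + C1) * expR (t - s))).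
  rewrite (le_trans (ler_normB _ _))// mulrDl lerD//.
    have e1 : 1 <= expR (t - s) by rewrite -[leLHS]expR0 ler_expR; lra.
    by rewrite (le_trans (BP t _)) ?t0// ler_peMr// ltW.
  have s0 : s <= 0 by lra.
  rewrite (le_trans (C1P s s0))// ler_wpM2l// ler_expR; lra.
have BC1 : 0 <= B + C1 by rewrite addr_ge0// ltW.
apply: le_trans (ler_wpM2l BC1 big) _.
by rewrite le_eqVlt; apply/orP; left; apply/eqP; ring.
Qed.

End hoelder_smallness.

(** * The Wong-Zakai system *)

Section extension.
Context {R : realType} {U : topologicalType}.

(** Solutions are continuous only within a half-line. Composing with a retraction onto it makes them
    continuous on the line, as the integral calculus requires. *)
Lemma clamp_continuous (J : set R) (c : R -> R) (z : R -> U) : continuous c ->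
  (forall t, J (c t)) -> {within J, continuous z} -> continuous (fun t => z (c t)).
Proof.
move=> cc cJ /subspace_continuousP cz t; apply: cvg_trans (cz (c t) (cJ t)).
move=> A H.
exact: (@filterS _ (nbhs t) _ _ _ (fun s (Hs : J (c s) -> A (z (c s))) => Hs (cJ s))
  (@cc t _ H)).
Qed.

End extension.

Section wong_zakai.
Context {R : realType} {H1 H2 : completeNormedModType R}.
Variables (SA : R -> H1 -> H1) (SB : R -> H2 -> H2) (DA : set H1) (A : H1 -> H1).
Variables (gamma1 gamma2 : R) (f : H1 * H2 -> H1) (g : H1 * H2 -> H2) (K : R) (sigma : H1).
Hypotheses (gamma1_gt0 : 0 < gamma1) (gamma2_gt0 : 0 < gamma2).
Hypothesis A_gen : generates_semigroup DA A SA.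
Hypothesis SA_decay : forall t x, 0 <= t -> `|SA t x| <= expR (- gamma1 * t) * `|x|.
Hypothesis SB_group : C0_group SB.
Hypothesis SB_decay : forall t y, t <= 0 -> `|SB t y| <= expR (- gamma2 * t) * `|y|.
Hypotheses (f_cont : continuous f) (g_cont : continuous g) (f0 : f (0, 0) = 0) (K_gt0 : 0 < K).
Hypothesis f_lip : forall z1 z2, `|f z1 - f z2| <= K * sum_norm (z1 - z2).
Hypothesis g_lip : forall z1 z2, `|g z1 - g z2| <= K * sum_norm (z1 - z2).
Hypothesis sigma_dom : DA sigma.
Variables (rho eps : R).
Hypothesis eps_gt0 : 0 < eps.
Implicit Types (w : wpath R) (mu : R) (z : R -> H1 * H2).

Let SA_sg : C0_semigroup SA := proj1 A_gen.
Let ei0 : 0 <= eps^-1. Proof. by rewrite invr_ge0 ltW. Qed.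
Let ei_gt0 : 0 < eps^-1. Proof. by rewrite invr_gt0. Qed.

Let S1 := semigroup_ext SA eps^-1.

Let S1E t r x : r <= t -> S1 (t - r) x = SA ((t - r) / eps) x.
Proof. by move=> rt; rewrite /S1 /semigroup_ext max_r ?subr_ge0// mulrC. Qed.

Let S1_linear t : linear (S1 t).
Proof. exact: semigroup_ext_linear. Qed.

Let S1_continuous : continuous (fun p : R * H1 => S1 p.1 p.2).
Proof. exact: (semigroup_ext_continuous2 gamma1_gt0 SA_sg SA_decay). Qed.

Let S1_0 x : S1 0 x = x.
Proof. exact: semigroup_ext_le0. Qed.

Let S1D s t x : 0 <= s -> 0 <= t -> S1 (s + t) x = S1 s (S1 t x).
Proof. by move=> s0 t0; apply: semigroup_extD. Qed.

Let S1_contraction t x : `|S1 t x| <= `|x|.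
Proof. exact: (semigroup_ext_contraction gamma1_gt0 SA_decay). Qed.

Let S1_decay t x : 0 <= t -> `|S1 t x| <= expR (- (gamma1 * eps^-1) * t) * `|x|.
Proof. by move=> t0; apply: (semigroup_ext_decay SA_decay). Qed.

Let SB_linear t : linear (SB t). Proof. exact: group_linear. Qed.
Let SB_continuous := group_continuous2 gamma2_gt0 SB_group SB_decay.
Let SB_0 y : SB 0 y = y. Proof. exact: group0. Qed.
Let SB_D s t y : SB (s + t) y = SB s (SB t y). Proof. exact: groupD. Qed.
Let SB_bounded := group_bounded gamma2_gt0 SB_group SB_decay.

(* The noise as a part of the nonlinearity. *)
Definition forced (h : R -> R) (r : R) (v : H1 * H2) : H1 :=
  eps^-1 *: f v + (Num.sqrt eps)^-1 *: (h r *: sigma).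

Lemma forced_continuous (h : R -> R) : continuous h ->
  continuous (fun p : R * (H1 * H2) => forced h p.1 p.2).
Proof.
move=> ch p; apply: cvgD; apply: cvgZl_tmp.
  by apply: (cvg_comp snd f _ (f_cont (x := p.2))); exact: cvg_snd.
apply: cvgZr_tmp; apply: (cvg_comp fst h _ (ch p.1)); exact: cvg_fst.
Qed.

Lemma forced_lip (h : R -> R) t v v' :
  `|forced h t v - forced h t v'| <= eps^-1 * K * sum_norm (v - v').
Proof.
rewrite /forced opprD addrACA subrr addr0 -scalerBr normrZ gtr0_norm// -mulrA.
by rewrite ler_wpM2l.
Qed.

Lemma convol_forced (h : R -> R) z s t : continuous h -> continuous z -> s <= t ->
  convol S1 (fun r => forced h r (z r)) s t =
  eps^-1 *: r_int (fun r => SA ((t - r) / eps) (f (z r))) s t +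
  (Num.sqrt eps)^-1 *: r_int (fun r => h r *: SA ((t - r) / eps) sigma) s t.
Proof.
move=> ch cz st.
have cf : continuous (fun r => f (z r)).
  by move=> r; apply: continuous_comp; [exact: cz|exact: f_cont].
have c1 := convol_integrand_continuous S1_continuous (t := t) cf.
have c2 : continuous (fun r => h r *: S1 (t - r) sigma).
  move=> r; apply: cvgZ; first exact: ch.
  apply: (@convol_integrand_continuous _ _ S1 S1_continuous (fun=> sigma)).
  by move=> u; exact: cvg_cst.
rewrite (eq_r_int (psi := fun r => S1 (t - r) (f (z r))) st); last first.
  by move=> r /andP[_ rt]; rewrite S1E.
rewrite [X in _ + _ *: X](eq_r_int (psi := fun r => h r *: S1 (t - r) sigma) st); last first.
  by move=> r /andP[_ rt]; rewrite S1E.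
rewrite -!r_intZ// -r_intD; last 2 first.
  by move=> r; apply: cvgZl_tmp; exact: c1.
  by move=> r; apply: cvgZl_tmp; exact: c2.
apply: eq_r_intT => r.
by rewrite /forced (linear_funD _ _ (S1_linear _)) !(linear_funZ _ _ (S1_linear _)).
Qed.

Let mild_wz h := mild S1 SB (forced h) g.

Lemma mild_wong_zakai (J : set R) mu w z : 0 < mu -> w t / t @[t --> -oo] --> 0 ->
  continuous z ->
  mild_wz (ou mu w) J z <-> wong_zakai_solution SA SB f g sigma mu eps w J z.
Proof.
move=> mu0 wg cz; have co := ou_continuous mu0 wg.
have E s t : s <= t -> r_int (fun r => ((integrated_ou mu w)^`())%classic r *: SA ((t - r) / eps) sigma) s t =
    r_int (fun r => ou mu w r *: SA ((t - r) / eps) sigma) s t.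
  by move=> st; apply: eq_r_int => // r _; rewrite integrated_ou_deriv.
split.
  move=> H; split; first exact: continuous_subspaceT.
  move=> s t Js Jt st; have [-> ->] := H s t Js Jt st.
  by rewrite E// convol_forced// S1E// addrA.
move=> [_ H] s t Js Jt st; have [-> ->] := H s t Js Jt st.
by rewrite E// convol_forced// S1E// addrA.
Qed.

Lemma eq_wong_zakai (J : set R) mu w z z' : {within J, continuous z'} ->
  (forall s t r, J s -> J t -> s <= r <= t -> J r) ->
  (forall t, J t -> z t = z' t) ->
  wong_zakai_solution SA SB f g sigma mu eps w J z ->
  wong_zakai_solution SA SB f g sigma mu eps w J z'.
Proof.
move=> cz' Jconv zz' [_ H]; split=> // s t Js Jt st.
have [h1 h2] := H s t Js Jt st; rewrite -!zz'//; split.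
  rewrite h1; congr (_ + _ *: _ + _); apply: eq_r_int => // r str.
  by rewrite zz'//; exact: Jconv str.
rewrite h2; congr (_ + _); apply: eq_r_int => // r str.
by rewrite zz'//; exact: Jconv str.
Qed.

Lemma mild_shift c (F : R -> H1 * H2 -> H1) z :
  continuous (fun p : R * (H1 * H2) => F p.1 p.2) -> continuous z ->
  mild S1 SB F g setT z -> mild S1 SB (fun r => F (c + r)) g setT (fun t => z (c + t)).
Proof.
move=> cF cz H s t _ _ st.
have cFz : continuous (fun r => F r (z r)).
  move=> r; apply: (@continuous_comp R (R * (H1 * H2))%type H1 (fun t => (t, z t))
    (fun p => F p.1 p.2)); last exact: cF.
  by apply: (@cvg_pair _ _ _ _ (nbhs r) (nbhs (z r))); [exact: cvg_id|exact: cz].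
have cgz : continuous (fun r => g (z r)).
  by move=> r; apply: continuous_comp; [exact: cz|exact: g_cont].
have st' : c + s <= c + t by rewrite lerD2l.
have [-> ->] := H (c + s) (c + t) Logic.I Logic.I st'.
have -> : c + t - (c + s) = t - s by ring.
split; congr (_ + _); rewrite /convol.
  rewrite -(@r_int_shift _ _ (fun r => S1 (c + t - r) (F r (z r)))); last first.
    exact: (convol_integrand_continuous S1_continuous (t := c + t) cFz).
  apply: eq_r_intT => r.
  by have -> : c + t - (c + r) = t - r by ring.
rewrite -(@r_int_shift _ _ (fun r => SB (c + t - r) (g (z r)))); last first.
  exact: (convol_integrand_continuous SB_continuous (t := c + t) cgz).
apply: eq_r_intT => r.
by have -> : c + t - (c + r) = t - r by ring.
Qed.

Hypothesis rho_gap : K < gamma1 - rho.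
Hypothesis eps_lt : eps < rho / (gamma2 + (K^-1 - (gamma1 - rho)^-1)^-1).

Let a := gamma1 * eps^-1.
Let eta := rho / eps.
Let k1 := eps^-1 * K.

Let k1_gt0 : 0 < k1. Proof. exact: mulr_gt0. Qed.

Let gr0 : 0 < gamma1 - rho. Proof. exact: lt_trans rho_gap. Qed.

Let inv_gap : 0 < K^-1 - (gamma1 - rho)^-1.
Proof. by rewrite subr_gt0 ltf_pV2 ?posrE. Qed.

(** The hypothesis on [eps] solved for [rho / eps]. *)
Let eta_gap : (K^-1 - (gamma1 - rho)^-1)^-1 < eta - gamma2.
Proof.
have X0 : 0 < (K^-1 - (gamma1 - rho)^-1)^-1 by rewrite invr_gt0.
by rewrite ltrBrDl /eta ltr_pdivlMr// mulrC -ltr_pdivlMr// addr_gt0.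
Qed.

Let gamma2_eta : gamma2 < eta.
Proof. by rewrite -subr_gt0 (lt_trans _ eta_gap)// invr_gt0. Qed.

Let eta_a : eta < a.
Proof. by rewrite /eta /a ltr_pM2r// -subr_gt0. Qed.

Let q := k1 / (a - eta) + K / (eta - gamma2).

Let rho_gt : rho - eps * gamma2 != 0.
Proof.
have -> : rho - eps * gamma2 = eps * (eta - gamma2).
  by rewrite /eta; field; exact: lt0r_neq0.
by rewrite lt0r_neq0// mulr_gt0// subr_gt0.
Qed.

(** The contraction rate is the quantity subtracted from 1 in the constant of the theorem. *)
Let qE : q = K * ((gamma1 - rho)^-1 + eps / (rho - eps * gamma2)).
Proof.
rewrite /q /k1 /a /eta; field.
by apply/and3P; split; [exact: rho_gt|exact: lt0r_neq0 gr0|exact: lt0r_neq0].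
Qed.

Let q_lt1 : q < 1.
Proof.
have e0 : 0 < eta - gamma2 by rewrite subr_gt0.
have -> : q = K * ((gamma1 - rho)^-1 + (eta - gamma2)^-1).
  rewrite qE; congr (_ * (_ + _)).
  have -> : rho - eps * gamma2 = eps * (eta - gamma2).
    by rewrite /eta; field; exact: lt0r_neq0.
  by rewrite invfM mulVKf ?gt_eqF.
rewrite -ltr_pdivlMl// mulr1 -ltrBrDl.
by rewrite -[ltRHS]invrK ltf_pV2 ?posrE ?invr_gt0.
Qed.

Lemma slow_manifold_mild mu w z D : 0 < mu -> w t / t @[t --> -oo] --> 0 ->
  continuous z -> mild_wz (ou mu w) setT z ->
  (forall t, t <= 0 -> sum_norm (z t) <= D * expR (- eta * t)) ->
  slow_manifold SA SB f g sigma mu rho eps w (z 0).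
Proof.
move=> mu0 wg cz mz zD; exists z; split=> //.
  apply/(mild_wong_zakai _ mu0 wg cz) => s t _ _ st.
  exact: mz.
split; first exact: continuous_subspaceT.
have le_sup (h : R -> R) : (forall t, t <= 0 -> h t <= sum_norm (z t)) ->
    (ereal_sup [set (expR (rho / eps * t) * h t)%:E | t in `]-oo, 0%R]] <= D%:E)%E.
  move=> hz; apply: ge_ereal_sup => _ [t /= t0 <-].
  rewrite in_itv /= in t0; rewrite lee_fin -ler_pdivlMl ?expR_gt0// mulrC -expRN -mulNr.
  by rewrite (le_trans (hz t t0))// zD.
rewrite /Cminus_norm; apply: (@le_lt_trans _ _ (D%:E + D%:E)%E); last by rewrite -EFinD ltry.
by apply: leeD; apply: le_sup => t _; rewrite /sum_norm ?lerDl ?lerDr.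
Qed.

Lemma slow_manifold_orbit mu w zeta : 0 < mu -> w t / t @[t --> -oo] --> 0 ->
  slow_manifold SA SB f g sigma mu rho eps w zeta -> exists z D,
  [/\ continuous z, mild_wz (ou mu w) [set t | t <= 0] z, z 0 = zeta &
      forall t, t <= 0 -> sum_norm (z t) <= D * expR (- eta * t)].
Proof.
move=> mu0 wg [z [wz z0 [cz nz]]].
(* Frozen at its value at 0 for positive times, which leaves the equation on []-oo, 0]]
   untouched. *)
pose z' t := z (Num.min 0 t).
have cz' : continuous z'.
  apply: (@clamp_continuous _ _ `]-oo, 0%R] (fun t => Num.min 0 t)) => //.
    by move=> t; apply: continuous_min; [exact: cvg_cst|exact: cvg_id].
  by move=> t; rewrite /= in_itv /= ge_min lexx.
have zz' t : `]-oo, 0%R]%classic t -> z t = z' t.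
  by rewrite /= in_itv /= => t0; rewrite /z' min_r.
have itvE : `]-oo, 0%R]%classic = [set t : R | t <= 0].
  by apply/seteqP; split=> t /=; rewrite in_itv.
have mz' : mild_wz (ou mu w) `]-oo, 0%R] z'.
  apply/(mild_wong_zakai _ mu0 wg cz'); apply: eq_wong_zakai zz' wz.
    exact: continuous_subspaceT.
  by move=> s t r /=; rewrite !in_itv /= => s0 t0 /andP[_ rt]; exact: le_trans t0.
rewrite itvE in mz'.
have sup_le (h : R -> R) : (forall t, 0 <= h t) ->
    (ereal_sup [set (expR (rho / eps * t) * h t)%:E | t in `]-oo, 0%R]] < +oo)%E ->
    exists D, forall t, t <= 0 -> h t <= D * expR (- eta * t).
  move=> h0; set S := ereal_sup _ => Soo.
  have ubS t : t <= 0 -> ((expR (rho / eps * t) * h t)%:E <= S)%E.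
    by move=> t0; apply: ereal_sup_ubound; exists t => //=; rewrite in_itv.
  have Sfin : S \is a fin_num.
    rewrite ge0_fin_numE//; apply: le_trans (ubS 0 (lexx 0)).
    by rewrite lee_fin mulr_ge0// expR_ge0.
  exists (fine S) => t t0; have := ubS t t0; rewrite -(fineK Sfin) lee_fin.
  by rewrite -ler_pdivlMl ?expR_gt0// mulrC -expRN -mulNr.
rewrite /Cminus_norm in nz.
set N1 := ereal_sup _ in nz; set N2 := ereal_sup _ in nz.
have ge0 (h : R -> R) : (forall t, 0 <= h t) ->
    (0 <= ereal_sup [set (expR (rho / eps * t) * h t)%:E | t in `]-oo, 0%R]])%E.
  move=> h0; apply: (@le_trans _ _ (expR (rho / eps * 0) * h 0)%:E).
    by rewrite lee_fin mulr_ge0// expR_ge0.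
  by apply: ereal_sup_ubound; exists 0 => //=; rewrite in_itv /= lexx.
have N10 : (0 <= N1)%E by apply: (ge0 (fun t => `|(z t).1|)).
have N20 : (0 <= N2)%E by apply: (ge0 (fun t => `|(z t).2|)).
have [D1 D1P] : exists D, forall t, t <= 0 -> `|(z t).1| <= D * expR (- eta * t).
  by apply: sup_le => //; apply: le_lt_trans nz; rewrite leeDl.
have [D2 D2P] : exists D, forall t, t <= 0 -> `|(z t).2| <= D * expR (- eta * t).
  by apply: sup_le => //; apply: le_lt_trans nz; rewrite leeDr.
exists z', (D1 + D2); split=> //; first by rewrite /z' minxx.
move=> t t0; rewrite -zz' /= ?in_itv//= mulrDl.
by rewrite /sum_norm lerD// ?D1P ?D2P.
Qed.

(** [xget] returns some point of the manifold over [xi]; two orbits of admissible growth with the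
    same slow value at 0 coincide there, so that point is [x]. *)
Lemma slow_graphE mu w x xi : 0 < mu -> w t / t @[t --> -oo] --> 0 ->
  slow_manifold SA SB f g sigma mu rho eps w (x, xi) ->
  slow_graph SA SB f g sigma mu rho eps w xi = x.
Proof.
move=> mu0 wg Mx; rewrite /slow_graph; case: xgetP => [y _ /= My|/(_ x)//].
have [z [D [cz mz z0 zD]]] := slow_manifold_orbit mu0 wg Mx.
have [z' [D' [cz' mz' z0' zD']]] := slow_manifold_orbit mu0 wg My.
have co := ou_continuous mu0 wg.
suff : z' 0 = z 0 by rewrite z0 z0' => -[].
apply: (@mild_backward_unique _ _ _ S1 SB (forced (ou mu w)) g a gamma2 k1 K k1_gt0 K_gt0
  S1_linear S1_continuous S1_decay SB_linear SB_continuous SB_0 SB_D SB_bounded SB_decay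
  (forced_continuous co) (forced_lip _) g_cont g_lip eta gamma2_eta eta_a q_lt1 _ _ (D' + D)) => //.
  move=> t t0; rewrite (le_trans (sum_normD _ _))// sum_normN mulrDl.
  by rewrite lerD// ?zD ?zD'.
by rewrite z0 z0'.
Qed.

Lemma wong_zakai_tracking mu w zeta : 0 < mu ->
  (forall c, wiener_shift c w t / t @[t --> -oo] --> 0) ->
  w t / t @[t --> -oo] --> 0 -> ou mu w t / t @[t --> -oo] --> 0 ->
  exists zf zt : R -> H1 * H2,
  [/\ continuous zf /\ mild_wz (ou mu w) [set t | 0 <= t] zf, zf 0 = zeta,
      slow_manifold SA SB f g sigma mu rho eps w (zt 0),
      reduced_solution SA SB f g sigma mu rho eps w `[0, +oo[ zt &
      forall t, 0 <= t -> sum_norm (zf t - zt t) <=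
        (1 - K * ((gamma1 - rho)^-1 + eps / (rho - eps * gamma2)))^-1 *
        expR (- (rho / eps) * t) * sum_norm (zeta - zt 0)].
Proof.
move=> mu0 wgs wg og; have co := ou_continuous mu0 wg.
have cF := forced_continuous co.
have [zf [czf mzf zf_neg]] := mild_forward_exists k1_gt0 K_gt0 S1_linear S1_continuous S1_0 S1D
  S1_contraction SB_linear SB_continuous SB_0 SB_D SB_bounded cF (forced_lip _) g_cont g_lip zeta.
have zf0 : zf 0 = zeta by exact: zf_neg.
have eta0 : 0 < eta by exact: lt_trans gamma2_eta.
have [C [C0 CP]] := sublinear_growth co eta0 og.
(* The noise enters the Lyapunov-Perron operator through this bound: the Ornstein-Uhlenbeck path is
   sublinear, so it stays within the weight at -oo. *)
have growth r : r <= 0 -> `|forced (ou mu w) r 0| <=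
    (Num.sqrt eps)^-1 * C * `|sigma| * expR (- eta * r).
  move=> r0; rewrite /forced f0 scaler0 add0r 2!normrZ ger0_norm ?invr_ge0 ?sqrtr_ge0//.
  rewrite -!mulrA ler_wpM2l ?invr_ge0 ?sqrtr_ge0// [leLHS]mulrC [leRHS]mulrCA ler_wpM2l//.
  exact: CP.
have zf_neg' t : t <= 0 -> zf t = zf 0 by move=> t0; rewrite zf0; exact: zf_neg.
have [zt [czt mzt [D ztD] track]] := exponential_tracking gamma2_gt0 k1_gt0 K_gt0 S1_linear
  S1_continuous S1D S1_contraction S1_decay SB_linear SB_continuous SB_D SB_bounded SB_decay
  cF (forced_lip _) g_cont g_lip gamma2_eta eta_a q_lt1 czf mzf zf_neg' growth.
exists zf, zt; split=> //.
- exact: slow_manifold_mild ztD.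
- split; first exact: continuous_subspaceT.
  split; last by move=> s t _ _ st; have [_ ->] := mzt s t Logic.I Logic.I st.
  (* [zt c] is the value at time 0 of the orbit shifted by [c], which solves the system driven by
     the shifted path. Once its growth is checked, it lies on the manifold of that path. *)
  move=> c; rewrite /= in_itv /= andbT => c0; apply/esym; apply: slow_graphE => //.
  have cs : continuous (fun t => zt (c + t)).
    move=> t; apply: (@continuous_comp R R (H1 * H2)%type (fun t => c + t) zt).
      by apply: cvgD; [exact: cvg_cst|exact: cvg_id].
    exact: czt.
  have ms : mild_wz (ou mu (wiener_shift c w)) setT (fun t => zt (c + t)).
    have := mild_shift c cF czt mzt.
    rewrite (_ : (fun r => forced (ou mu w) (c + r)) = forced (ou mu (wiener_shift c w)))//.
    by apply/funext => r; apply/funext => v; rewrite /forced ou_shift.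
  (* The shift moves the times between 0 and [c] into the past; there the orbit is bounded by
     compactness, and before them by its own growth bound. *)
  have [B B0 BP] := @bounded_itv R R^o (fun t => sum_norm (zt t) : R^o) 0 c
    (sum_norm_continuous czt).
  rewrite -surjective_pairing; have -> : zt c = zt (c + 0) by rewrite addr0.
  apply: (@slow_manifold_mild mu (wiener_shift c w) (fun t => zt (c + t))
    (`|D| * expR (- eta * c) + B) mu0 (wgs c) cs ms) => t t0.
  have er : 1 <= expR (- eta * t) by rewrite -expR0 ler_expR mulNr oppr_ge0 pmulr_rle0.
  rewrite mulrDl; have [ct|ct] := leP (c + t) 0.
    rewrite (le_trans (ztD _ ct))// -mulrA -expRD -mulrDr.
    rewrite (le_trans (ler_wpM2r (expR_ge0 _) (ler_norm D)))// lerDl.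
    by rewrite mulr_ge0 ?expR_ge0// ltW.
  have := BP (c + t); rewrite (ltW ct) gerDl t0 => /(_ isT).
  rewrite ger0_norm ?sum_norm_ge0// => h; rewrite (le_trans h)//.
  rewrite (le_trans (_ : B <= B * expR (- eta * t)))//; first by rewrite ler_peMr// ltW.
  by rewrite lerDr !mulr_ge0 ?expR_ge0.
- by move=> t t0; have := track t t0; rewrite -/q qE zf0.
Qed.

(** The original solution solves the Wong-Zakai equation up to the difference [d] of the two
    stochastic convolutions. By parts, [d] is bounded by the uniform distance of the noises, and [M]
    depends neither on [mu] nor on the path. *)
Lemma original_wong_zakai_dist T : 0 <= T -> exists2 M, 0 < M &
  forall mu w (u zf : R -> H1 * H2) delta, 0 < mu -> w t / t @[t --> -oo] --> 0 ->
  original_solution SA SB f g sigma eps w `[0, +oo[ u -> u 0 = zf 0 ->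
  continuous zf -> mild_wz (ou mu w) [set t | 0 <= t] zf -> 0 <= delta ->
  (forall t, 0 <= t <= T -> `|w t - integrated_ou mu w t| <= delta) ->
  forall t, 0 <= t <= T -> sum_norm (u t - zf t) <= M * delta.
Proof.
move=> T0; have [M M0 MP] := mild_perturbation k1_gt0 K_gt0 S1_linear S1_continuous
  S1_contraction SB_linear SB_continuous SB_bounded g_cont g_lip T.
(* [2 * |sigma|] bounds the two boundary terms of the integration by parts, the other term the
   integral against [A sigma]. Below, [N + 1] keeps the constant positive when [sigma = 0]. *)
pose N := (Num.sqrt eps)^-1 * (2 * `|sigma| + eps^-1 * (`|A sigma| * T)).
have N0 : 0 <= N.
  by rewrite mulr_ge0 ?invr_ge0 ?sqrtr_ge0// addr_ge0 ?mulr_ge0.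
exists (M * (N + 1)); first by rewrite mulr_gt0// ltr_wpDl.
move=> mu w u zf delta mu0 wg [cu Hu] u0 czf mzf delta0 wd.
have co := ou_continuous mu0 wg.
pose u' t := u (Num.max 0 t).
have cu' : continuous u'.
  apply: (@clamp_continuous _ _ `[0, +oo[ (fun t => Num.max 0 t)) => //.
    exact: max0_continuous.
  by move=> t; rewrite /= in_itv /= le_max lexx.
have uE t : 0 <= t -> u' t = u t by move=> t0; rewrite /u' max_r.
pose d t := (Num.sqrt eps)^-1 *: (rs_int (fun r => SA ((t - r) / eps) sigma) w 0 t -
  r_int (fun r => ou mu w r *: SA ((t - r) / eps) sigma) 0 t).
have gen : h^-1 *: (SA h sigma - sigma) @[h --> 0^'+] --> A sigma.
  by case: A_gen => _ /(_ sigma (A sigma))[+ _]; apply.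
have cS t : continuous (fun r => S1 (t - r) sigma).
  apply: (@convol_integrand_continuous _ _ S1 S1_continuous (fun=> sigma)).
  by move=> r; exact: cvg_cst.
have cSA t : continuous (fun r => S1 (t - r) (A sigma)).
  apply: (@convol_integrand_continuous _ _ S1 S1_continuous (fun=> A sigma)).
  by move=> r; exact: cvg_cst.
have cw := @wpath_continuous _ w.
have pPhi := integrated_ou_primitive mu0 wg.
have cPhi : continuous (integrated_ou mu w : R -> R).
  exact: (is_primitive_continuous co pPhi).
have dE t : 0 <= t -> d t = (Num.sqrt eps)^-1 *:
    ((w t - integrated_ou mu w t) *: sigma -
     (w 0 - integrated_ou mu w 0) *: SA ((t - 0) / eps) sigma +
     eps^-1 *: r_int (fun r => (w r - integrated_ou mu w r) *: S1 (t - r) (A sigma)) 0 t).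
  move=> t0; rewrite /d; congr (_ *: _).
  have -> : r_int (fun r => ou mu w r *: SA ((t - r) / eps) sigma) 0 t =
      rs_int (fun r => SA ((t - r) / eps) sigma) (integrated_ou mu w) 0 t.
    rewrite (eq_r_int (psi := fun r => ou mu w r *: S1 (t - r) sigma) t0); last first.
      by move=> r /andP[_ rt]; rewrite S1E.
    rewrite -(rs_int_C1 t0 (cS t) co pPhi); apply: eq_rs_int => // r /andP[_ rt].
    by rewrite S1E.
  rewrite (rs_int_semigroup gamma1_gt0 SA_sg SA_decay eps_gt0 gen cw t0).
  rewrite (rs_int_semigroup gamma1_gt0 SA_sg SA_decay eps_gt0 gen cPhi t0).
  have -> : (fun r => (w r - integrated_ou mu w r) *: S1 (t - r) (A sigma)) =
      (fun r => w r *: S1 (t - r) (A sigma) - integrated_ou mu w r *: S1 (t - r) (A sigma)).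
    by apply/funext => r; rewrite scalerBl.
  rewrite r_intB; last 2 first.
    by move=> r; apply: cvgZ; [exact: cw|exact: cSA].
    by move=> r; apply: cvgZ; [exact: cPhi|exact: cSA].
  by zmod.
have d_le t : 0 <= t <= T -> `|d t| <= N * delta.
  move=> /andP[t0 tT]; rewrite dE// normrZ ger0_norm ?invr_ge0 ?sqrtr_ge0//.
  rewrite /N -mulrA ler_wpM2l ?invr_ge0 ?sqrtr_ge0//.
  have wt := wd t; rewrite t0 tT in wt; have {}wt := wt isT.
  have w0 := wd 0; rewrite lexx T0 in w0; have {}w0 := w0 isT.
  rewrite [leRHS]mulrDl (le_trans (ler_normD _ _))// lerD//.
    rewrite (le_trans (ler_normB _ _))// 2!normrZ.
    rewrite (_ : 2 * `|sigma| * delta = delta * `|sigma| + delta * `|sigma|); last by ring.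
    rewrite lerD// ?ler_wpM2r// ler_pM//.
    by rewrite -S1E//; exact: S1_contraction.
  rewrite normrZ gtr0_norm// -mulrA ler_pM2l//.
  have h : `|r_int (fun r => (w r - integrated_ou mu w r) *: S1 (t - r) (A sigma)) 0 t| <=
      delta * `|A sigma| * (t - 0).
    apply: norm_r_int_cst => //.
      move=> r; apply: cvgZ; last exact: cSA.
      by apply: cvgB; [exact: cw|exact: cPhi].
    move=> r /andP[r0 rt]; rewrite normrZ ler_pM//.
    by apply: wd; rewrite r0 (le_trans rt).
  rewrite (le_trans h)// subr0 -mulrA [leRHS]mulrC ler_wpM2l// ler_wpM2l//.
have it (t : R) : 0 <= t -> `[0, +oo[%classic t by move=> t0; rewrite /= in_itv /= t0.
move=> t tT; have /andP[t0 _] := tT.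
rewrite -uE// (le_trans (MP (forced (ou mu w)) zf u' d (N * delta) (forced_continuous co)
  (forced_lip _) czf cu' _ d_le _ _ t tT))//.
- by rewrite mulr_ge0.
- by move=> s /andP[s0 _]; have := mzf 0 s (lexx 0) s0 s0; rewrite subr0.
- move=> s /andP[s0 _]; have [h1 h2] := Hu 0 s (it 0 (lexx 0)) (it s s0) s0.
  rewrite uE// h1 h2 u0; split; last first.
    rewrite subr0; congr (_ + _); apply: eq_r_int => // r /andP[r0 _].
    by rewrite uE.
  rewrite convol_forced// /d -(S1E _ s0) subr0 -!addrA; congr (_ + (_ *: _ + _)).
    by apply: eq_r_int => // r /andP[r0 _]; rewrite uE.
  by rewrite -scalerDr addrC subrK.
- by rewrite -mulrA ler_pM2l// ler_wpM2r// lerDl.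
Qed.

End wong_zakai.

Lemma powR_littleo {R : realType} (r : R -> R) (C alpha beta : R) : 0 <= C -> alpha < beta ->
  (\forall mu \near 0^'+, `|r mu| <= C * mu `^ beta) ->
  (r : R -> R^o) =o_ (0^'+) (fun mu : R => mu `^ alpha : R^o).
Proof.
move=> C0 ab rC; apply/eqoP => e e0.
have C1 : 0 < C + 1 by rewrite ltr_wpDl.
have g0 : 0 < beta - alpha by rewrite subr_gt0.
have /cvgrPdist_le small := @powR_cvg0 R _ g0.
have {}small : \forall mu \near 0^'+, `|0 - mu `^ (beta - alpha)| <= e / (C + 1).
  by apply: small; rewrite divr_gt0.
near=> mu.
have mu0 : 0 < mu by near: mu; exact: nbhs_right_gt.
have rmu : `|r mu| <= C * mu `^ beta by near: mu; exact: rC.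
have smu : `|0 - mu `^ (beta - alpha)| <= e / (C + 1) by near: mu; exact: small.
rewrite sub0r normrN ger0_norm ?powR_ge0// ler_pdivlMr// in smu.
rewrite (le_trans rmu)// [leRHS](_ : _ = e * mu `^ alpha); last first.
  by rewrite ger0_norm ?powR_ge0.
rewrite -[beta in leLHS](subrK alpha) powRD; last by rewrite (gt_eqF mu0) implybT.
rewrite mulrA ler_wpM2r ?powR_ge0// (le_trans _ smu)// mulrC ler_wpM2l ?powR_ge0//.
by rewrite lerDl.
Unshelve. all: by end_near. Qed.

Theorem corollary2p10 (R : realType) (H1 H2 : completeNormedModType R)
  (hilb1 : is_hilbert H1) (hilb2 : is_hilbert H2)
  (sep1 : is_separable H1) (sep2 : is_separable H2)
  (DA : set H1) (A : H1 -> H1) (SA : R -> H1 -> H1)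
  (DB : set H2) (B : H2 -> H2) (SB : R -> H2 -> H2)
  (gamma1 gamma2 : R) (gamma1_gt0 : 0 < gamma1) (gamma2_gt0 : 0 < gamma2)
  (A_gen : generates_semigroup DA A SA)
  (SA_decay : forall t x, 0 <= t -> `|SA t x| <= expR (- gamma1 * t) * `|x|)
  (B_gen : generates_group DB B SB)
  (SB_decay : forall t y, t <= 0 -> `|SB t y| <= expR (- gamma2 * t) * `|y|)
  (f : H1 * H2 -> H1) (g : H1 * H2 -> H2) (K : R)
  (f_cont : continuous f) (g_cont : continuous g)
  (f0 : f (0, 0) = 0) (g0 : g (0, 0) = 0) (K_gt0 : 0 < K)
  (f_lip : forall z1 z2, `|f z1 - f z2| <= K * sum_norm (z1 - z2))
  (g_lip : forall z1 z2, `|g z1 - g z2| <= K * sum_norm (z1 - z2))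
  (K_lt_gamma1 : K < gamma1)
  (sigma : H1) (sigma_dom : DA sigma)
  (P : probability (wpath R) R) (P_wiener : is_wiener P)
  (Omega : set (wpath R)) (Omega_noise : noise_space P Omega)
  (rho eps : R) (rho_gt0 : 0 < rho) (rho_gap : K < gamma1 - rho)
  (eps_gt0 : 0 < eps)
  (eps_lt : eps < rho / (gamma2 + (K^-1 - (gamma1 - rho)^-1)^-1))
  (kappa_lt1 : kappa_star K gamma1 gamma2 rho eps < 1)
  (weps : R -> wpath R -> H1 * H2 -> H1 * H2)
  (weps_sol : forall w zeta, Omega w ->
     original_solution SA SB f g sigma eps w `[0, +oo[ (fun t => weps t w zeta)
     /\ weps 0 w zeta = zeta) :
  let C1 := (1 - K * ((gamma1 - rho)^-1 + eps / (rho - eps * gamma2)))^-1 in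
  let C2 := rho / eps in
  forall zeta : H1 * H2,
  exists (zbar : R -> wpath R -> H1 * H2) (wtilde : R -> R -> wpath R -> H1 * H2),
    (forall mu w, 0 < mu -> Omega w ->
       [/\ slow_manifold SA SB f g sigma mu rho eps w (zbar mu w),
           reduced_solution SA SB f g sigma mu rho eps w `[0, +oo[
             (fun t => wtilde mu t w) &
           wtilde mu 0 w = zbar mu w]) /\
    (forall alpha : R, 0 < alpha < 2^-1 ->
       {ae P, forall w, Omega w -> forall t, 0 <= t ->
          exists r : R -> R,
            (r : R -> R^o) =o_ (0^'+) (fun mu : R => mu `^ alpha : R^o) /\
            forall mu, 0 < mu ->
              sum_norm (weps t w zeta - wtilde mu t w)
              <= C1 * expR (- C2 * t) * sum_norm (zeta - zbar mu w) + r mu}).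
Proof.
move=> C1 C2 zeta.
case: Omega_noise => _ _ Oshift Ogrowth Oou.
have Ow w : Omega w -> w t / t @[t --> -oo] --> 0 by move=> /Ogrowth[].
have SB_group := proj1 B_gen.
(* The initial state and the reduced orbit must be functions of [mu] and of the path, hence a
   choice; off the admissible pairs the value is arbitrary. *)
have pick (p : R * wpath R) : exists s : (R -> H1 * H2) * (R -> H1 * H2), 0 < p.1 -> Omega p.2 ->
  [/\ continuous s.1 /\ mild (semigroup_ext SA eps^-1) SB (forced f sigma eps (ou p.1 p.2)) g
        [set t | 0 <= t] s.1,
      s.1 0 = zeta,
      slow_manifold SA SB f g sigma p.1 rho eps p.2 (s.2 0),
      reduced_solution SA SB f g sigma p.1 rho eps p.2 `[0, +oo[ s.2 &
      forall t, 0 <= t -> sum_norm (s.1 t - s.2 t) <=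
        C1 * expR (- C2 * t) * sum_norm (zeta - s.2 0)].
  have [[mu0 pO]|H] := pselect (0 < p.1 /\ Omega p.2); last first.
    by exists (fun=> 0, fun=> 0) => h1 h2; case: H.
  have [zf [zt H]] := wong_zakai_tracking sigma gamma1_gt0 gamma2_gt0 A_gen SA_decay SB_group
    SB_decay f_cont g_cont f0 K_gt0 f_lip g_lip eps_gt0 rho_gap eps_lt zeta mu0
    (fun c => Ow _ (Oshift c _ pO)) (Ow _ pO) (proj2 (Oou _ _ mu0 pO)).
  by exists (zf, zt).
have [s sP] := choice pick.
exists (fun mu w => (s (mu, w)).2 0), (fun mu t w => (s (mu, w)).2 t); split.
  by move=> mu w mu0 wO; have [] := sP (mu, w) mu0 wO.
move=> alpha /andP[alpha0 alpha2].
(* Halfway between [alpha] and 1/2: the gap to [alpha] turns [O] into [o], the gap to 1/2 gives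
   Hoelder continuity. *)
pose beta := (alpha + 2^-1) / 2.
have alpha_beta : alpha < beta by rewrite /beta; lra.
have beta2 : beta < 2^-1 by rewrite /beta; lra.
have beta0 : 0 < beta by exact: lt_trans alpha_beta.
have := ae_dyadic_increments P_wiener (hoelder_base_gt0 beta) (hoelder_base_sqr beta2).
apply: filterS => w dy wO t t0.
have [C [d [C0 d0 small]]] := wiener_smallness beta0 beta2 dy (Ow w wO) t0.
have [M M0 dist] := original_wong_zakai_dist gamma1_gt0 gamma2_gt0 A_gen SA_decay SB_group
  SB_decay f_cont g_cont K_gt0 f_lip g_lip sigma_dom eps_gt0 t0.
(* The remainder is the distance at time [t] between the original and the Wong-Zakai orbit of
   [zeta]; tracking accounts for the other term of the bound. *)
exists (fun mu => sum_norm (weps t w zeta - (s (mu, w)).1 t)); split; last first.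
  move=> mu mu0; have [_ _ _ _ track] := sP (mu, w) mu0 wO.
  rewrite (le_trans (sum_norm_dist _ _ ((s (mu, w)).1 t)))// addrC lerD//.
  exact: track.
(* [6 = 3 + 3]: the noises differ by two Ornstein-Uhlenbeck terms, at time 0 and at the current
   time, each bounded by [ou_small]. *)
apply: (@powR_littleo _ _ (M * (6 * C)) alpha beta) => //.
  by rewrite mulr_ge0 ?(ltW M0)// mulr_ge0 ?(ltW C0).
near=> mu.
have mu0 : 0 < mu by near: mu; exact: nbhs_right_gt.
have mud : mu < d by near: mu; exact: nbhs_right_lt.
have [[czf mzf] zf0 _ _ _] := sP (mu, w) mu0 wO.
have [orig weps0] := weps_sol w zeta wO.
have D0 : 0 <= C * mu `^ beta by rewrite mulr_ge0 ?powR_ge0// ltW.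
have ou_le r : 0 <= r <= t -> `|mu * ou mu w r| <= 3 * (C * mu `^ beta).
  move=> /andP[r0 rt]; apply: ou_small => //; first exact: Ow.
  by move=> s' s'r; exact: small.
rewrite ger0_norm ?sum_norm_ge0// -mulrA.
apply: (dist mu w (fun t => weps t w zeta) _ _ mu0 (Ow w wO) orig _ czf mzf) => //.
- by rewrite weps0 zf0.
- by rewrite -mulrA mulr_ge0.
- move=> r rt; rewrite distrC integrated_ou_dist//; last exact: Ow.
  rewrite (le_trans (ler_normB _ _))//.
  have -> : 6 * C * mu `^ beta = 3 * (C * mu `^ beta) + 3 * (C * mu `^ beta) by ring.
  by rewrite lerD// ou_le// lexx.
- by rewrite t0 lexx.
Unshelve. all: by end_near. Qed.
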